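(* Let $n$ be a positive multiple of $4$, $c_e\ge0$, $0<c_l\le c_L$, and $\varepsilon_n=c_e\sqrt{\log(n)/n}$. Let $F\in[0,1]^{n\times n}$ be a symmetric matrix and let $\sigma^*$ be a permutation of $\{1,\dots,n\}$ such that $[F_{\sigma^*(i)\sigma^*(j)}]_{i,j=1,\dots,n}$ is a toroidal R-matrix. Assume that $[F_{\sigma^*(i)\sigma^*(j)}]_{i,j}$ fulfills the following bi-Lipschitz condition with respect to the torus distance $d_n$ on $\{1,\dots,n\}$: for all $i,j,k\in\{1,\dots,n\}$, $$|F_{\sigma^*(i)\sigma^*(j)}-F_{\sigma^*(i)\sigma^*(k)}|\le c_L\frac{2\pi}{n}\,d_n(j,k)+\varepsilon_n,$$ $$F_{\sigma^*(i)\sigma^*(k)}-F_{\sigma^*(i)\sigma^*(j)}\ge c_l\frac{2\pi}{n}\big(d_n(i,j)-d_n(i,k)\big)-\varepsilon_n\quad\text{if } d_n(i,j)\ge d_n(i,k).$$ Suppose the observed random symmetric matrix $A$ satisfies $A_{ii}=0$ and $A_{ij}=F_{ij}+E_{ij}$ for $i<j$, where the centered independent variables $(E_{ij})_{i<j}$ satisfy the subGaussian(1) condition. Let $\hat x\in\mathcal C^n$ be the output of the Localize-and-Refine procedure applied to $A$, and let $\hat\sigma(i)=\lceil n\,\underline{\hat x}_i/(2\pi)\rceil$ for $i=1,\dots,n$, where $\underline{\hat x}_i\in(0,2\pi]$ is the argument of $\hat x_i$. Then there exists a constant $C_{lLe}>0$ depending only on $c_e,c_l,c_L$ such that, with probability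 at least $1-5/n^2$, $$\min_{\tau\in\Gamma_n}\ \max_{1\le i\le n}\ |\tau\circ\sigma^*(i)-\hat\sigma(i)|\le C_{lLe}\sqrt{n\log(n)},$$ where $\Gamma_n$ is the subgroup of permutations of $\{1,\dots,n\}$ generated by the circular permutations and the reverse permutation.
   Context: Torus distance on $\{1,\dots,n\}$: $d_n(i,j)=\min(|j-i|,n-|j-i|)$. A toroidal R-matrix is a symmetric matrix $B\in\mathbb R^{n\times n}$ such that (indices modulo $n$) $B_{i,j}\ge B_{i+1,j}$ when $d_n(i,j)<d_n(i+1,j)$ and $B_{i,j}\ge B_{i,j+1}$ when $d_n(i,j)<d_n(i,j+1)$. The circular permutations are the shifts $i\mapsto i+k$ modulo $n$, and the reverse permutation is $i\mapsto n+1-i$. $\mathcal C$ is the unit circle in $\mathbb R^2$, identified with unit complex numbers; $d(x,y)\in[0,\pi]$ is the geodesic (arc-length) distance on $\mathcal C$. For tuples $x,y$ of points of $\mathcal C$ indexed by the same set, $d_\infty(x,y)=\max_i d(x_i,y_i)$. For $k\ge1$: $\mathcal C_k=\{e^{\iota 2\pi j/k}:0\le j\le k-1\}$, and $\Pi_k$ is the set of $k$-tuples $(e^{\iota2\pi\sigma(j)/k})_{1\le j\le k}$, $\sigma$ a permutation of $\{1,\dots,k\}$ (similarly for tuples indexed by a set of cardinality $k$). $\mathcal O$ is the orthogonal group of $\mathbb R^2$, acting coordinatewise on tuples. SubGaussian(1) condition: for every $B\in\mathbb R^{n\times n}$ and $t\ge0$, $\mathbb P\big[\sum_{i<j}B_{ij}E_{ij}>t\sqrt{\sum_{i<j}B_{ij}^2}\big]\le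 e^{-t^2/2}$. Localize-and-Refine procedure. Let $n_0=n/4$. For index sets, $A_{SS'}=[A_{ij}]_{i\in S,j\in S'}$, $\bar S=\{1,\dots,n\}\setminus S$; $\langle\cdot,\cdot\rangle$ is the entrywise (Frobenius) scalar product; $D(x_S)=[d(x_i,x_j)]_{i,j\in S}$, $D(z,x_S)=[d(z,x_j)]_{j\in S}$. (A) Draw $S\subset\{1,\dots,n\}$, $|S|=n_0$, uniformly at random. Compute $\hat x^{(1)}_S\in\arg\min_{x_S\in\Pi_{n_0}}\langle A_{SS},D(x_S)\rangle$, and for each $i\in\bar S$, $\hat x^{(2)}_i\in\arg\min_{z\in\mathcal C_{n_0}}\langle A_{i,S},D(z,\hat x^{(1)}_S)\rangle$. (B) Draw $S'\subset\bar S$, $|S'|=n_0$, uniformly at random. Compute $\hat x^{(1')}_{S'}\in\arg\min_{x_{S'}\in\Pi_{n_0}}\langle A_{S'S'},D(x_{S'})\rangle$ and for $i\in\bar S'$, $\hat x^{(2')}_i\in\arg\min_{z\in\mathcal C_{n_0}}\langle A_{i,S'},D(z,\hat x^{(1')}_{S'})\rangle$. (C) Compute $\hat Q\in\arg\min_{Q\in\mathcal O}d_\infty(\hat x^{(2)}_{\bar S\cap\bar S'},Q\hat x^{(2')}_{\bar S\cap\bar S'})$. Output $\hat x$ with $\hat x_j=\hat x^{(2)}_j$ for $j\in\bar S$ and $\hat x_j=\hat Q\hat x^{(2')}_j$ for $j\in S$.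
   Formalization: The conclusion is proved with the inverse permutation of σ* in place of σ*, and with the torus distance d_n in place of the absolute value; as printed it fails (σ* maps positions to items, and ranks of items near the angle 0=2π jump between 1 and n). *)

(* Defs.v *)
From HB Require Import structures.
From mathcomp Require Import all_boot all_order all_algebra all_fingroup.
From mathcomp Require Import all_classical all_reals all_analysis.

Set Implicit Arguments.
Unset Strict Implicit.
Unset Printing Implicit Defensive.

Import Order.TTheory GRing.Theory Num.Theory.
Import numFieldNormedType.Exports.

Local Open Scope classical_set_scope.
Local Open Scope ring_scope.

(* The index set {1, ..., n} is encoded by 'I_n = {0, ..., n-1}: the index i of
   the text is the ordinal of value i - 1. *)

(* The torus distance only depends on |j - i|, so it can be applied both to
   0-based ordinals and to 1-based labels. *)
Definition torus_dist (n i j : nat) : nat := (minn `|i - j| (n - `|i - j|))%N.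

(* ordS is the successor modulo n. *)
Definition toroidal_R_matrix (R : realType) (n : nat) (B : 'M[R]_n) : Prop :=
  [/\ B^T = B,
      forall i j : 'I_n,
        (torus_dist n i j < torus_dist n (ordS i) j)%N -> B (ordS i) j <= B i j
    & forall i j : 'I_n,
        (torus_dist n i j < torus_dist n i (ordS j))%N -> B i (ordS j) <= B i j].

Definition bi_lipschitz (R : realType) (n : nat) (c_l c_L eps : R)
    (B : 'M[R]_n) : Prop :=
  (forall i j k : 'I_n,
     `|B i j - B i k| <= c_L * (2 * pi / n%:R) * (torus_dist n j k)%:R + eps) /\
  (forall i j k : 'I_n, (torus_dist n i k <= torus_dist n i j)%N ->
     c_l * (2 * pi / n%:R) * ((torus_dist n i j)%:R - (torus_dist n i k)%:R) - eps
       <= B i k - B i j).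

Definition circular_perm (n : nat) (s : {perm 'I_n}) : bool :=
  [exists k : 'I_n, [forall i : 'I_n, (s i == (i + k) %% n :> nat)%N]].

(* In 0-based indices the reversal i |-> n + 1 - i is i |-> n - 1 - i. *)
Definition reverse_perm (n : nat) (s : {perm 'I_n}) : bool :=
  [forall i : 'I_n, s i == rev_ord i].

Definition Gamma (n : nat) : {set {perm 'I_n}} :=
  <<[set s | circular_perm s] :|: [set s | reverse_perm s]>>%g.

Section Circle.
Variable R : realType.
Implicit Types x y z : 'cV[R]_2.

Definition cis (t : R) : 'cV[R]_2 :=
  \col_(k < 2) (if k == 0 then cos t else sin t).

Definition circle : set 'cV[R]_2 := [set x | x 0 0 ^+ 2 + x 1 0 ^+ 2 = 1].

(* Geodesic distance: the angle in [0, pi] between two unit vectors. *)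
Definition gdist x y : R := acos (x 0 0 * y 0 0 + x 1 0 * y 1 0).

(* Argument in ]0, 2 pi]. *)
Definition arg x : R :=
  xget 0 [set t : R | 0 < t <= 2 * pi /\ cis t = x].

(* Rank, in {1, ..., n}, of a point of the circle. *)
Definition rank_of (n : nat) x : nat :=
  `|Num.ceil (n%:R * arg x / (2 * pi))|%N.

Definition circle_grid (k : nat) : set 'cV[R]_2 :=
  [set z | exists2 j : nat, (j < k)%N & z = cis (2 * pi * j%:R / k%:R)].

Definition orthogonal_group : set 'M[R]_2 := [set Q | Q *m Q^T = 1%:M].

(* A tuple x_S of points indexed by S is encoded by a function on all of 'I_n
   whose values outside S are irrelevant. *)
Definition config (n : nat) := 'I_n -> 'cV[R]_2.

Definition d_inf (n : nat) (T : {set 'I_n}) (x y : config n) : R :=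
  \big[Num.max/0]_(i in T) gdist (x i) (y i).

(* Pi_k for tuples indexed by S, k = #|S|: an injection of S into {1, ..., #|S|}
   is a bijection. *)
Definition Pi_grid (n : nat) (S : {set 'I_n}) : set (config n) :=
  [set x | exists s : 'I_n -> nat, {in S &, injective s} /\
     forall i, i \in S ->
       (0 < s i <= #|S|)%N /\ x i = cis (2 * pi * (s i)%:R / #|S|%:R)].

End Circle.

Definition is_argmin (R : realType) (T : Type) (D : set T) (f : T -> R) (x : T)
  : Prop := D x /\ forall y, D y -> f x <= f y.

Section LocalizeAndRefine.
Variables (R : realType) (n : nat).
Implicit Types (S T : {set 'I_n}) (A M : 'M[R]_n) (x : config R n).

(* The submatrix A_{ST} and the subtuple x_S, padded with zeros: a map applied
   to them depends on these blocks only. *)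
Definition block S T A : 'M[R]_n :=
  \matrix_(i, j) (if (i \in S) && (j \in T) then A i j else 0).

Definition subtuple S x : config R n := fun i => if i \in S then x i else 0.

(* <M_{SS}, D(x_S)> and <M_{i,S}, D(z, x_S)>. *)
Definition loc_cost S M x : R :=
  \sum_(i in S) \sum_(j in S) M i j * gdist (x i) (x j).

Definition ref_cost S (i : 'I_n) M x (z : 'cV[R]_2) : R :=
  \sum_(j in S) M i j * gdist z (x j).

(* Borel sets of R^(n x n). *)
Definition mx_borel : set (set 'M[R]_n) :=
  <<s [set G | exists (i j : 'I_n) (B : set R),
        measurable B /\ G = [set M : 'M[R]_n | B (M i j)]] >>.

(* Minimizers are not unique, so an implementation of "compute an element of
   the arg min" comes with tie-breaking rules, which may be arbitrary Borel
   functions of the data of the minimization problem.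
   loc S (A_SS) is the minimizer over Pi_{n0};
   ref S i A_{i,S} x_S is the minimizer over the grid C_{n0}. *)
Record localizer (n0 : nat) := Localizer {
  loc : {set 'I_n} -> 'M[R]_n -> config R n ;
  ref : {set 'I_n} -> 'I_n -> 'M[R]_n -> config R n -> 'cV[R]_2 ;
  locP : forall S M, #|S| = n0 ->
    is_argmin (Pi_grid S) (loc_cost S M) (loc S M) ;
  refP : forall S i M x, #|S| = n0 ->
    is_argmin (circle_grid n0) (ref_cost S i M x) (ref S i M x) ;
  loc_borel : forall S, #|S| = n0 -> forall i, i \in S ->
    forall v, mx_borel [set M | loc S M i = v] ;
  ref_borel : forall S, #|S| = n0 -> forall i x v,
    mx_borel [set M | ref S i M x = v] }.

(* Tie-breaking rule for step (C). *)
Record aligner := Aligner {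
  align : {set 'I_n} -> config R n -> config R n -> 'M[R]_2 ;
  alignP : forall T x x',
    (forall i, i \in T -> circle (x i) /\ circle (x' i)) ->
    is_argmin (@orthogonal_group R) (fun Q => d_inf T x (fun i => Q *m x' i))
      (align T x x') }.

(* The estimators x^(2)_i of step (A) (and of step (B), with S' for S),
   meant for i outside S. *)
Definition half_estimate n0 (K : localizer n0) A S : config R n :=
  let x1 := loc K S (block S S A) in
  fun i => ref K S i (block [set i] S A) (subtuple S x1).

Definition localize_and_refine n0 (K K' : localizer n0) (al : aligner)
    A S S' : config R n :=
  let x2 := half_estimate K A S in
  let x2' := half_estimate K' A S' in
  let T := ~: S :&: ~: S' in
  let Q := align al T (subtuple T x2) (subtuple T x2') in
  fun j => if j \in S then Q *m x2' j else x2 j.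

End LocalizeAndRefine.

Section Noise.
Context d (Omega : measurableType d) (R : realType) (P : probability Omega R).
Variable n : nat.
Implicit Type E : 'I_n -> 'I_n -> {RV P >-> R}.

(* Mutual independence of (E_ij)_{i<j}; since the family is finite, taking
   some of the B i j to be setT gives the product rule of every subfamily. *)
Definition independent_noise E : Prop :=
  forall B : 'I_n -> 'I_n -> set R, (forall i j, measurable (B i j)) ->
    P [set w | forall i j : 'I_n, (i < j)%N -> B i j (E i j w)] =
    (\prod_(ij : 'I_n * 'I_n | (ij.1 < ij.2)%N)
        P (E ij.1 ij.2 @^-1` B ij.1 ij.2))%E.

Definition centered_noise E : Prop :=
  forall i j : 'I_n, (i < j)%N -> 'E_P[E i j]%E = 0%E.

Definition subgaussian1 E : Prop :=
  forall (B : 'M[R]_n) (t : R), 0 <= t ->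
    (P [set w | (\sum_(i < n) \sum_(j < n | (i < j)%N) B i j * E i j w) >
               t * Num.sqrt (\sum_(i < n) \sum_(j < n | (i < j)%N) B i j ^+ 2)]%R
     <= (expR (- t ^+ 2 / 2))%:E)%E.

(* The sigma-algebra generated by (E_ij)_{i<j}. *)
Definition noise_events E : set (set Omega) :=
  <<s [set G | exists (i j : 'I_n) (B : set R),
        [/\ (i < j)%N, measurable B & G = E i j @^-1` B]] >>.

(* S is uniform among the n0-subsets, independently of the noise; given S and
   the noise, S' is uniform among the n0-subsets of the complement of S. *)
Record uniform_draws E (n0 : nat) (S S' : Omega -> {set 'I_n}) : Prop := {
  draws_card : forall w,
    [/\ #|S w| = n0, #|S' w| = n0 & S' w \subset ~: S w] ;
  draw1_measurable : forall s, measurable (S @^-1` [set s]) ;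
  draw2_measurable : forall s, measurable (S' @^-1` [set s]) ;
  draw1_law : forall (s : {set 'I_n}) G, #|s| = n0 -> noise_events E G ->
    (P (G `&` S @^-1` [set s]) = ('C(n, n0)%:R^-1)%:E * P G)%E ;
  draw2_law : forall (s s' : {set 'I_n}) G, #|s| = n0 -> #|s'| = n0 -> s' \subset ~: s ->
    noise_events E G ->
    (P (G `&` S @^-1` [set s] `&` S' @^-1` [set s']) =
     ('C(n - n0, n0)%:R^-1)%:E * P (G `&` S @^-1` [set s]))%E }.

End Noise.

(* Main.v *)
(* Localization: for every row i, the map j |-> F i j + c_l d(i, j)
   is still nearly decreasing in d(i, j). As the distances
   (d(x_i, x_j))_j are a permutation of the true ones, the rearrangement
   inequality bounds <F, D(x) - D(x_star)> from below by
   (c_l / 2) |D(x) - D(x_star)|^2, up to errors that are small multiples of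
   |D(x) - D(x_star)|. Comparing with the noise gives a mean error of order
   sqrt(n log n) on the distances, and two well chosen anchors turn it into a
   mean error on the positions themselves, up to a dihedral isometry.
   Refinement: the same rearrangement argument, applied to the single row of an
   item outside the sample, bounds the error of that item; its noise is
   independent of the localization of the sample.
   Alignment: both half-estimates are close to isometric images of the truth;
   an alignment with the wrong orientation would make the doubled angles of n/2
   distinct positions nearly equal.
   Sampling: the law of a uniform n/4-subset is dominated, up to the factor n+1,
   by that of n independent draws of probability 1/4, so a Chernoff bound
   controls the ranks of the positions within the sample.
   The whole argument works on the discrete tori Z/n and Z/(n/4). *)
Require Import Defs.
From HB Require Import structures.
From mathcomp Require Import all_boot all_order all_algebra all_fingroup.
From mathcomp Require Import all_classical all_reals all_analysis.
From mathcomp Require Import measurable_realfun.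
From mathcomp Require Import zify ring lra.
Import Order.TTheory GRing.Theory Num.Theory.
Import numFieldNormedType.Exports.
Set Implicit Arguments.
Unset Strict Implicit.
Unset Printing Implicit Defensive.
Local Open Scope classical_set_scope.
Local Open Scope ring_scope.

(** * Discrete tori and their isometries *)

(** The localized sample depends on the very noise it has to beat, so that noise is controlled
    uniformly over all [m ^ (2 n)] pairs of index maps; this costs a level of order [sqrt (n log n)]
    relative to the Frobenius norm. The noise between the sample and the other items is independent
    of the localization: once the sample indices are frozen, at most [n ^ 3] comparisons remain and
    the level drops to [sqrt (log n)]. The torus of the sample is four times coarser than that of
    the items: the sampled item of rank [a] sits within [eta] of position [4 a], with [eta] of order
    [sqrt (n log n)]. This mismatch and [eps] make the monotonicity approximate, with a slack
    [kappa] such that [kappa * m] is again of order [sqrt (n log n)], so it does not spoil the rate.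
    Distances determine positions only up to a dihedral map, so each half-estimate carries its own
    unknown isometry, and the overlap of the two has to reveal the relative one. Small [n] are
    harmless: if [n] is at most [C sqrt (n log n)] the bound is trivial. The constant [C] is
    therefore sized so that the remaining [n] leave room for all other steps. *)

Lemma torus_distE n i j :
  torus_dist n i j = minn ((i - j) + (j - i)) (n - ((i - j) + (j - i))).
Proof. rewrite /torus_dist; lia. Qed.

Lemma torus_distC n i j : torus_dist n i j = torus_dist n j i.
Proof. by rewrite !torus_distE addnC. Qed.

Lemma torus_dist0 n i : torus_dist n i i = 0%N.
Proof. by rewrite torus_distE; lia. Qed.

Lemma torus_dist_double n i j : (2 * torus_dist n i j <= n)%N.
Proof. rewrite torus_distE; lia. Qed.

Lemma torus_dist_triangle n i j k : (i <= n)%N -> (j <= n)%N -> (k <= n)%N ->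
  (torus_dist n i k <= torus_dist n i j + torus_dist n j k)%N.
Proof. rewrite !torus_distE; lia. Qed.

Lemma torus_dist_le n i j : (torus_dist n i j <= n)%N.
Proof. by have := torus_dist_double n i j; lia. Qed.

Lemma torus_dist_le_dist n i j : (torus_dist n i j <= (i - j) + (j - i))%N.
Proof. rewrite torus_distE; lia. Qed.

Lemma torus_dist_le_codist n i j : (torus_dist n i j <= n - ((i - j) + (j - i)))%N.
Proof. rewrite torus_distE; lia. Qed.

Lemma torus_dist_scale m i j :
  torus_dist (4 * m) (4 * i) (4 * j) = (4 * torus_dist m i j)%N.
Proof. rewrite !torus_distE; lia. Qed.

(** In each case the distance obeys linear equations, so later proofs can generalize it to a
    variable and leave the rest to [lia]. *)
Lemma torus_dist_cases n i j : (i <= n)%N -> (j <= n)%N ->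
  [\/ (i <= j)%N /\ (2 * torus_dist n i j <= n)%N /\ (torus_dist n i j + i = j)%N,
      (i <= j)%N /\ (2 * torus_dist n i j <= n)%N /\ (torus_dist n i j + j = n + i)%N,
      (j <= i)%N /\ (2 * torus_dist n i j <= n)%N /\ (torus_dist n i j + j = i)%N |
      (j <= i)%N /\ (2 * torus_dist n i j <= n)%N /\ (torus_dist n i j + i = n + j)%N].
Proof.
move=> hi hj; have [ij|ij] := leqP i j; have [h|h] := leqP (2 * ((i - j) + (j - i))) n.
- by apply: Or41; rewrite torus_distE; lia.
- by apply: Or42; rewrite torus_distE; lia.
- by apply: Or43; rewrite torus_distE; lia.
- by apply: Or44; rewrite torus_distE; lia.
Qed.

(** Points at equal distances from [0] are equal or mirror images; an anchor [c] away from both [0]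
    and its antipode breaks the tie. The factor 3 suffices for every anchor at distance between
    [m/8] and [3m/8]. *)
Lemma two_point_sep0 m c u v :
  (c < m)%N -> (u < m)%N -> (v < m)%N ->
  (m <= 8 * torus_dist m 0 c)%N -> (8 * torus_dist m 0 c <= 3 * m)%N ->
  (torus_dist m u v <=
   3 * ((torus_dist m u 0 - torus_dist m v 0) + (torus_dist m v 0 - torus_dist m u 0)
      + ((torus_dist m u c - torus_dist m v c) + (torus_dist m v c - torus_dist m u c))))%N.
Proof.
move=> hc hu hv.
have := @torus_dist_cases m 0 c (leq0n _) (ltnW hc).
have := @torus_dist_cases m u 0 (ltnW hu) (leq0n _).
have := @torus_dist_cases m v 0 (ltnW hv) (leq0n _).
have := @torus_dist_cases m u c (ltnW hu) (ltnW hc).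
have := @torus_dist_cases m v c (ltnW hv) (ltnW hc).
have := @torus_dist_cases m u v (ltnW hu) (ltnW hv).
move: (torus_dist m 0 c) (torus_dist m u 0) (torus_dist m v 0)
  (torus_dist m u c) (torus_dist m v c) (torus_dist m u v) => tc tu tv tuc tvc tuv.
move=> huv hvc huc hv0 hu0 hc0 h1 h2.
case: hc0 => [[c1 [c2 c3]]|[c1 [c2 c3]]|[c1 [c2 c3]]|[c1 [c2 c3]]]; try (exfalso; lia);
case: hu0 => [[u1 [u2 u3]]|[u1 [u2 u3]]|[u1 [u2 u3]]|[u1 [u2 u3]]]; try (exfalso; lia);
case: hv0 => [[v1 [v2 v3]]|[v1 [v2 v3]]|[v1 [v2 v3]]|[v1 [v2 v3]]]; try (exfalso; lia);
case: huc => [[a1 [a2 a3]]|[a1 [a2 a3]]|[a1 [a2 a3]]|[a1 [a2 a3]]]; try (exfalso; lia);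
case: hvc => [[b1 [b2 b3]]|[b1 [b2 b3]]|[b1 [b2 b3]]|[b1 [b2 b3]]]; try (exfalso; lia);
case: huv => [[d1 [d2 d3]]|[d1 [d2 d3]]|[d1 [d2 d3]]|[d1 [d2 d3]]]; try (exfalso; lia);
lia.
Qed.

Lemma torus_dist_eq0 n i j : (i < n)%N -> (j < n)%N -> torus_dist n i j = 0%N -> i = j.
Proof. rewrite torus_distE; lia. Qed.

Lemma modn_cases n x : (x < 2 * n)%N ->
  ((x %% n = x /\ x < n) \/ (x = x %% n + n /\ n <= x))%N.
Proof.
move=> h; case: (ltnP x n) => hx; [left|right]; split=> //; first by rewrite modn_small.
have -> : x = (x - n + n)%N by lia.
by rewrite modnDr modn_small; lia.
Qed.

(** The disjunction lists equal or opposite differences, possibly after one turn around the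
    torus. *)
Lemma torus_dist_eq n x y x' y' :
  (x + y' = x' + y \/ x + x' = y + y' \/
   (x <= n /\ y <= n /\ x' <= n /\ y' <= n /\
    (x + y' = x' + y + n \/ x + y' + n = x' + y
     \/ x + x' = y + y' + n \/ x + x' + n = y + y')))%N ->
  torus_dist n x y = torus_dist n x' y'.
Proof.
rewrite !torus_distE => h.
have [e|[e ?]] : ((x - y) + (y - x) = (x' - y') + (y' - x') \/
   (x - y) + (y - x) = n - ((x' - y') + (y' - x')) /\
   (x' - y') + (y' - x') <= n)%N by lia.
- by rewrite e.
- by rewrite e subKn // minnC.
Qed.

Lemma torus_dist_modl n k i j : (k < n)%N -> (i < n)%N -> (j < n)%N ->
  torus_dist n ((k + i) %% n)%N ((k + j) %% n)%N = torus_dist n i j.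
Proof.
move=> hk hi hj; apply: torus_dist_eq.
have h1 := @modn_cases n (k + i); have h2 := @modn_cases n (k + j).
move: ((k + i) %% n)%N ((k + j) %% n)%N h1 h2 => x y h1 h2.
by case: h1 => [|[? ?]|[? ?]]; try lia; case: h2 => [|[? ?]|[? ?]]; lia.
Qed.

Lemma torus_dist_modr n k i j : (k < n)%N -> (i < n)%N -> (j < n)%N ->
  torus_dist n ((k + (n - i)) %% n)%N ((k + (n - j)) %% n)%N = torus_dist n i j.
Proof.
move=> hk hi hj; apply: torus_dist_eq.
have h1 := @modn_cases n (k + (n - i)); have h2 := @modn_cases n (k + (n - j)).
move: ((k + (n - i)) %% n)%N ((k + (n - j)) %% n)%N h1 h2 => x y h1 h2.
by case: h1 => [|[? ?]|[? ?]]; try lia; case: h2 => [|[? ?]|[? ?]]; lia.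
Qed.

Lemma torus_dist_val n i j d : (2 * d <= n)%N ->
  (i + d = j \/ j + d = i \/ i + d = j + n \/ j + d = i + n)%N -> torus_dist n i j = d.
Proof. by move=> hd; rewrite torus_distE => -[|[|[|]]] h; lia. Qed.

(** The reflections [x |-> k - x] are written with [m - x] to avoid truncated subtraction. *)
Definition dihedral (m : nat) (g : 'I_m -> 'I_m) : Prop :=
  exists k : 'I_m, (forall x, g x = (k + x) %% m :> nat)%N \/
                   (forall x, g x = (k + (m - x)) %% m :> nat)%N.

Lemma dihedral_iso m (g : 'I_m -> 'I_m) x y : dihedral g ->
  torus_dist m (g x) (g y) = torus_dist m x y.
Proof.
by case=> k [] h; rewrite !h; [apply: torus_dist_modl | apply: torus_dist_modr]; apply: ltn_ord.
Qed.

Lemma iso_inj m (g : 'I_m -> 'I_m) :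
  (forall x y, torus_dist m (g x) (g y) = torus_dist m x y) -> injective g.
Proof.
move=> h x y e; apply: ord_inj; apply: (@torus_dist_eq0 m) => //.
by rewrite -h e torus_dist0.
Qed.

Lemma dihedral_inj m (g : 'I_m -> 'I_m) : dihedral g -> injective g.
Proof. by move=> hg; apply: iso_inj => x y; exact: dihedral_iso. Qed.

Lemma mod_map_exists m (f : nat -> nat) : (0 < m)%N -> exists g : 'I_m -> 'I_m,
  forall x : 'I_m, (g x = f x %% m :> nat)%N.
Proof.
move=> m0; exists (fun x => Ordinal (ltn_pmod (f x) m0)); done.
Qed.

Lemma rotation_exists m (a b : 'I_m) : exists g : 'I_m -> 'I_m, dihedral g /\ g a = b.
Proof.
have m0 : (0 < m)%N by case: m a {b} => [[]|].
pose k := Ordinal (ltn_pmod (b + (m - a)) m0).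
have [g gE] := mod_map_exists (addn k) m0.
exists g; split; first by exists k; left.
apply/val_inj; rewrite /= gE /=.
by rewrite modnDml -addnA subnK 1?ltnW // modnDr modn_small.
Qed.

(** The rotation and the reflection taking [a] to [a'] send [c] to the two points at distance
    [d(a, c)] from [a'], one on each side. On the side that contains [c'], only the difference of
    the distances to [a'] is left. *)
Lemma dihedral_exists m (a c a' c' : 'I_m) : exists g : 'I_m -> 'I_m,
  [/\ dihedral g, g a = a' &
   (torus_dist m (g c) c' <= (torus_dist m a c - torus_dist m a' c')
                           + (torus_dist m a' c' - torus_dist m a c))%N].
Proof.
have m0 : (0 < m)%N by case: m a {a' c c'} => [[]|].
pose k1 := Ordinal (ltn_pmod (a' + (m - a)) m0).
have [g1 g1E] := mod_map_exists (addn k1) m0.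
have g1a : g1 a = a'.
  apply/val_inj; rewrite /= g1E /=.
  by rewrite modnDml -addnA subnK 1?ltnW // modnDr modn_small.
pose k2 := Ordinal (ltn_pmod (a' + a) m0).
have [g2 g2E] := mod_map_exists (fun x => k2 + (m - x))%N m0.
have g2a : g2 a = a'.
  apply/val_inj; rewrite /= g2E /=.
  by rewrite modnDml -addnA subnKC 1?ltnW // modnDr modn_small.
suff [h|h] : (torus_dist m (g1 c) c' <= (torus_dist m a c - torus_dist m a' c')
                           + (torus_dist m a' c' - torus_dist m a c))%N \/
  (torus_dist m (g2 c) c' <= (torus_dist m a c - torus_dist m a' c')
                           + (torus_dist m a' c' - torus_dist m a c))%N.
- by exists g1; split=> //; exists k1; left.
- by exists g2; split=> //; exists k2; right.
(* The two images of [c] are symmetric about [a']. *)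
have e : ((g1 c + g2 c) %% m = (a' + a') %% m)%N.
  rewrite g1E g2E modnDm /= addnACA (subnKC (ltnW (ltn_ord c))) modnDr modnDm.
  have -> : (a' + (m - a) + (a' + a) = a' + a' + m)%N by have := ltn_ord a; lia.
  by rewrite modnDr.
have e0 : torus_dist m a' (g1 c) = torus_dist m a c.
  by rewrite -g1a; apply: dihedral_iso; exists k1; left.
have := torus_dist_cases (ltnW (ltn_ord a')) (ltnW (ltn_ord (g1 c))).
have := torus_dist_cases (ltnW (ltn_ord a')) (ltnW (ltn_ord c')).
have := torus_dist_le_dist m (g1 c) c'.
have := torus_dist_le_dist m (g2 c) c'.
have := torus_dist_le_codist m (g1 c) c'.
have := torus_dist_le_codist m (g2 c) c'.
rewrite e0; move: (torus_dist m (g1 c) c') (torus_dist m (g2 c) c') => t1 t2.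
move: (ltn_ord a') (ltn_ord c') (ltn_ord (g1 c)) (ltn_ord (g2 c)) e.
move: (torus_dist m a c) (torus_dist m a' c') => t t'.
move: (val (g1 c)) (val (g2 c)) (val a') (val c') => x y z w hz hw hx hy e l1 l2 l3 l4.
have {}e : (x + y = z + z \/ x + y = z + z + m \/ x + y + m = z + z)%N.
  move: (@modn_cases m (x + y)) (@modn_cases m (z + z)); rewrite -e.
  move: ((x + y) %% m)%N hx hy hz => r hx hy hz {e l1 l2} h1 h2.
  by case: h1 => [|[? ?]|[? ?]]; try lia; case: h2 => [|[? ?]|[? ?]]; lia.
case=> [[a1 [a2 a3]]|[a1 [a2 a3]]|[a1 [a2 a3]]|[a1 [a2 a3]]];
case=> [[b1 [b2 b3]]|[b1 [b2 b3]]|[b1 [b2 b3]]|[b1 [b2 b3]]]; lia.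
Qed.

Lemma torus_dist_between n (i j : 'I_n) d : (d <= torus_dist n i j)%N ->
  exists k : 'I_n, torus_dist n i k = d /\ torus_dist n k j = (torus_dist n i j - d)%N.
Proof.
move=> hd; have n0 : (0 < n)%N by case: n i {j hd} => [[]|].
have := torus_dist_cases (ltnW (ltn_ord i)) (ltnW (ltn_ord j)).
have hi := ltn_ord i; have hj := ltn_ord j.
pose f x := Ordinal (ltn_pmod x n0).
move: hd; set t := torus_dist n i j => hd.
case=> [[h1 [h2 h3]]|[h1 [h2 h3]]|[h1 [h2 h3]]|[h1 [h2 h3]]].
- exists (f (i + d)%N); rewrite /f /=.
  move: (@modn_cases n (i + d)); move: ((i + d) %% n)%N => r h.
  by case: h => [|[? ?]|[? ?]]; try lia; split; apply: torus_dist_val; lia.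
- exists (f (i + (n - d))%N); rewrite /f /=.
  move: (@modn_cases n (i + (n - d))); move: ((i + (n - d)) %% n)%N => r h.
  by case: h => [|[? ?]|[? ?]]; try lia; split; apply: torus_dist_val; lia.
- exists (f (i + (n - d))%N); rewrite /f /=.
  move: (@modn_cases n (i + (n - d))); move: ((i + (n - d)) %% n)%N => r h.
  by case: h => [|[? ?]|[? ?]]; try lia; split; apply: torus_dist_val; lia.
- exists (f (i + d)%N); rewrite /f /=.
  move: (@modn_cases n (i + d)); move: ((i + d) %% n)%N => r h.
  by case: h => [|[? ?]|[? ?]]; try lia; split; apply: torus_dist_val; lia.
Qed.

Lemma torus_dist_section m (a : 'I_m) j : (2 * j <= m)%N ->
  exists b : 'I_m, torus_dist m a b = j.
Proof.
move=> hj; have m0 : (0 < m)%N by case: m a {hj} => [[]|].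
exists (Ordinal (ltn_pmod (a + j) m0)); rewrite /= torus_distE.
have ha := ltn_ord a.
by have [|[-> ?]|[e ?]] := @modn_cases m (a + j); lia.
Qed.

Lemma two_point_sep m (a c u v : 'I_m) :
  (m <= 8 * torus_dist m a c)%N -> (8 * torus_dist m a c <= 3 * m)%N ->
  (torus_dist m u v <=
   3 * ((torus_dist m u a - torus_dist m v a) + (torus_dist m v a - torus_dist m u a)
      + ((torus_dist m u c - torus_dist m v c) + (torus_dist m v c - torus_dist m u c))))%N.
Proof.
move=> h1 h2; have m0 : (0 < m)%N by case: m a {c u v h1 h2} => [[]|].
have [g [hg ga]] := rotation_exists a (Ordinal m0).
have := @two_point_sep0 m (g c) (g u) (g v) (ltn_ord _) (ltn_ord _) (ltn_ord _).
have e x : torus_dist m (g x) 0 = torus_dist m x a by rewrite -(dihedral_iso _ _ hg) ga.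
by rewrite torus_distC !e !(dihedral_iso _ _ hg) torus_distC; apply.
Qed.

Section Rescaling.
Variables (n m eta : nat) (nE : n = (4 * m)%N).

Lemma torus_dist_rescale (p q u a : nat) : (p < n)%N -> (q < n)%N -> (u < m)%N -> (a < m)%N ->
  ((4 * u - p) + (p - 4 * u) <= eta)%N -> ((4 * a - q) + (q - 4 * a) <= eta)%N ->
  (torus_dist n p q <= 4 * torus_dist m u a + 2 * eta)%N /\
  (4 * torus_dist m u a <= torus_dist n p q + 2 * eta)%N.
Proof.
move=> hp hq hu ha h1 h2; rewrite -torus_dist_scale -nE.
have l1 := torus_dist_le_dist n (4 * u) p; have l2 := torus_dist_le_dist n (4 * a) q.
have l1' := torus_dist_le_dist n p (4 * u); have l2' := torus_dist_le_dist n q (4 * a).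
have hu' : (4 * u <= n)%N by lia.
have ha' : (4 * a <= n)%N by lia.
have := torus_dist_triangle hu' (ltnW hp) ha'.
have := torus_dist_triangle (ltnW hp) (ltnW hq) ha'.
have := torus_dist_triangle (ltnW hp) hu' (ltnW hq).
have := torus_dist_triangle hu' ha' (ltnW hq).
lia.
Qed.
End Rescaling.

(** * Rearrangement *)

(* The partial sums of phi form a (nearly) concave function, of which phi is
   a (near) supergradient. *)
Lemma partial_sum_supergradient (R : realType) (kappa : R) (phi : nat -> R) (M k k' : nat) :
  (forall j j', (j <= j' <= M)%N -> phi j' - kappa <= phi j) ->
  (k <= M)%N -> (k' <= M)%N ->
  \sum_(j < k') phi j - \sum_(j < k) phi j
    <= phi k * (k'%:R - k%:R) + kappa * `|k'%:R - k%:R|.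
Proof.
move=> hphi hk hk'; rewrite -!(big_mkord xpredT).
have cst (a b : nat) (x : R) : (a <= b)%N -> \sum_(a <= j < b) x = x * (b%:R - a%:R).
  by move=> ab; rewrite big_const_nat iter_addr addr0 -natrB // mulr_natr.
have [kk|kk] := leqP k k'.
- rewrite (@big_cat_nat _ _ _ k 0 k') //= [leLHS]addrC addKr ger0_norm ?subr_ge0 ?ler_nat //.
  rewrite -mulrDl -cst //; apply: ler_sum_nat => j /andP[j1 j2].
  by rewrite -lerBlDr; apply: hphi; lia.
- rewrite (@big_cat_nat _ _ _ k' 0 k) ?(ltnW kk) //= opprD addNKr.
  rewrite ler0_norm ?subr_le0 ?ler_nat ?(ltnW kk) // opprB.
  have -> : phi k * (k'%:R - k%:R) + kappa * (k%:R - k'%:R) = - ((phi k - kappa) * (k%:R - k'%:R)) by ring.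
  rewrite lerN2 -cst ?(ltnW kk) //.
  by apply: ler_sum_nat => j /andP[j1 j2]; apply: hphi; lia.
Qed.

(** Write [f = g - c e] with [g] nearly decreasing in [e]. As [e] and [e'] are equidistributed,
    their squares have equal sums and the part [- c e] gives exactly [c/2] times the sum of
    [(e' - e)^2]. The partial sums of the levels of [g] also have equal totals along [e] and [e'],
    so by near concavity the part [g] loses at most the [kappa] term. *)
Lemma rearrangement (R : realType) (T : finType) (e e' : T -> nat) (f : T -> R)
    (c kappa : R) (M : nat) :
  (forall Phi : nat -> R, \sum_b Phi (e' b) = \sum_b Phi (e b)) ->
  (forall b, (e b <= M)%N) -> (forall b, (e' b <= M)%N) ->
  (forall j, (j <= M)%N -> exists b, e b = j) ->
  (forall b b', (e b <= e b')%N ->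
     f b' + c * (e b')%:R - kappa <= f b + c * (e b)%:R) ->
  c / 2 * (\sum_b ((e' b)%:R - (e b)%:R) ^+ 2)
    - 2 * kappa * (\sum_b `|(e' b)%:R - (e b)%:R|)
  <= \sum_b f b * ((e' b)%:R - (e b)%:R).
Proof.
move=> equi eM e'M sec mono.
pose g b := f b + c * (e b)%:R.
(* Several points may share a level; [phi] keeps one representative per level, which changes [g] by
   at most [kappa]. *)
pose phi j := if [pick b | e b == j] is Some b then g b else 0.
have phiE j : (j <= M)%N -> exists2 b, e b = j & phi j = g b.
  move=> /sec[b eb]; rewrite /phi; case: pickP => [b' /eqP <-|/(_ b)]; first by exists b'.
  by rewrite eb eqxx.
have phi_mono j j' : (j <= j' <= M)%N -> phi j' - kappa <= phi j.
  move=> /andP[jj' j'M]; have [b eb ->] := phiE _ (leq_trans jj' j'M).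
  by have [b' eb' ->] := phiE _ j'M; apply: mono; rewrite eb eb'.
have g_phi b : `|g b - phi (e b)| <= kappa.
  have [b' eb' ->] := phiE _ (eM b).
  have := mono b b'; have := mono b' b; rewrite -/(g b) -/(g b') eb' leqnn.
  by move=> /(_ isT) h1 /(_ isT) h2; rewrite ler_norml; apply/andP; split; lra.
have Phi0 : \sum_b (\sum_(j < e' b) phi j - \sum_(j < e b) phi j) = 0.
  by rewrite sumrB (equi (fun k => \sum_(j < k) phi j)) subrr.
have sq0 : \sum_b ((e' b)%:R ^+ 2 - (e b)%:R ^+ 2) = 0 :> R.
  by rewrite sumrB (equi (fun k => k%:R ^+ 2)) subrr.
rewrite !mulr_sumr -sumrB -[leLHS]addr0 -[X in _ + X <= _]Phi0 -big_split /= -[leLHS]subr0.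
rewrite -[X in _ - X <= _](mulr0 (c / 2)) -[X in _ - _ * X <= _]sq0 mulr_sumr -sumrB; apply: ler_sum => b _.
have := partial_sum_supergradient phi_mono (eM b) (e'M b).
set x := (e' b)%:R; set y := (e b)%:R.
have h : (phi (e b) - g b) * (x - y) <= kappa * `|x - y|.
  apply: le_trans (ler_norm _) _; rewrite normrM distrC.
  by apply: ler_wpM2r.
have -> : f b = g b - c * y by rewrite /g addrK.
move: h; move: x y (\sum_(j < e' b) phi j - \sum_(j < e b) phi j) (phi (e b)) (g b) `|x - y| => x y D p q r h hD; lra.
Qed.

(** Supplies the equidistribution hypothesis of [rearrangement]: all rows of the distance matrix
    have the same multiset of entries. *)
Lemma sum_torus_dist_equi (R : realType) m (z z' : 'I_m) (Phi : nat -> R) :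
  \sum_(b < m) Phi (torus_dist m z b) = \sum_(b < m) Phi (torus_dist m z' b).
Proof.
have [g [hg <-]] := rotation_exists z z'.
rewrite [RHS](reindex_inj (dihedral_inj hg)) /=.
by apply: eq_bigr => b _; rewrite (dihedral_iso _ _ hg).
Qed.

(** * From distances to positions *)

Definition absdiff (x y : nat) : nat := ((x - y) + (y - x))%N.

Lemma normrB_nat (R : realType) (x y : nat) : `|x%:R - y%:R| = (absdiff x y)%:R :> R.
Proof.
rewrite /absdiff; have [xy|xy] := leqP x y.
  by rewrite distrC -natrB // ger0_norm ?ler0n //; congr (_%:R); lia.
by rewrite -natrB ?(ltnW xy) // ger0_norm ?ler0n //; congr (_%:R); lia.
Qed.

Lemma exists_le_average (T : finType) (x0 : T) (f : T -> nat) :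
  exists x, (#|T| * f x <= \sum_y f y)%N.
Proof.
case: (@arg_minnP _ x0 xpredT f) => // x _ h; exists x.
by rewrite -sum_nat_const; apply: leq_sum => y _; apply: h.
Qed.

Lemma leq_sum_inj (S T : finType) (phi : S -> T) (h : T -> nat) :
  injective phi -> (\sum_s h (phi s) <= \sum_t h t)%N.
Proof.
move=> phi_inj; rewrite -(big_imset (h := phi) (A := predT) h) /=; last by move=> ? ? _ _; apply: phi_inj.
by rewrite [leqRHS](bigID (mem (phi @: predT))) /= leq_addr.
Qed.

Section Anchors.
Variables (m : nat) (p : 'I_m -> 'I_m).
Let disc (a b : 'I_m) := absdiff (torus_dist m (p a) (p b)) (torus_dist m a b).
Let r (a : 'I_m) := (\sum_b disc a b)%N.

(** [g] agrees with [p] at [a] and up to [disc a c] at [c], so the anchors [g a] and [g c] separate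
    [p b] from [g b]. Replacing [p c] by [g c] costs [disc a c] for each [b], whence the factor
    [m]. *)
Lemma anchored_isometry (a c : 'I_m) :
  (m <= 8 * torus_dist m a c)%N -> (8 * torus_dist m a c <= 3 * m)%N ->
  exists g : 'I_m -> 'I_m, dihedral g /\
    (\sum_b torus_dist m (p b) (g b) <= 3 * (r a + r c + m * disc a c))%N.
Proof.
move=> h1 h2; have [g [hg ga gc]] := dihedral_exists a c (p a) (p c).
exists g; split=> //.
have -> : (m * disc a c)%N = (\sum_(b < m) disc a c)%N by rewrite sum_nat_const card_ord.
rewrite /r -!big_split /= big_distrr /=; apply: leq_sum => b _.
have hgac : torus_dist m (g a) (g c) = torus_dist m a c by apply: dihedral_iso.
have := @two_point_sep m (g a) (g c) (p b) (g b); rewrite hgac => /(_ h1 h2).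
rewrite !(dihedral_iso _ _ hg) ga.
have t1 := torus_dist_triangle (ltnW (ltn_ord (p b))) (ltnW (ltn_ord (g c))) (ltnW (ltn_ord (p c))).
have t2 := torus_dist_triangle (ltnW (ltn_ord (p b))) (ltnW (ltn_ord (p c))) (ltnW (ltn_ord (g c))).
rewrite (torus_distC m (p c) (g c)) in t2.
rewrite /disc /absdiff (torus_distC m (p b) (p a)) (torus_distC m b a).
rewrite (torus_distC m c b) (torus_distC m (p c) (p b)).
move: gc t1 t2; lia.
Qed.

(** Good anchors exist by averaging over base points and over [l] shifts. Averaging over the shift
    is what controls the term [m * disc a c] by the total discrepancy. *)
Lemma isometry_approximation : (8 <= m)%N ->
  exists g : 'I_m -> 'I_m, dihedral g /\
    (m * \sum_b torus_dist m (p b) (g b) <= 30 * \sum_a r a)%N.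
Proof.
move=> m8; have m0 : (0 < m)%N by lia.
pose q := ((m + 7) %/ 8)%N; pose l := (m %/ 4)%N.
have l0 : (0 < l)%N by rewrite /l; lia.
have hq : (m <= 8 * q /\ 8 * q <= m + 7)%N by rewrite /q; lia.
have hl : (4 * l <= m /\ m <= 8 * l)%N by rewrite /l; lia.
(* For [s < l] the shift [q + s] stays between [m/8] and [3m/8], the range accepted by
   [anchored_isometry]. *)
pose tr (s : 'I_l) (a : 'I_m) : 'I_m := Ordinal (ltn_pmod (q + s + a) m0).
have trE (s : 'I_l) (a : 'I_m) : torus_dist m a (tr s a) = (q + s)%N.
  have hs := ltn_ord s; have ha := ltn_ord a.
  apply: torus_dist_val; first lia.
  by rewrite /=; move: (@modn_cases m (q + s + a)); move: ((q + s + a) %% m)%N; lia.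
have tr_inj s : injective (tr s).
  have hqs : (q + s < m)%N by have := ltn_ord s; lia.
  apply: iso_inj => x y; exact: (@torus_dist_modl m (q + s)).
have tr_injl a : injective (tr ^~ a).
  move=> s s' e; apply: ord_inj; have := trE s a; rewrite /= in e; rewrite e trE; lia.
pose f (sa : 'I_l * 'I_m) := (r sa.2 + r (tr sa.1 sa.2) + m * disc sa.2 (tr sa.1 sa.2))%N.
have [[s a] /=] := exists_le_average (Ordinal l0, Ordinal m0) f.
rewrite card_prod !card_ord => hsa.
have [||g [hg gle]] := @anchored_isometry a (tr s a); rewrite ?trE; try by have := ltn_ord s; lia.
exists g; split=> //.
have : (\sum_y f y <= l * (2 * \sum_a r a) + m * \sum_a r a)%N.
  rewrite (eq_bigr (fun y => f (y.1, y.2))); last by case.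
  rewrite -(pair_bigA _ (fun s a => f (s, a))) /= /f /=.
  under eq_bigr do rewrite !big_split /=.
  rewrite big_split /=; apply: leq_add.
    have -> : (l * (2 * \sum_a r a) = \sum_(s < l) 2 * \sum_a r a)%N.
      by rewrite sum_nat_const card_ord.
    apply: leq_sum => s' _; rewrite mul2n -addnn leq_add2l.
    by rewrite [leqRHS](reindex_inj (tr_inj s')).
  under eq_bigr do rewrite -big_distrr /=.
  rewrite -big_distrr /= leq_mul2l; apply/orP; right.
  rewrite exchange_big /=; apply: leq_sum => b _.
  exact: (leq_sum_inj (disc b) (tr_injl b)).
move: hsa gle; set x := f (s, a); set F := (\sum_y f y)%N; set T := (\sum_a r a)%N.
set X := (\sum_b _)%N => hsa gle hF.
have {}gle : (X <= 3 * x)%N := gle.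
rewrite -(leq_pmul2l l0) (leq_trans (n := 3 * (l * m * x))) //.
  by rewrite -(mulnA l) [leqRHS]mulnCA leq_mul2l (mulnCA 3 m) leq_mul2l gle !orbT.
apply: (leq_trans (n := (3 * (l * (2 * T) + m * T))%N)).
  by rewrite leq_mul2l /= (leq_trans hsa).
(* The bound becomes [3 (2 + 8) l T], the origin of the constant 30. *)
have : (m * T <= 8 * l * T)%N by rewrite leq_mul2r hl.2 orbT.
lia.
Qed.
End Anchors.

(** * Localization and refinement errors *)

Definition nat_close (eta x y : nat) : bool := (x <= y + eta)%N && (y <= x + eta)%N.

(** Cauchy-Schwarz against the constant 1, read off from the nonnegativity of the sum of
    [(N |f b| - S)^2]. *)
Lemma sum_norm_le (R : realType) (T : finType) (f : T -> R) :
  \sum_b `|f b| <= Num.sqrt #|T|%:R * Num.sqrt (\sum_b f b ^+ 2).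
Proof.
rewrite -sqrtrM ?ler0n //.
set S := \sum_b _; set Q := \sum_b _; set N := #|T|%:R.
have S0 : 0 <= S by apply: sumr_ge0.
rewrite -[leLHS]ger0_norm // -sqrtr_sqr ler_sqrt; last first.
  by rewrite mulr_ge0 ?ler0n // sumr_ge0 // => b _; rewrite sqr_ge0.
have [N0|N0] := eqVneq N 0.
  rewrite N0 mul0r; have -> : S = 0; last by rewrite expr0n.
  rewrite /S big1 // => b _; have : (0 < #|T|)%N by apply/card_gt0P; exists b.
  by rewrite lt0n -(@pnatr_eq0 R) -/N N0 eqxx.
have : 0 <= \sum_b (N * `|f b| - S) ^+ 2 by apply: sumr_ge0 => b _; rewrite sqr_ge0.
have -> : \sum_b (N * `|f b| - S) ^+ 2 = N * (N * Q - S ^+ 2).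
  under eq_bigr => b _.
    rewrite (_ : _ ^+ 2 = N ^+ 2 * f b ^+ 2 - 2 * N * S * `|f b| + S ^+ 2); last first.
      by rewrite -[f b ^+ 2]real_normK ?num_real //; ring.
    over.
  have cst : \sum_(b : T) S ^+ 2 = N * S ^+ 2 by rewrite sumr_const mulr_natl.
  rewrite big_split sumrB /= cst -!mulr_sumr -/Q -/S; ring.
by rewrite pmulr_rge0 ?subr_ge0 // lt_neqAle eq_sym N0 ler0n.
Qed.

Section BiLipschitz.
Variables (R : realType) (n m eta : nat) (nE : n = (4 * m)%N) (n0 : (0 < n)%N).
Variables (B : 'M[R]_n) (c_l c_L eps : R).
Hypotheses (cl0 : 0 < c_l) (clL : c_l <= c_L) (B_lip : bi_lipschitz c_l c_L eps B).
Local Notation omega := (2 * pi / n%:R : R).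

Lemma omega_gt0 : 0 < omega.
Proof. by rewrite divr_gt0 ?mulr_gt0 ?pi_gt0 ?ltr0n. Qed.

(** The Lipschitz condition involves [d(j, k)], which is large when [j] and [k] lie on opposite
    sides of [i]. The point [k'] at distance [d(i, k)] on a geodesic from [i] to [j] is on the right
    side, and the second condition makes [B i k] at most [B i k' + eps]. *)
Lemma lipschitz_torus_dist (i j k : 'I_n) : (torus_dist n i k <= torus_dist n i j)%N ->
  B i k - c_L * omega * ((torus_dist n i j)%:R - (torus_dist n i k)%:R) - 2 * eps <= B i j.
Proof.
move=> h; have [k' [k1 k2]] := torus_dist_between h.
have := B_lip.2 i k k'; rewrite k1 leqnn subrr mulr0 => /(_ isT) h1.
have := B_lip.1 i j k'; rewrite torus_distC k2 natrB // ler_norml => /andP[h2 _].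
lra.
Qed.

(** One coarse step is four fine ones, whence the slope [4 c_l omega]. If the fine distances are
    ordered like the coarse ones, the lower Lipschitz bound applies; otherwise they differ by at
    most [4 eta] and [lipschitz_torus_dist] bounds the loss. *)
Lemma approx_decreasing (i j k : 'I_n) (u a b : 'I_m) :
  nat_close eta (4 * u) i -> nat_close eta (4 * a) j -> nat_close eta (4 * b) k ->
  (torus_dist m u a <= torus_dist m u b)%N ->
  B i k + 4 * c_l * omega * (torus_dist m u b)%:R
    - (8 * c_L * omega * eta%:R + 2 * eps)
  <= B i j + 4 * c_l * omega * (torus_dist m u a)%:R.
Proof.
rewrite /nat_close => ui aj bk.
have [||a1 a2] := torus_dist_rescale (eta := eta) nE (ltn_ord i) (ltn_ord j) (ltn_ord u) (ltn_ord a).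
- by move: ui; lia.
- by move: aj; lia.
have [||b1 b2] := torus_dist_rescale (eta := eta) nE (ltn_ord i) (ltn_ord k) (ltn_ord u) (ltn_ord b).
- by move: ui; lia.
- by move: bk; lia.
move: a1 a2 b1 b2 {ui aj bk}.
have e0 : 0 <= eps.
  by have := B_lip.1 i j j; rewrite subrr normr0 torus_dist0 mulr0 add0r.
rewrite -!(ler_nat R) !natrD.
have h1 := B_lip.2 i k j; have h2 := @lipschitz_torus_dist i j k.
have := leq_total (torus_dist n i j) (torus_dist n i k).
have w0 := omega_gt0; move: h1 h2; rewrite mulrC.
move: (torus_dist n i j) (torus_dist n i k) (torus_dist m u a) (torus_dist m u b).
move=> dj dk A C h1 h2 hjk a1 a2 b1 b2 AC.
have cw : 0 < c_l * omega by rewrite mulr_gt0.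
have Lw : c_l * omega <= c_L * omega by rewrite ler_pM2r.
have eta0 : 0 <= eta%:R :> R by [].
rewrite -(mulrA 4) -(mulrA 8).
move: h1 h2; rewrite -(mulrC omega) [omega * c_l]mulrC.
move: (c_l * omega) (c_L * omega) cw Lw => c L cw Lw h1 h2.
have eL := ler_wpM2r eta0 Lw.
case/orP: hjk => hjk.
- have {}h1 := h1 hjk.
  have : 0 <= c * (dk%:R - dj%:R + 4 * A%:R - 4 * C%:R + 4 * eta%:R).
    by apply: mulr_ge0; [exact: ltW | lra].
  nra.
- have {}h2 := h2 hjk.
  have : 0 <= L * (dk%:R - dj%:R + 4 * eta%:R).
    by apply: mulr_ge0; [exact: le_trans (ltW cw) Lw | lra].
  have : 0 <= c * (4 * A%:R - 4 * C%:R + 4 * eta%:R).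
    apply: mulr_ge0; [exact: ltW | ].
    by move: hjk; rewrite -(ler_nat R); lra.
  nra.
Qed.
End BiLipschitz.

Lemma torus_dist_absdiff m (x y z : 'I_m) :
  (absdiff (torus_dist m x z) (torus_dist m y z) <= torus_dist m x y)%N.
Proof.
have h1 := torus_dist_triangle (ltnW (ltn_ord x)) (ltnW (ltn_ord y)) (ltnW (ltn_ord z)).
have h2 := torus_dist_triangle (ltnW (ltn_ord y)) (ltnW (ltn_ord x)) (ltnW (ltn_ord z)).
by rewrite (torus_distC m y x) in h2; rewrite /absdiff; lia.
Qed.

(* Shifting h by about m/8 yields a second anchor that separates the points. *)
Lemma sum_sqr_torus_dist_ge m (z z' : 'I_m) : (8 <= m)%N ->
  (m * torus_dist m z z' ^ 2 <=
   36 * \sum_(h < m) absdiff (torus_dist m z h) (torus_dist m z' h) ^ 2)%N.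
Proof.
move=> m8; have m0 : (0 < m)%N by lia.
pose q := ((m + 7) %/ 8)%N.
have hq : (m <= 8 * q /\ 8 * q <= m + 7)%N by rewrite /q; lia.
pose tr (a : 'I_m) : 'I_m := Ordinal (ltn_pmod (q + a) m0).
have trE (a : 'I_m) : torus_dist m a (tr a) = q.
  have ha := ltn_ord a.
  apply: torus_dist_val; first lia.
  by rewrite /=; move: (@modn_cases m (q + a)); move: ((q + a) %% m)%N; lia.
have tr_inj : injective tr.
  have hqs : (q < m)%N by lia.
  by apply: iso_inj => x y; exact: (@torus_dist_modl m q).
set f := fun h : 'I_m => absdiff (torus_dist m z h) (torus_dist m z' h).
have sep h : (torus_dist m z z' ^ 2 <= 18 * (f h ^ 2 + f (tr h) ^ 2))%N.
  have h1 : (m <= 8 * torus_dist m h (tr h))%N by rewrite trE; lia.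
  have h2 : (8 * torus_dist m h (tr h) <= 3 * m)%N by rewrite trE; lia.
  have := two_point_sep z z' h1 h2.
  rewrite -/(absdiff (torus_dist m z h) _) -/(absdiff (torus_dist m z (tr h)) _).
  rewrite -/(f h) -/(f (tr h)).
  move: (torus_dist m z z') (f h) (f (tr h)) => D x y Dxy.
  have {}Dxy : (D ^ 2 <= (3 * (x + y)) ^ 2)%N by rewrite leq_exp2r.
  apply: leq_trans Dxy _; rewrite expnMn sqrnD -(mulnA 9 2) leq_mul2l /=.
  by have := (nat_Cauchy x y).1; lia.
have -> : (m * torus_dist m z z' ^ 2 = \sum_(h < m) torus_dist m z z' ^ 2)%N.
  by rewrite sum_nat_const card_ord.
apply: (leq_trans (n := (\sum_h 18 * (f h ^ 2 + f (tr h) ^ 2))%N)).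
  by apply: leq_sum => h _; exact: sep.
rewrite -big_distrr big_split /= -(reindex_inj tr_inj (P := xpredT) (F := fun h => f h ^ 2)%N).
by rewrite addnn -mul2n mulnA.
Qed.

Lemma torus_dist_half m i j : (torus_dist m i j <= m %/ 2)%N.
Proof. by rewrite leq_divRL // mulnC torus_dist_double. Qed.

Lemma nat_closeP eta x y : nat_close eta x y -> ((x - y) + (y - x) <= eta)%N.
Proof. rewrite /nat_close; lia. Qed.

Section Estimation.
Variables (R : realType) (n m eta : nat) (nE : n = (4 * m)%N) (n0 : (0 < n)%N).
Variables (B : 'M[R]_n) (c_l c_L eps : R).
Hypotheses (cl0 : 0 < c_l) (clL : c_l <= c_L) (B_lip : bi_lipschitz c_l c_L eps B).
Local Notation omega := (2 * pi / n%:R : R).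
Let kappa := 8 * c_L * omega * eta%:R + 2 * eps.
Variable pos : 'I_m -> 'I_n.
Hypothesis pos_close : forall a : 'I_m, nat_close eta (4 * a) (pos a).
Variable p : 'I_m -> 'I_m.
Hypothesis p_inj : injective p.

Lemma eps_ge0 : 0 <= eps.
Proof.
have := B_lip.1 (Ordinal n0) (Ordinal n0) (Ordinal n0).
by rewrite subrr normr0 torus_dist0 mulr0 add0r.
Qed.

Lemma kappa_ge0 : 0 <= kappa.
Proof.
have w0 := omega_gt0 R n0; have e0 := eps_ge0.
have L0 : 0 <= c_L * omega by rewrite mulr_ge0 ?(ltW w0) // (le_trans (ltW cl0)).
by rewrite /kappa -(mulrA 8); apply: addr_ge0; apply: mulr_ge0 => //; apply: mulr_ge0.
Qed.

(** Here [pos a] is the true position of the sampled item of rank [a], and [p a] its estimated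
    index. With [X] the Frobenius norm of [D], rearrangement in each row, optimality and the noise
    bound give [c/2 X^2 <= (t + 2 kappa m) X]. Dividing by [X], Cauchy-Schwarz returns to the sum of
    [|D a b|]. *)
Lemma localization_error (W : 'I_m -> 'I_m -> R) (t : R) :
  let D a b := (torus_dist m (p a) (p b))%:R - (torus_dist m a b)%:R : R in
  0 <= t ->
  \sum_a \sum_b (B (pos a) (pos b) + W a b) * D a b <= 0 ->
  - (\sum_a \sum_b W a b * D a b) <= t * Num.sqrt (\sum_a \sum_b D a b ^+ 2) ->
  4 * c_l * omega * (\sum_a \sum_b `|D a b|) <= 2 * m%:R * (t + 2 * kappa * m%:R).
Proof.
move=> D t0 opt noise; set c := 4 * c_l * omega.
have c0 : 0 < c by rewrite /c mulr_gt0 ?(omega_gt0 R n0) // mulr_gt0.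
have k0 := kappa_ge0.
have row a : c / 2 * (\sum_b D a b ^+ 2) - 2 * kappa * (\sum_b `|D a b|)
    <= \sum_b B (pos a) (pos b) * D a b.
  apply: (@rearrangement _ _ (fun b : 'I_m => torus_dist m a b) (fun b => torus_dist m (p a) (p b))
    (fun b => B (pos a) (pos b)) c kappa (m %/ 2)).
  - move=> Phi; rewrite -(reindex_inj p_inj (P := xpredT) (F := fun h : 'I_m => Phi (torus_dist m (p a) h))) /=.
    exact: sum_torus_dist_equi.
  - by move=> b; apply: torus_dist_half.
  - by move=> b; apply: torus_dist_half.
  - by move=> j hj; apply: torus_dist_section; rewrite mulnC -leq_divRL.
  - by move=> b b' h; apply: approx_decreasing (h); rewrite ?pos_close.
have {row} := ler_sum (index_enum 'I_m) (P := xpredT) (fun a _ => row a).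
rewrite sumrB -!mulr_sumr => row.
have {opt} opt : \sum_a \sum_b B (pos a) (pos b) * D a b + \sum_a \sum_b W a b * D a b <= 0.
  by rewrite -big_split /=; under eq_bigr do rewrite -big_split /=;
     under eq_bigr do under eq_bigr do rewrite -mulrDl.
have S1 : \sum_a \sum_b `|D a b| <= m%:R * Num.sqrt (\sum_a \sum_b D a b ^+ 2).
  rewrite !pair_bigA /=; apply: le_trans (sum_norm_le _) _.
  by rewrite card_prod card_ord natrM -expr2 sqrtr_sqr ger0_norm.
have Q0 : 0 <= \sum_a \sum_b D a b ^+ 2.
  by apply: sumr_ge0 => a _; apply: sumr_ge0 => b _; rewrite sqr_ge0.
have X0 := sqrtr_ge0 (\sum_a \sum_b D a b ^+ 2).
have QE := sqr_sqrtr Q0.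
have m0 : 0 <= m%:R :> R by [].
move: (Num.sqrt _) X0 QE S1 noise => X X0 QE S1 noise.
move: row opt; rewrite -QE.
move: (\sum_a \sum_b `|D a b|) S1 (\sum_a \sum_b W a b * D a b) noise => S S1 N noise.
move: (\sum_a \sum_b _) => T h1 h2.
have h3 : c / 2 * X ^+ 2 <= (t + 2 * kappa * m%:R) * X.
  have := ler_wpM2l (mulr_ge0 (ler0n _ 2) k0) S1.
  move: noise h1 h2; lra.
have r0 : 0 <= t + 2 * kappa * m%:R by rewrite addr_ge0 ?mulr_ge0.
have h4 : c * X <= 2 * (t + 2 * kappa * m%:R).
  have [X00|X00] := eqVneq X 0; first by rewrite X00 mulr0 mulr_ge0.
  have Xp : 0 < X by rewrite lt_neqAle eq_sym X00.
  by rewrite -(ler_pM2r Xp); move: h3; lra.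
have := ler_wpM2l (ltW c0) S1; have := ler_wpM2l m0 h4; lra.
Qed.

(** Optimality involves the estimated indices [p a], rearrangement the isometric images [g a] of the
    true ranks; passing from one to the other costs the localization error. All error terms are
    linear in the distance [d] from [z] to [g u], while the squares contribute at least
    [m d^2 / 36], so one factor [d] cancels. *)
Lemma refinement_error (g : 'I_m -> 'I_m) (i : 'I_n) (u z : 'I_m) (W : 'I_m -> R) (t : R) :
  let D (a : 'I_m) := (torus_dist m z a)%:R - (torus_dist m (g u) a)%:R : R in
  (8 <= m)%N -> dihedral g -> nat_close eta (4 * u) i ->
  0 <= t ->
  \sum_a (B i (pos a) + W a) * D (p a) <= 0 ->
  - (\sum_a W a * D (p a)) <= t * Num.sqrt (\sum_a D (p a) ^+ 2) ->
  4 * c_l * omega * m%:R * (torus_dist m z (g u))%:R <=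
  72 * (t * Num.sqrt m%:R + 2 * kappa * m%:R
    + (c_L * omega * (4 * (\sum_a torus_dist m (p a) (g a))%:R + 2 * eta%:R * m%:R) + m%:R * eps)).
Proof.
move=> D m8 hg ui t0 opt noise; set c := 4 * c_l * omega.
have g_inj := dihedral_inj hg.
have c0 : 0 < c by rewrite /c mulr_gt0 ?(omega_gt0 R n0) // mulr_gt0.
have k0 := kappa_ge0.
have L0 : 0 <= c_L * omega by rewrite mulr_ge0 ?(ltW (omega_gt0 R n0)) // (le_trans (ltW cl0)).
have m0 : 0 < m%:R :> R by rewrite ltr0n (leq_trans _ m8).
set d := (torus_dist m z (g u))%:R.
have d0 : 0 <= d by [].
have Dd a : `|D a| <= d.
  by rewrite /D normrB_nat ler_nat torus_dist_absdiff.
have Dp (F : R -> R) : \sum_a F (D (p a)) = \sum_a F (D a).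
  by rewrite -(reindex_inj p_inj (P := xpredT) (F := fun h => F (D h))).
have Dg (F : R -> R) : \sum_a F (D (g a)) = \sum_a F (D a).
  by rewrite -(reindex_inj g_inj (P := xpredT) (F := fun h => F (D h))).
(* [rho a] is the rank whose image under [g] is [p a]; its distance to [a] equals the distance from
   [p a] to [g a], the localization error at [a]. *)
pose rho a := invF g_inj (p a).
have gr a : g (rho a) = p a by rewrite /rho f_invF.
have rho_inj : injective rho by move=> a b /(congr1 g); rewrite !gr => /p_inj.
have row : c / 2 * (\sum_b D (g b) ^+ 2) - 2 * kappa * (\sum_b `|D (g b)|)
    <= \sum_b B i (pos b) * D (g b).
  have DE b : D (g b) = (torus_dist m z (g b))%:R - (torus_dist m u b)%:R.
    by rewrite /D (dihedral_iso _ _ hg).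
  under eq_bigr do rewrite DE; under [in X in _ - X]eq_bigr do rewrite DE.
  under [leRHS]eq_bigr do rewrite DE.
  apply: (@rearrangement _ _ (fun b : 'I_m => torus_dist m u b) (fun b => torus_dist m z (g b))
    (fun b => B i (pos b)) c kappa (m %/ 2)).
  - move=> Phi; rewrite -(reindex_inj g_inj (P := xpredT) (F := fun h : 'I_m => Phi (torus_dist m z h))) /=.
    exact: sum_torus_dist_equi.
  - by move=> b; apply: torus_dist_half.
  - by move=> b; apply: torus_dist_half.
  - by move=> j hj; apply: torus_dist_section; rewrite mulnC -leq_divRL.
  - by move=> b b' h; apply: approx_decreasing (h); rewrite ?pos_close.
have transfer : \sum_b B i (pos b) * D (g b) = \sum_a B i (pos (rho a)) * D (p a).
  by rewrite (reindex_inj rho_inj) /=; apply: eq_bigr => a _; rewrite gr.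
have err : \sum_a (B i (pos (rho a)) - B i (pos a)) * D (p a) <=
   (c_L * omega * (4 * (\sum_a torus_dist m (p a) (g a))%:R + 2 * eta%:R * m%:R) + m%:R * eps) * d.
  rewrite natr_sum.
  have -> : (c_L * omega * (4 * (\sum_a (torus_dist m (p a) (g a))%:R) + 2 * eta%:R * m%:R) + m%:R * eps) * d
    = \sum_a (c_L * omega * (4 * (torus_dist m (p a) (g a))%:R + 2 * eta%:R) + eps) * d.
    rewrite -mulr_suml big_split /= -mulr_sumr big_split /= -mulr_sumr !sumr_const card_ord.
    by rewrite -(mulr_natl eps) -(mulr_natr (2 * _)).
  apply: ler_sum => a _; apply: le_trans (ler_norm _) _; rewrite normrM.
  apply: ler_pM => //.
  apply: le_trans (B_lip.1 _ _ _) _; rewrite lerD2r.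
  rewrite ler_wpM2l //.
  have h1 := pos_close a; have h2 := pos_close (rho a).
  have [||h _] := @torus_dist_rescale n m eta nE (pos a) (pos (rho a)) a (rho a)
    (ltn_ord _) (ltn_ord _) (ltn_ord _) (ltn_ord _).
  - exact: nat_closeP.
  - exact: nat_closeP.
  move: h; rewrite -(dihedral_iso a (rho a) hg) gr torus_distC (torus_distC m (g a)) -(ler_nat R) => h.
  by apply: le_trans h _; rewrite natrD !natrM.
have dS : \sum_b `|D b| <= m%:R * d.
  apply: le_trans (ler_sum (index_enum 'I_m) (P := xpredT) (fun a _ => Dd a)) _.
  by rewrite sumr_const card_ord mulr_natl.
have QE : \sum_a D a ^+ 2 = (\sum_(a < m) absdiff (torus_dist m z a) (torus_dist m (g u) a) ^ 2)%:R.
  rewrite natr_sum; apply: eq_bigr => a _; rewrite natrX -normrB_nat.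
  by rewrite real_normK ?num_real.
have Qge : m%:R * d ^+ 2 <= 36 * (\sum_a D a ^+ 2).
  by rewrite QE -natrX -!natrM ler_nat; exact: sum_sqr_torus_dist_ge.
have Qle : Num.sqrt (\sum_a D a ^+ 2) <= Num.sqrt m%:R * d.
  rewrite -(ger0_norm d0) -sqrtr_sqr -sqrtrM ?ler0n // ler_wsqrtr //.
  apply: le_trans (_ : _ <= \sum_(a < m) d ^+ 2) _; last by rewrite sumr_const card_ord mulr_natl.
  apply: ler_sum => a _; rewrite -[D a ^+ 2]real_normK ?num_real //.
  by rewrite ler_sqr ?nnegrE.
move: noise; rewrite (Dp (fun x => x ^+ 2)) => noise.
have {}opt : \sum_a B i (pos a) * D (p a) + \sum_a W a * D (p a) <= 0.
  by rewrite -big_split /=; under eq_bigr do rewrite -mulrDl.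
move: row; rewrite transfer (Dg (fun x => x ^+ 2)) (Dg (fun x => `|x|)) => row.
have {}err : \sum_a B i (pos (rho a)) * D (p a) - \sum_a B i (pos a) * D (p a) <=
  (c_L * omega * (4 * (\sum_a torus_dist m (p a) (g a))%:R + 2 * eta%:R * m%:R) + m%:R * eps) * d.
  by apply: le_trans err; rewrite -sumrB; apply: ler_sum => a _; rewrite mulrBl.
move: err; set K := (X in X * d) => err.
have K0 : 0 <= K.
  apply: addr_ge0; last by rewrite mulr_ge0 ?eps_ge0.
  by apply: mulr_ge0 => //; apply: addr_ge0; rewrite ?mulr_ge0.
have {}noise := le_trans noise (ler_wpM2l t0 Qle).
have kd := ler_wpM2l (mulr_ge0 (ler0n _ 2) k0) dS.
have Qc := ler_wpM2l (ltW c0) Qge.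
have [d00|d00] := eqVneq d 0.
  by rewrite d00 mulr0 mulr_ge0 // addr_ge0 // addr_ge0 // ?mulr_ge0 ?sqrtr_ge0 // ltW.
have dp : 0 < d by rewrite lt_neqAle eq_sym d00.
rewrite -(ler_pM2r dp) -/K.
move: (\sum_a D a ^+ 2) (\sum_b `|D b|) row Qc kd err opt noise.
move: (\sum_a B i (pos (rho a)) * D (p a)) (\sum_a B i (pos a) * D (p a)) (\sum_a W a * D (p a)).
move: (Num.sqrt m%:R) => sm b1 b2 w Q S row Qc kd err opt noise.
move: (K) row Qc kd err opt noise => k row Qc kd err opt noise; lra.
Qed.
End Estimation.

(** * Angles and planar isometries *)

Section Angles.
Variable R : realType.
Implicit Types (a b c r x y : R) (u v : 'cV[R]_2).

(** Closeness on the circle expressed on real lifts: with an explicit multiple of [2 pi], shifts and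
    reflections of angles become linear arithmetic and [acos] disappears. *)
Definition near_angle a b r := exists k : int, `|a - b - 2 * pi * k%:~R| <= r.

Lemma near_angle_le a b r r' : r <= r' -> near_angle a b r -> near_angle a b r'.
Proof. by move=> rr [k h]; exists k; apply: le_trans rr. Qed.

Lemma near_angle_sym a b r : near_angle a b r -> near_angle b a r.
Proof.
case=> k h; exists (- k); move: h; rewrite !ler_norml => /andP[h1 h2].
by rewrite mulrNz; apply/andP; split; lra.
Qed.

Lemma near_angle_trans b a c r r' :
  near_angle a b r -> near_angle b c r' -> near_angle a c (r + r').
Proof.
move=> [k h] [l h']; exists (k + l); rewrite intrD.
move: h h'; rewrite !ler_norml => /andP[h1 h2] /andP[h3 h4].
by apply/andP; split; lra.
Qed.

Lemma near_angle_shift c a b r : near_angle a b r -> near_angle (c + a) (c + b) r.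
Proof. by case=> k h; exists k; move: h; rewrite !ler_norml => /andP[h1 h2]; apply/andP; split; lra. Qed.

Lemma near_angle_sign (s : bool) a b r :
  near_angle a b r -> near_angle ((-1) ^+ s * a) ((-1) ^+ s * b) r.
Proof.
case: s => -[k h]; last by exists k; rewrite !mul1r.
exists (- k); move: h; rewrite !expr1 !mulN1r mulrNz !ler_norml => /andP[h1 h2].
by apply/andP; split; lra.
Qed.

Lemma cosD2piz x (k : int) : cos (x + 2 * pi * k%:~R) = cos x.
Proof.
have nat_case y (n : nat) : cos (y + 2 * pi * n%:R) = cos y.
  elim: n => [|n ih]; first by rewrite mulr0 addr0.
  by rewrite -[n.+1%:R]natr1 mulrDr mulr1 addrA mulr_natl cosD2pi -mulr_natl ih.
case: k => n; first exact: nat_case.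
by rewrite NegzE mulrNz mulrN -[LHS](nat_case _ n.+1) subrK.
Qed.

Lemma acos_cos_le x r : `|x| <= r -> acos (cos x) <= r.
Proof.
move=> xr; rewrite -cos_norm; have [h|h] := leP `|x| pi.
  by rewrite cosK // in_itv /= normr_ge0.
apply: le_trans xr; apply: le_trans (ltW h).
by rewrite acos_lepi // cos_geN1 cos_le1.
Qed.

Lemma gdist_cis a b : gdist (cis a) (cis b) = acos (cos (a - b)).
Proof. by rewrite /gdist /cis !mxE /= cosB. Qed.

Lemma gdist_le_near a b r : near_angle a b r -> gdist (cis a) (cis b) <= r.
Proof.
case=> k h; rewrite gdist_cis -(cosD2piz _ (- k)) mulrNz mulrN.
exact: acos_cos_le.
Qed.

Lemma near_gdist a b : near_angle a b (gdist (cis a) (cis b)).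
Proof.
have p0 : 0 < 2 * pi :> R by rewrite mulr_gt0 ?pi_gt0.
(* Rounding to the nearest integer leaves a residue in [[-pi, pi]], where [acos] undoes [cos] up to
   sign. *)
pose k := Num.floor ((a - b) / (2 * pi) + 1 / 2).
exists k; rewrite gdist_cis -(cosD2piz _ (- k)) mulrNz mulrN.
set x := a - b - _; rewrite -(cos_norm x) cosK // in_itv /= normr_ge0 /=.
have := floor_itv ((a - b) / (2 * pi) + 1 / 2); rewrite -/k intrD => /andP[h1 h2].
have ab : (a - b) / (2 * pi) * (2 * pi) = a - b by rewrite divfK // gt_eqF.
have {}h1 := ler_wpM2r (ltW p0) h1.
have {}h2 : ((a - b) / (2 * pi) + 1 / 2) * (2 * pi) < (k%:~R + 1%:~R) * (2 * pi) by rewrite ltr_pM2r.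
move: ab h1 h2; rewrite /x; move: ((a - b) / (2 * pi)) => q ab h1 h2.
rewrite ler_norml; apply/andP; split; lra.
Qed.

Lemma near_angle_eq_cis a b : cis a = cis b -> near_angle a b 0.
Proof. by move=> e; have := near_gdist a b; rewrite e gdist_cis subrr cos0 acos1. Qed.

Lemma circle_cis a : circle (cis a).
Proof. by rewrite /circle /cis /= !mxE /= cos2Dsin2. Qed.

Lemma circle_is_cis u : circle u -> exists2 t, 0 < t <= 2 * pi & cis t = u.
Proof.
rewrite /circle /= => h.
have c1 : -1 <= u 0 0 <= 1.
  have : u 0 0 ^+ 2 <= 1 by rewrite -h lerDl sqr_ge0.
  by rewrite -ler_norml -real_normK ?num_real // -[X in _ <= X -> _](expr1n _ 2) ler_sqr ?nnegrE.
have pp := pi_gt0 R.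
pose t0 := acos (u 0 0).
have t0c : cos t0 = u 0 0 by rewrite acosK // in_itv.
have t0s : sin t0 = `|u 1 0|.
  by rewrite sin_acos // -h addrAC subrr add0r sqrtr_sqr.
have t0_ge : 0 <= t0 := acos_ge0 c1; have t0_le : t0 <= pi := acos_lepi c1.
have [t [h1 h2 h3]] : exists t, [/\ 0 <= t <= 2 * pi, cos t = u 0 0 & sin t = u 1 0].
  have [s0|s0] := leP 0 (u 1 0).
    by exists t0; split=> //; [apply/andP; split; lra | rewrite t0s ger0_norm].
  exists (2 * pi - t0); split; first by apply/andP; split; lra.
    by rewrite -t0c -(cosN t0) -(cosD2piz (- t0) 1) mulr1 addrC.
  have -> : sin (2 * pi - t0) = - sin t0.
    by rewrite mulr_natl addrC sinD2pi sinN.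
  by rewrite t0s ltr0_norm // opprK.
have cisE x : cos x = u 0 0 -> sin x = u 1 0 -> cis x = u.
  move=> e1 e2; apply/colP => i; rewrite /cis mxE.
  by case: i => [[|[|//]] hi]; rewrite /= ?e1 ?e2; congr (u _ _); apply/val_inj.
(* The required range excludes 0, so the angle 0 is represented by [2 pi]. *)
have [t00|t00] := eqVneq t 0.
  exists (2 * pi); first by apply/andP; split; lra.
  by apply: cisE; rewrite mulr_natl ?cos2pi ?sin2pi -?h2 -?h3 t00 ?cos0 ?sin0.
exists t; last exact: cisE.
by case/andP: h1 => h1 ->; rewrite lt_neqAle eq_sym t00 h1.
Qed.

Lemma argP u : circle u -> 0 < arg u <= 2 * pi /\ cis (arg u) = u.
Proof.
case/circle_is_cis => t ht tu; rewrite /arg.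
by case: xgetP => [? _ []//|/(_ t)]; case; split.
Qed.

(** The rotation by [al], preceded by the reflection of the second coordinate when [s] holds. *)
Definition isometry_mx (al : R) (s : bool) : 'M[R]_2 :=
  \matrix_(i, j) (if i == 0 then (if j == 0 then cos al else - (-1) ^+ s * sin al)
                 else (if j == 0 then sin al else (-1) ^+ s * cos al)).

Lemma isometry_mx_orthogonal al s : orthogonal_group (isometry_mx al s).
Proof.
rewrite /orthogonal_group /=; apply/matrixP => i j.
rewrite !mxE !big_ord_recl big_ord0 !mxE /=.
have cs := cos2Dsin2 al.
by case: s; case: i => [[|[|//]] ?]; case: j => [[|[|//]] ?];
   rewrite /= ?mulr1n ?mulr0n ?expr1 ?expr0; move: cs; lra.
Qed.

Lemma isometry_mx_cis al s t : isometry_mx al s *m cis t = cis (al + (-1) ^+ s * t).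
Proof.
apply/colP => i; rewrite !mxE !big_ord_recl big_ord0 !mxE /=.
have c : cos ((-1) ^+ s * t) = cos t by case: s; rewrite ?mulN1r ?cosN ?mul1r.
have sn : sin ((-1) ^+ s * t) = (-1) ^+ s * sin t by case: s {c}; rewrite ?mulN1r ?sinN ?mul1r.
by case: i => [[|[|//]] hi] /=; rewrite ?cosD ?sinD c sn; ring.
Qed.

Lemma orthogonal_is_isometry (Q : 'M[R]_2) : orthogonal_group Q ->
  exists al s, Q = isometry_mx al s.
Proof.
rewrite /orthogonal_group /= => QQ; have Q'Q := mulmx1C QQ.
have /matrixP Q1 := Q'Q; have /matrixP Q2 := QQ.
have := Q1 0 0; have := Q1 0 1; have := Q1 1 1.
rewrite !mxE !big_ord_recl !big_ord0 !mxE /= !addr0.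
set l0 := lift ord0 ord0; have -> : l0 = 1 by apply/val_inj.
rewrite !mulr1n !mulr0n => h11 h01 h00.
have [|al _ /colP e] := @circle_is_cis (\col_i Q i 0).
  by rewrite /circle /= !mxE !expr2.
have ec : cos al = Q 0 0 by have := e 0; rewrite !mxE.
have es : sin al = Q 1 0 by have := e 1; rewrite !mxE.
have [w hw] : exists w, Q 0 1 = - w * sin al /\ Q 1 1 = w * cos al.
  (* The witness is the determinant of [Q]. *)
  exists (cos al * Q 1 1 - sin al * Q 0 1); rewrite -ec -es in h00 h01 *.
  have := congr1 (fun x => Q 0 1 * x) h00; have := congr1 (fun x => Q 1 1 * x) h00.
  have := congr1 (fun x => sin al * x) h01; have := congr1 (fun x => cos al * x) h01.
  by rewrite /= !mulr0 !mulr1 => a1 a2 a3 a4; split; lra.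
have w1 : w ^+ 2 = 1.
  move: h11 h00; rewrite -ec -es hw.1 hw.2 => h11 h00.
  have : w ^+ 2 * (cos al * cos al + sin al * sin al) = 1 by rewrite -h11; ring.
  by rewrite h00 mulr1.
have [s ws] : exists s : bool, w = (-1) ^+ s.
  move/eqP: w1; rewrite sqrf_eq1 => /orP[]/eqP ->; first by exists false.
  by exists true.
have o2 (i : 'I_2) : i = 0 \/ i = 1.
  by case: i => [[|[|//]] hi]; [left | right]; apply/val_inj.
exists al, s; apply/matrixP => i j; rewrite mxE -ws.
case: (o2 i) => ->; case: (o2 j) => ->; rewrite /= ?ec ?es //.
- by rewrite hw.1 es mulNr.
- by rewrite hw.2 ec.
Qed.

Lemma gdist_grid (m a b : nat) : (0 < m)%N -> (a <= m)%N -> (b <= m)%N ->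
  gdist (cis (2 * pi * a%:R / m%:R)) (cis (2 * pi * b%:R / m%:R))
  = 2 * pi / m%:R * (torus_dist m a b)%:R :> R.
Proof.
move=> m0 ha hb; rewrite gdist_cis.
have mR : 0 < m%:R :> R by rewrite ltr0n.
have pp := pi_gt0 R.
have -> : 2 * pi * a%:R / m%:R - 2 * pi * b%:R / m%:R = 2 * pi / m%:R * (a%:R - b%:R) :> R.
  by ring.
rewrite -cos_norm normrM ger0_norm; last by rewrite divr_ge0 ?mulr_ge0 // ltW.
rewrite normrB_nat.
have D : torus_dist m a b = absdiff a b \/ (torus_dist m a b = m - absdiff a b)%N.
  by rewrite torus_distE /absdiff; lia.
have Dm : (absdiff a b <= m)%N by rewrite /absdiff; lia.
have -> : cos (2 * pi / m%:R * (absdiff a b)%:R) = cos (2 * pi / m%:R * (torus_dist m a b)%:R) :> R.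
  case: D => -> //; rewrite natrB // mulrBr divfK ?gt_eqF //.
  by rewrite -[RHS]cosN opprB -[RHS](cosD2piz _ 1) mulr1 subrK.
rewrite cosK // in_itv /=; apply/andP; split.
  by rewrite mulr_ge0 // divr_ge0 ?mulr_ge0 // ltW.
rewrite mulrAC ler_pdivrMr // -(mulrA 2) mulrCA ler_pM2l //.
by rewrite -natrM ler_nat torus_dist_double.
Qed.
End Angles.

(** * The group Gamma and ranks *)

Lemma torus_dist_le_int n i j (l : int) :
  (torus_dist n i j <= `|(i%:Z - j%:Z + n%:Z * l)%R|)%N.
Proof.
rewrite torus_distE; have [->|l0] := eqVneq l 0; first by rewrite mulr0; lia.
have : (n%:Z <= `|n%:Z * l|)%R.
  by rewrite normrM ler_peMr //; lia.
lia.
Qed.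

Lemma natr_absz_norm (R : realType) (x : int) : (`|x|%N)%:R = `|x%:~R| :> R.
Proof. by case: x => k; rewrite ?NegzE ?mulrNz ?normrN normr_nat. Qed.

Section GroupGamma.
Variables (R : realType) (n : nat) (n0 : (0 < n)%N).

Lemma circular_perm_exists (k : 'I_n) : exists2 s : {perm 'I_n}, s \in Gamma n &
  forall i, (s i = (i + k) %% n :> nat)%N.
Proof.
pose f (i : 'I_n) : 'I_n := Ordinal (ltn_pmod (i + k) n0).
have f_inj : injective f.
  apply: iso_inj => x y; rewrite /f /= addnC (addnC y).
  exact: torus_dist_modl.
exists (perm f_inj); last by move=> i; rewrite permE.
apply: mem_gen; rewrite inE; apply/orP; left; rewrite inE.
by apply/existsP; exists k; apply/forallP => i; rewrite permE.
Qed.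

Lemma reverse_perm_exists : exists2 s : {perm 'I_n}, s \in Gamma n &
  forall i, s i = rev_ord i.
Proof.
exists (perm (@rev_ord_inj n)); last by move=> i; rewrite permE.
apply: mem_gen; rewrite inE; apply/orP; right; rewrite inE.
by apply/forallP => i; rewrite permE.
Qed.

Lemma modz_ord (a : int) : exists (k : 'I_n) (q : int), a = q * n%:Z + k%:Z.
Proof.
have nz : n%:Z != 0 by lia.
have lt : (`|(a %% n%:Z)%Z| < n)%N.
  by have := modz_ge0 a nz; have := ltz_mod a nz; lia.
exists (Ordinal lt), (a %/ n%:Z)%Z => /=.
by rewrite gez0_abs ?modz_ge0 // -divz_eq.
Qed.

Lemma modn_int (x : nat) : exists q : int, (x %% n)%N%:Z = x%:Z - n%:Z * q.
Proof.
by exists (x %/ n)%N%:Z; rewrite {2}(divn_eq x n) PoszD PoszM [_ * n%:Z]mulrC addrAC subrr add0r.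
Qed.

(** [tau] is a shift, preceded by the reversal when [o] holds. The multiple of [n] stays explicit
    for the later comparison with real angles. *)
Lemma Gamma_affine (a : int) (o : bool) : exists2 tau : {perm 'I_n}, tau \in Gamma n &
  forall p : 'I_n, exists l : int, (tau p).+1%:Z = a + (-1) ^+ o * p%:Z + n%:Z * l.
Proof.
case: o.
- have [k [q ak]] := modz_ord a.
  have [s sG sE] := circular_perm_exists k; have [t tG tE] := reverse_perm_exists.
  exists (t * s)%g; first by rewrite groupM.
  move=> p; rewrite permM sE tE /=.
  have [l lE] := modn_int (n - p.+1 + k).
  exists (1 - q - l); rewrite -addn1 PoszD lE PoszD -subzn // ak expr1 mulN1r -addn1 PoszD.
  by ring.
- have [k [q ak]] := modz_ord (a - 1).
  have [s sG sE] := circular_perm_exists k.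
  exists s => // p; rewrite sE; have [l lE] := modn_int (p + k).
  exists (- q - l); rewrite -addn1 PoszD lE PoszD expr0 mul1r.
  have -> : a = q * n%:Z + k%:Z + 1 by rewrite -ak subrK.
  by ring.
Qed.

(** The extra 2 pays for two roundings, each by less than 1: the offset [n al / (2 pi)] down to an
    integer, and the argument of [cis b] up to its rank. *)
Lemma Gamma_rank (al : R) (o : bool) : exists2 tau : {perm 'I_n}, tau \in Gamma n &
  forall (p : 'I_n) (b rho : R),
    near_angle b (al + (-1) ^+ o * (2 * pi * p%:R / n%:R)) (2 * pi * rho / n%:R) ->
    (torus_dist n (tau p).+1 (rank_of n (cis b)))%:R <= rho + 2.
Proof.
have pp := pi_gt0 R; have nR : 0 < n%:R :> R by rewrite ltr0n.
have p2 : 0 < 2 * pi :> R by rewrite mulr_gt0.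
have [tau tauG tauE] := Gamma_affine (Num.floor (n%:R * al / (2 * pi))) o.
exists tau => // p b rho hb; have [l lE] := tauE p.
have [/andP[arg0 arg1] argb] := argP (circle_cis b).
have [k] := near_angle_trans (near_angle_eq_cis argb) hb.
rewrite add0r /rank_of; set t := arg (cis b) in arg0 arg1 *.
have := ceil_itv (n%:R * t / (2 * pi)); set c := Num.ceil _; rewrite intrB => /andP[c1 c2].
have := floor_itv (n%:R * al / (2 * pi)); move: lE; set fl := Num.floor _.
rewrite intrD => lE /andP[f1 f2] hk.
have c0 : 0 <= c by rewrite ceil_ge0 (lt_le_trans (ltrN10 R)) // !mulr_ge0 ?invr_ge0 ?(ltW p2) // ltW.
have := torus_dist_le_int n (tau p).+1 `|c|%N (k - l); rewrite gez0_abs //.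
rewrite lE -(ler_nat R) natr_absz_norm => h; apply: le_trans h _.
have -> : fl + (-1) ^+ o * p%:Z + n%:Z * l - c + n%:Z * (k - l)
   = fl + (-1) ^+ o * p%:Z - c + n%:Z * k by ring.
have {}hk : `|n%:R * t / (2 * pi) - n%:R * al / (2 * pi) - (-1) ^+ o * p%:R - n%:R * k%:~R| <= rho.
  rewrite -(ler_pM2r (_ : 0 < 2 * pi / n%:R)); last by rewrite divr_gt0.
  have -> : rho * (2 * pi / n%:R) = 2 * pi * rho / n%:R by ring.
  apply: le_trans hk; rewrite -[X in _ * X]gtr0_norm; last by rewrite divr_gt0.
  rewrite -normrM le_eqVlt; apply/orP; left; apply/eqP; congr (`|_|).
  move: (pi : R) pp => w w0; field.
  by rewrite (gt_eqF nR) (gt_eqF w0).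
rewrite !(intrB, intrD, intrM) rmorphXn /= intrN -!pmulrn.
move: hk c1 c2 f1 f2; rewrite !ler_norml.
have one : 1%:~R = 1 :> R by [].
rewrite !one => /andP[h1 h2] c1 c2 f1 f2; apply/andP; split; lra.
Qed.
End GroupGamma.

(** * Alignment *)

Lemma card_interval (n E : nat) (p : 'I_n -> 'I_n) (A : {pred 'I_n}) : injective p ->
  (forall x y, x \in A -> y \in A -> (p y <= p x + E)%N) -> (#|A| <= E.+1)%N.
Proof.
move=> p_inj h; have [x0 x0A|A0] := pickP (mem A); last by rewrite eq_card0.
case: (@arg_minnP _ x0 (mem A) (fun x => p x : nat) x0A) => x xA xmin.
pose f (y : 'I_n) : 'I_E.+1 := inord (p y - p x)%N.
rewrite -[E.+1]card_ord -(card_in_image (f := f)).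
  exact: max_card.
move=> y z yA zA; rewrite /f => /(congr1 val) /=.
have hy := h _ _ xA yA; have hz := h _ _ xA zA.
have h1 := xmin _ yA; have h2 := xmin _ zA.
rewrite !inordK; try lia.
by move=> e; apply/p_inj/ord_inj; lia.
Qed.

Section Alignment.
Variables (R : realType) (n : nat) (n0 : (0 < n)%N) (p : 'I_n -> 'I_n).
Hypothesis p_inj : injective p.
Let theta (i : 'I_n) : R := 2 * pi * (p i)%:R / n%:R.

(* Doubling angles is two-to-one, so few positions have nearly equal doubles. *)
Lemma card_double_angle_le (T : {pred 'I_n}) (c r : R) (E : nat) :
  (E < n)%N -> r * n%:R <= pi * E%:R ->
  (forall i, i \in T -> near_angle (2 * theta i) c r) -> (#|T| <= 5 * E.+1)%N.
Proof.
move=> En rE hT; have [i0 i0T|T0] := pickP (mem T); last by rewrite eq_card0.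
have pp := pi_gt0 R; have nR : 0 < n%:R :> R by rewrite ltr0n.
have h j : j \in T -> exists k : int,
    `|2 * ((p j)%:Z - (p i0)%:Z) - n%:Z * k| <= E%:Z.
  move=> jT; have [k hk] := near_angle_trans (hT _ jT) (near_angle_sym (hT _ i0T)).
  exists k; rewrite -(ler_int R) intr_norm !(intrB, intrM) -!pmulrn.
  have w0 : 0 < 2 * pi / n%:R :> R by rewrite divr_gt0 ?mulr_gt0.
  rewrite -(ler_pM2r w0) -[X in _ * X](gtr0_norm w0) -normrM.
  have -> : (2 * ((p j)%:R - (p i0)%:R) - n%:R * k%:~R) * (2 * pi / n%:R)
     = 2 * theta j - 2 * theta i0 - 2 * pi * k%:~R :> R.
    rewrite /theta; move: (pi : R) => w; field.
    by rewrite gt_eqF.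
  apply: le_trans hk _.
  by rewrite mulrA ler_pdivlMr //; lra.
(* Twice a difference of positions is below [2 n] in absolute value and [E < n], so [k] has five
   possible values, moved into ['I_5] by adding 2. Items sharing the same [k] have positions within
   [E] of each other. *)
have hc (j : 'I_n) : exists c : 'I_5, j \in T ->
    `|2 * ((p j)%:Z - (p i0)%:Z) - n%:Z * (c%:Z - 2)| <= E%:Z.
  have [jT|jT] := boolP (j \in T); last by exists ord0.
  have [k hk] := h _ jT.
  have kb : -3 < k < 3.
    have h1 := ltn_ord (p j); have h2 := ltn_ord (p i0).
    apply/andP; split; nia.
  have lt : (`|(k + 2)%R| < 5)%N by lia.
  exists (Ordinal lt) => _ /=; apply: le_trans hk.
  by have -> : `|(k + 2)%R|%N%:Z - 2 = k by lia.
have [col hcol] := boolp.choice hc.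
have -> : #|T| = (\sum_(c < 5) #|[pred j in T | col j == c]|)%N.
  rewrite -sum1_card (partition_big col xpredT) //=; apply: eq_bigr => c0 _.
  by rewrite -sum1_card; apply: eq_bigl => j; rewrite !inE.
have -> : (5 * E.+1 = \sum_(c < 5) E.+1)%N by rewrite sum_nat_const card_ord.
apply: leq_sum => c0 _; apply: (card_interval p_inj) => x y.
rewrite !inE => /andP[xT /eqP xc] /andP[yT /eqP yc].
by have := hcol _ xT; have := hcol _ yT; rewrite xc yc; lia.
Qed.

(** The isometry [Q0] relating the two reference isometries is a competitor of cost at most [2 r],
    so the optimal [Q] costs no more. With the factor [2 r] for the two estimates, [Q] then matches
    the references within [4 r] on the overlap. *)
Lemma alignment (s s' : {set 'I_n}) (x x' : config R n) (al al' r : R) (o o' : bool) (E : nat)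
    (Q : 'M[R]_2) :
  (E < n)%N -> 4 * r * n%:R <= pi * E%:R -> 0 <= r ->
  (5 * E.+1 < #|~: s :&: ~: s'|)%N ->
  (forall i, i \notin s -> exists2 a, x i = cis a & near_angle a (al + (-1) ^+ o * theta i) r) ->
  (forall i, i \notin s' -> exists2 a, x' i = cis a & near_angle a (al' + (-1) ^+ o' * theta i) r) ->
  is_argmin (@orthogonal_group R) (fun Q => d_inf (~: s :&: ~: s') x (fun i => Q *m x' i)) Q ->
  forall j, j \notin s' ->
    exists2 b, Q *m x' j = cis b & near_angle b (al + (-1) ^+ o * theta j) (5 * r).
Proof.
move=> En rE r0 cardT hx hx' [Qorth Qmin].
have [be [u Qu]] := orthogonal_is_isometry Qorth.
set T := ~: s :&: ~: s' in cardT Qmin.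
have signM (a b : bool) (t : R) : (-1) ^+ a * ((-1) ^+ b * t) = (-1) ^+ (a (+) b) * t.
  by rewrite mulrA signr_addb.
have fit i : i \in T -> near_angle (al + (-1) ^+ o * theta i)
    (be + (-1) ^+ u * (al' + (-1) ^+ o' * theta i)) (4 * r).
  move=> iT.
  have : d_inf T x (fun i => Q *m x' i) <= 2 * r.
    pose v := o (+) o'; pose Q0 := isometry_mx (al - (-1) ^+ v * al') v.
    apply: le_trans (Qmin Q0 (isometry_mx_orthogonal _ _)) _.
    apply: bigmax_le; first by rewrite mulr_ge0.
    move=> k; rewrite !inE => /andP[ks ks'].
    have [a -> ha] := hx _ ks; have [a' -> ha'] := hx' _ ks'.
    rewrite isometry_mx_cis; apply: gdist_le_near.
    have -> : 2 * r = r + r by ring.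
    apply: near_angle_trans ha _; apply: near_angle_sym.
    have := near_angle_shift (al - (-1) ^+ v * al') (near_angle_sign v ha').
    by rewrite mulrDr addrA subrK signM /v -addbA addbb addbF.
  move=> hd; have {hd} hd : gdist (x i) (Q *m x' i) <= 2 * r.
    by apply: le_trans hd; apply: (le_bigmax_cond _ (fun i => gdist (x i) (Q *m x' i))).
  move: iT; rewrite !inE => /andP[ks ks'].
  have [a xa ha] := hx _ ks; have [a' xa' ha'] := hx' _ ks'.
  move: hd; rewrite xa xa' Qu isometry_mx_cis => hd.
  have := near_angle_le hd (near_gdist _ _).
  have := near_angle_shift be (near_angle_sign u ha').
  move=> h1 h2; have := near_angle_trans (near_angle_sym ha) (near_angle_trans h2 h1).
  by apply: near_angle_le; lra.
have [i0 i0T] : exists i, i \in T by apply/card_gt0P; lia.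
(* With the right orientation the discrepancy is a constant angle: the bound [4 r] at [i0] holds for
   every [j], and the error [r] of [x'] is added. *)
have [e|e] := eqVneq o (u (+) o').
- move=> j js'; have [a' -> ha'] := hx' _ js'.
  exists (be + (-1) ^+ u * a'); first by rewrite Qu isometry_mx_cis.
  have := fit _ i0T; rewrite mulrDr signM -e => h1.
  have h2 := near_angle_shift be (near_angle_sign u ha').
  have h3 := near_angle_shift ((-1) ^+ o * theta j - (-1) ^+ o * theta i0) (near_angle_sym h1).
  rewrite mulrDr signM -e in h2.
  have := @near_angle_trans _ _ _ _ _ _ h2 (_ : near_angle _ _ (4 * r)).
  move=> /(_ (al + (-1) ^+ o * theta j)) h4; apply: near_angle_le (h4 _); first lra.
  have [k hk] := h3; exists k; apply: le_trans hk.
  by rewrite le_eqVlt; apply/orP; left; apply/eqP; congr (`|_|); ring.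
- have eo : u (+) o' = ~~ o by move: e; case: (o); case: (u); case: (o').
  suff : (#|T| <= 5 * E.+1)%N by lia.
  apply: (@card_double_angle_le _ ((-1) ^+ o * (be + (-1) ^+ u * al' - al)) (4 * r)) => //.
  move=> i iT; have := fit _ iT; rewrite mulrDr signM eo => h1.
  have h2 := near_angle_sign o (near_angle_shift (- al + (-1) ^+ o * theta i) h1).
  have [k hk] := h2; exists k; apply: le_trans hk.
  rewrite le_eqVlt; apply/orP; left; apply/eqP; congr (`|_|).
  by case: (o) => /=; rewrite ?expr0 ?expr1; ring.
Qed.
End Alignment.

(** * Sampling *)

(** From [expR x * (1 - x) <= 1] and [(1 + x + 2 x^2) (1 - x) = 1 + x^2 (1 - 2 x)]. *)
Lemma expR_le_quadratic (R : realType) (x : R) : x <= 1 / 2 -> expR x <= 1 + x + 2 * x ^+ 2.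
Proof.
move=> x2; have h := expR_ge1Dx (- x).
have e0 := expR_gt0 x.
have : expR x * (1 - x) <= 1.
  by have := ler_wpM2l (ltW e0) h; rewrite expRxMexpNx_1.
move=> h1; have x1 : 0 < 1 - x by lra.
rewrite -(ler_pM2r x1); apply: le_trans h1 _.
have : 0 <= x ^+ 2 * (1 - 2 * x) by rewrite mulr_ge0 ?sqr_ge0 //; lra.
nra.
Qed.

(* The largest term of the expansion of (1 + 3) ^ (4m) is the one of index m. *)
Lemma binomial_mode (m : nat) : 
  (4 ^ (4 * m) <= (4 * m).+1 * ('C(4 * m, m) * 3 ^ (3 * m)))%N.
Proof.
set n := (4 * m)%N; pose a k := ('C(n, k) * 3 ^ (n - k))%N.
have step k : (k < n)%N -> (3 * k.+1 * a k.+1 = (n - k) * a k)%N.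
  move=> kn; rewrite /a; have -> : (n - k = (n - k.+1).+1)%N by lia.
  rewrite expnS; have := mul_bin_left n k.
  have -> : (n - k = (n - k.+1).+1)%N by lia.
  move: (n - k.+1)%N => w /(congr1 (muln (3 * 3 ^ w))).
  move: 'C(n, k) 'C(n, k.+1) (3 ^ w)%N => x y z; lia.
have up k : (k <= m)%N -> (a k <= a m)%N.
  move=> km; have [d dE] : exists d, m = (k + d)%N by exists (m - k)%N; lia.
  elim: d k km dE => [|d ih] k km dE; first by rewrite dE addn0.
  apply: leq_trans (ih k.+1 _ _); try lia.
  have := step k; move: (a k) (a k.+1) => x y h; have {}h := h ltac:(rewrite /n; lia).
  have : ((3 * k.+1) * x <= (n - k) * x)%N by rewrite leq_mul2r; apply/orP; right; rewrite /n; lia.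
  by rewrite -h leq_pmul2l.
have down k : (m <= k <= n)%N -> (a k <= a m)%N.
  case/andP; elim: k => [|k ih] mk kn; first by have -> : m = 0%N by lia.
  have [->//|mk'] := eqVneq m k.+1.
  apply: leq_trans (ih _ _); try lia.
  have := step k kn; move: (a k) (a k.+1) => x y h.
  have : ((n - k) * x <= (3 * k.+1) * x)%N by rewrite leq_mul2r; apply/orP; right; rewrite /n; lia.
  by rewrite -h leq_pmul2l.
have -> : (4 ^ n = \sum_(k < n.+1) a k)%N.
  by rewrite -[4%N]/(3 + 1)%N expnDn; apply: eq_bigr => k _; rewrite exp1n muln1.
have -> : ('C(n, m) * 3 ^ (3 * m) = a m)%N by rewrite /a; congr (_ * 3 ^ _)%N; rewrite /n; lia.
rewrite -[X in (_ <= X * _)%N]card_ord -sum_nat_const; apply: leq_sum => k _.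
have [km|km] := leqP k m; first exact: up.
by apply: down; have := ltn_ord k; lia.
Qed.

Section HypergeometricTail.
Variables (R : realType) (n m : nat) (nE : n = (4 * m)%N) (n0 : (0 < n)%N).

(* Moment generating function of s |-> #|s :&: I|, when each point is drawn
   independently with probability 1/4 (up to the factor 4 ^ n). *)
Lemma sum_weighted_exp (I : {set 'I_n}) (lam : R) :
  \sum_(s : {set 'I_n}) 3 ^+ (n - #|s|) * expR (lam * #|s :&: I|%:R)
  = \prod_(i < n) (3 + expR (lam * (i \in I)%:R)).
Proof.
under [RHS]eq_bigr do rewrite addrC.
rewrite bigA_distr; apply: eq_big => [s|s _]; first by rewrite inE.
rewrite (bigID (mem s)) /= mulrC; congr (_ * _).
- rewrite (eq_bigr (fun i => expR (lam * (i \in I)%:R))); last by move=> i ->.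
  rewrite -expR_sum -mulr_sumr; congr (expR (lam * _)).
  rewrite -natr_sum; congr (_%:R); rewrite -sum1_card big_mkcond [RHS]big_mkcond /=.
  by apply: eq_bigr => i _; rewrite inE; case: (i \in s); case: (i \in I).
- rewrite (eq_bigr (fun=> 3)); last by move=> i /negPf ->.
  rewrite prodr_const; congr (_ ^+ _).
  have := cardC (mem s); rewrite card_ord => sC; apply/esym/eqP.
  by rewrite -(eqn_add2l #|s|) subnKC ?sC // -[leqRHS]sC leq_addr.
Qed.

(** Chernoff bound for independent draws, with a tilt of size [h / n], the minimizer of
    [n lam^2 / 2 - lam h]. The condition [h <= n / 2] keeps the tilt in the range of
    [expR_le_quadratic], and [binomial_mode] restricts to samples of size [m] at the price of
    [n + 1]. *)
Lemma hypergeometric_tail (I : {set 'I_n}) (b : bool) (h : R) :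
  0 <= h -> h <= n%:R / 2 ->
  #|[set s : {set 'I_n} | (#|s| == m) &&
      (h < (-1) ^+ b * (#|s :&: I|%:R - #|I|%:R / 4))]%SET|%:R
  <= n.+1%:R * 'C(n, m)%:R * expR (- (h ^+ 2 / (2 * n%:R))) :> R.
Proof.
move=> h0 hn; set bad := [set s | _]%SET.
have nR : 0 < n%:R :> R by rewrite ltr0n.
pose lam : R := (-1) ^+ b * (h / n%:R).
have lam2 : lam ^+ 2 = (h / n%:R) ^+ 2 by rewrite /lam exprMn sqrr_sign mul1r.
have hn0 : 0 <= h / n%:R by rewrite divr_ge0 // ltW.
have hn2 : h / n%:R <= 1 / 2 by rewrite ler_pdivrMr //; lra.
have lam_le : lam <= 1 / 2.
  have e : `|lam| = h / n%:R by rewrite /lam normrM normr_sign mul1r ger0_norm.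
  by apply: le_trans (ler_norm _) _; rewrite e.
have fac (i : 'I_n) : 3 + expR (lam * (i \in I)%:R) <=
    4 * expR ((i \in I)%:R * (lam / 4 + lam ^+ 2 / 2)).
  case: (i \in I); rewrite /= ?mulr1 ?mul1r ?mulr0 ?mul0r ?expR0; last by lra.
  have h1 := expR_le_quadratic lam_le.
  by have h2 := expR_ge1Dx (lam / 4 + lam ^+ 2 / 2); lra.
have mgf : \sum_(s : {set 'I_n}) 3 ^+ (n - #|s|) * expR (lam * #|s :&: I|%:R)
    <= 4 ^+ n * expR (#|I|%:R * (lam / 4) + n%:R * (lam ^+ 2 / 2)).
  rewrite sum_weighted_exp; apply: le_trans (_ : _ <= \prod_(i < n)
    (4 * expR ((i \in I)%:R * (lam / 4 + lam ^+ 2 / 2)))) _.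
    by apply: ler_prod => i _; rewrite fac addr_ge0 // expR_ge0.
  rewrite big_split /= prodr_const card_ord -expR_sum -mulr_suml -natr_sum.
  have -> : (\sum_(i < n) (i \in I) = #|I|)%N.
    by rewrite -sum1_card [RHS]big_mkcond; apply: eq_bigr => i _; case: (i \in I).
  rewrite ler_pM2l ?exprn_gt0 // ler_expR mulrDr lerD2l ler_wpM2r ?divr_ge0 ?sqr_ge0 //.
  by rewrite ler_nat -[leqRHS]card_ord max_card.
have low : #|bad|%:R * (3 ^+ (n - m) * expR (lam * (#|I|%:R / 4) + h * (h / n%:R)))
    <= \sum_(s : {set 'I_n}) 3 ^+ (n - #|s|) * expR (lam * #|s :&: I|%:R).
  rewrite [leRHS](bigID (mem bad)) /= mulr_natl -sumr_const.
  rewrite -[leLHS]addr0; apply: lerD; last first.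
    by apply: sumr_ge0 => s _; rewrite mulr_ge0 ?exprn_ge0 ?expR_ge0.
  apply: ler_sum => s; rewrite inE => /andP[/eqP -> hs].
  rewrite ler_pM2l ?exprn_gt0 // ler_expR.
  have := ler_wpM2r hn0 (ltW hs); rewrite mulrAC -/lam; lra.
have e3 : (n - m = 3 * m)%N by lia.
have md : 4 ^+ n <= n.+1%:R * ('C(n, m)%:R * 3 ^+ (n - m)) :> R.
  by rewrite e3 -!natrX -!natrM ler_nat nE binomial_mode.
set C := expR (lam * (#|I|%:R / 4)).
have C0 : 0 < C by apply: expR_gt0.
have T0 : 0 < 3 ^+ (n - m) :> R by rewrite exprn_gt0.
have key := le_trans low mgf.
have e1 : expR (#|I|%:R * (lam / 4) + n%:R * (lam ^+ 2 / 2)) =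
   C * expR (h * (h / n%:R)) * expR (- (h ^+ 2 / (2 * n%:R))).
  rewrite /C -!expRD; congr expR; rewrite lam2; field.
  by rewrite gt_eqF.
move: key; rewrite e1 expRD -/C => key.
have H0 : 0 < C * expR (h * (h / n%:R)) by rewrite mulr_gt0 ?expR_gt0.
have X0 : 0 <= expR (- (h ^+ 2 / (2 * n%:R))) by apply: expR_ge0.
have : #|bad|%:R * 3 ^+ (n - m) <= 4 ^+ n * expR (- (h ^+ 2 / (2 * n%:R))).
  by rewrite -(ler_pM2r H0); move: key; rewrite !mulrA; lra.
move=> key2; rewrite -(ler_pM2r T0); apply: le_trans key2 _.
have := ler_wpM2r X0 md; lra.
Qed.

End HypergeometricTail.

Section SampleRanks.
Variables (n m : nat) (p : 'I_n -> 'I_n).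
Hypothesis p_inj : injective p.

Definition below (k : nat) : {set 'I_n} := [set i | (p i < k)%N]%SET.

Lemma card_below k : (k <= n)%N -> #|below k| = k.
Proof.
move=> kn; have -> : below k = (p @^-1: [set i : 'I_n | (i < k)%N])%SET.
  by apply/setP => i; rewrite !inE.
rewrite card_preimset //.
have -> : [set i : 'I_n | (i < k)%N]%SET = (widen_ord kn @: [set: 'I_k]%SET)%SET.
  apply/setP => i; rewrite inE; apply/idP/imsetP => [ik|[j _ ->]]; last exact: (ltn_ord j).
  by exists (Ordinal ik); [rewrite inE | apply: ord_inj].
rewrite card_imset ?cardsT ?card_ord //.
by move=> x y /(congr1 (@nat_of_ord n)) /= e; apply: ord_inj.
Qed.

(** [pos] sorts the sample by position: exactly [a] sampled items precede [pos a]. *)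
Lemma sample_enumeration (s : {set 'I_n}) (eta : nat) : #|s| = m ->
  (forall j, nat_close eta (4 * #|s :&: below (p j)|) (p j)) ->
  exists pos : 'I_m -> 'I_n,
    [/\ injective pos, forall a, pos a \in s,
        forall j, j \in s -> exists a, pos a = j &
        forall a : 'I_m, nat_close eta (4 * a) (p (pos a))].
Proof.
move=> sm hs; pose rk j := #|s :&: below (p j)|.
have rk_lt i j : i \in s -> (p i < p j)%N -> (rk i < rk j)%N.
  move=> si ij; apply: proper_card; apply/properP; split.
    apply/fintype.subsetP => k; rewrite !inE => /andP[-> ki]; exact: ltn_trans ij.
  by exists i; rewrite !inE ?si ?ltnn.
have rk_inj : {in s &, injective rk}.
  move=> i j si sj e; apply/p_inj/ord_inj; apply/eqP.
  by case: ltngtP => // ij; have := rk_lt _ _ _ ij; rewrite e ltnn => /(_ ltac:(done)).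
have rk_m j : j \in s -> (rk j < m)%N.
  move=> sj; rewrite -sm; apply: proper_card; apply/properP; split.
    by apply/fintype.subsetP => k; rewrite inE => /andP[].
  by exists j => //; rewrite !inE sj ltnn.
have [_ rkE] : (size (map rk (enum s)) = size (iota 0 m)) * (map rk (enum s) =i iota 0 m).
  apply: uniq_min_size.
  - rewrite map_inj_in_uniq ?enum_uniq // => i j; rewrite !mem_enum; exact: rk_inj.
  - by move=> x /mapP[j]; rewrite mem_enum => sj ->; rewrite mem_iota add0n rk_m.
  - by rewrite size_iota size_map -cardE sm.
have ex (a : 'I_m) : exists j, j \in s /\ rk j = a.
  have : (a : nat) \in map rk (enum s) by rewrite rkE mem_iota add0n /=.
  by case/mapP => j; rewrite mem_enum => sj ->; exists j.
have [pos posP] := boolp.choice ex.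
exists pos; split.
- by move=> a b e; apply: ord_inj; rewrite -(posP a).2 -(posP b).2 e.
- by move=> a; case: (posP a).
- move=> j sj; exists (Ordinal (rk_m _ sj)).
  by apply: rk_inj => //; case: (posP (Ordinal (rk_m j sj))).
- by move=> a; have := hs (pos a); rewrite -/(rk (pos a)) (posP a).2.
Qed.

Definition unbalanced (R : realType) (h : R) : {set {set 'I_n}} :=
  [set s : {set 'I_n} | (#|s| == m) && [exists j, exists b : bool,
     h < (-1) ^+ b * (#|s :&: below (p j)|%:R - (p j)%:R / 4)]]%SET.

Lemma balanced_close (R : realType) (h : R) (s : {set 'I_n}) (eta : nat) j :
  #|s| = m -> s \notin unbalanced h -> 4 * h <= eta%:R ->
  nat_close eta (4 * #|s :&: below (p j)|) (p j).
Proof.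
move=> sm; rewrite inE sm eqxx /= => /existsPn/(_ j)/existsPn hb he.
have := hb false; have := hb true; rewrite -!leNgt expr0 expr1 mul1r mulN1r.
by rewrite /nat_close -!(ler_nat R) !natrD => h1 h2; apply/andP; split; lra.
Qed.

Lemma card_unbalanced (R : realType) (h : R) : n = (4 * m)%N -> (0 < n)%N ->
  0 <= h -> h <= n%:R / 2 ->
  #|unbalanced h|%:R
  <= (2 * n)%:R * (n.+1%:R * 'C(n, m)%:R * expR (- (h ^+ 2 / (2 * n%:R)))) :> R.
Proof.
move=> nE n0 h0 hn.
pose bad (jb : 'I_n * bool) := [set s : {set 'I_n} | (#|s| == m) &&
  (h < (-1) ^+ jb.2 * (#|s :&: below (p jb.1)|%:R - #|below (p jb.1)|%:R / 4))]%SET.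
have sub : unbalanced h \subset (\bigcup_jb bad jb)%SET.
  apply/fintype.subsetP => s; rewrite !inE => /andP[sm /existsP[j /existsP[b hb]]].
  by apply/finset.bigcupP; exists (j, b) => //; rewrite inE sm /= card_below // ltnW.
have c : (#|unbalanced h| <= \sum_jb #|bad jb|)%N.
  apply: leq_trans (subset_leq_card sub) _.
  elim/big_rec2: _ => [|jb k A _ hA]; first by rewrite cards0.
  by apply: leq_trans (leq_card_setU _ _) _; rewrite leq_add2l.
apply: le_trans (_ : _ <= (\sum_jb #|bad jb|)%:R) _; first by rewrite ler_nat.
rewrite natr_sum; apply: le_trans (ler_sum _ (fun jb _ => hypergeometric_tail nE n0 _ _ h0 hn)) _.
by rewrite sumr_const card_prod card_ord card_bool -[leLHS]mulr_natl mulnC.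
Qed.
End SampleRanks.

(** * Accuracy of a half-estimate under quiet noise *)

Section Grid.
Variables (R : realType) (n m : nat) (m0 : (0 < m)%N).

Definition grid_point (h : nat) : 'cV[R]_2 := cis (2 * pi * h%:R / m%:R).

Lemma grid_point_mod h : (h <= m)%N -> grid_point (h %% m) = grid_point h.
Proof.
rewrite leq_eqVlt => /orP[/eqP ->|hm]; last by rewrite modn_small.
rewrite modnn /grid_point mulr0 mul0r mulfK ?pnatr_eq0 -?lt0n //.
by apply/colP => i; rewrite !mxE mulr_natl cos2pi sin2pi cos0 sin0.
Qed.

Lemma grid_point_inj a b : (0 < a <= m)%N -> (0 < b <= m)%N ->
  grid_point a = grid_point b -> a = b.
Proof.
move=> /andP[a0 am] /andP[b0 bm] e.
have := gdist_grid R m0 am bm; rewrite -/(grid_point a) -/(grid_point b) e.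
rewrite /grid_point gdist_cis subrr cos0 acos1 => /esym/eqP.
rewrite mulf_eq0 (gt_eqF (divr_gt0 _ _)) ?ltr0n ?mulr_gt0 ?pi_gt0 //= pnatr_eq0 => /eqP.
by rewrite torus_distE; lia.
Qed.

(* Index of a grid point; arbitrary off the grid. *)
Definition grid_index (v : 'cV[R]_2) : 'I_m :=
  odflt (Ordinal m0) [pick h : 'I_m | `[< grid_point h = v >]].

Lemma grid_indexK (h : 'I_m) : grid_point (grid_index (grid_point h)) = grid_point h.
Proof.
rewrite /grid_index; case: pickP => [k /asboolP //|/(_ h)].
by move/negbT/asboolPn.
Qed.

(** The labels [1, ..., m] of [Pi_grid] become indices in ['I_m] by identifying [m] with [0]. *)
Lemma Pi_grid_index (s : {set 'I_n}) (x : config R n) : #|s| = m -> Pi_grid s x ->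
  (forall i, i \in s -> x i = grid_point (grid_index (x i))) /\
  {in s &, injective (fun i => grid_index (x i))}.
Proof.
move=> sm [sg [sg_inj sgP]].
have xE i : i \in s -> exists h : 'I_m, x i = grid_point h.
  move=> si; have [] := sgP i si; rewrite sm => /andP[_ h] xi.
  exists (Ordinal (ltn_pmod (sg i) m0)).
  by rewrite /= grid_point_mod.
have xI i : i \in s -> x i = grid_point (grid_index (x i)).
  by move=> si; have [h hE] := xE i si; rewrite hE grid_indexK.
split=> // i j si sj /= e; apply: sg_inj => //; apply: grid_point_inj.
- by have [] := sgP i si; rewrite sm.
- by have [] := sgP j sj; rewrite sm.
have [_] := sgP i si; have [_] := sgP j sj; rewrite sm /grid_point => <- <-.
by rewrite (xI i si) (xI j sj) e.
Qed.
End Grid.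

Lemma nat_close_div4 eta x : (3 <= eta)%N -> nat_close eta (4 * (x %/ 4)) x.
Proof. by rewrite /nat_close; lia. Qed.

Section Constants.
Variables (R : realType) (c_e c_l c_L : R).

(** Times [L / 4], this bounds [kappa * m] when [eta <= Ce * L]. *)
Definition mismatch_const (Ce : R) := 16 * pi * c_L * Ce + 2 * c_e.
(** Times [m ^ 2 * L], this bounds the total error on the pairwise distances of the sample. *)
Definition localization_const (Ce : R) := (4 + mismatch_const Ce / 2) / (pi * c_l).
(** Times [L], this bounds the error of a refined item, in steps of the coarse grid. *)
Definition refinement_const (Ce : R) :=
  36 * (8 + mismatch_const Ce / 2
    + c_L * (pi / 2) * (120 * localization_const Ce + 2 * Ce) + c_e / 4) / (pi * c_l).

(** Arithmetic separated from the geometry: [M] stands for [m], [T] for the total error on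
    distances, [S] for the total error on positions, [D] for the error of the refined item. *)
Lemma refinement_const_bound (M L Ce eta T S D eps sq kappa : R) :
  0 < c_l -> c_l <= c_L -> 0 < M -> 0 <= L ->
  eta <= Ce * L -> eps = c_e * (L / (4 * M)) -> sq <= L ->
  kappa = 8 * c_L * (2 * pi / (4 * M)) * eta + 2 * eps ->
  4 * c_l * (2 * pi / (4 * M)) * T <= 2 * M * (4 * L + 2 * kappa * M) ->
  M * S <= 30 * T ->
  4 * c_l * (2 * pi / (4 * M)) * M * D <= 72 * (8 * sq + 2 * kappa * M +
    (c_L * (2 * pi / (4 * M)) * (4 * S + 2 * eta * M) + M * eps)) ->
  D <= refinement_const Ce * L.
Proof.
move=> cl0 clL M0 L0 etaL epsE sqL kE hT hS hD.
have pp := pi_gt0 R; have cL0 : 0 < c_L := lt_le_trans cl0 clL.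
have w : 2 * pi / (4 * M) = pi / 2 / M by field; rewrite gt_eqF.
have pc : 0 < pi * c_l by rewrite mulr_gt0.
rewrite !w in kE hT hD.
have epsM : M * eps = c_e * L / 4 by rewrite epsE; field; rewrite gt_eqF.
set k1 := mismatch_const Ce.
have kM : kappa * M <= k1 * L / 4.
  have -> : kappa * M = 4 * pi * c_L * eta + 2 * (M * eps).
    by rewrite kE; move: (pi : R) => v; field; rewrite gt_eqF.
  have := ler_wpM2l (ltW (mulr_gt0 pp cL0)) etaL.
  by rewrite epsM /k1 /mismatch_const; lra.
set k2 := localization_const Ce.
have k2E : pi * c_l * k2 = 4 + k1 / 2.
  by rewrite /k2 /localization_const mulrC divfK // gt_eqF.
have T_le : T <= M ^+ 2 * (k2 * L).
  rewrite -(ler_pM2l pc) -(ler_pM2l (_ : 0 < 2 / M)) ?divr_gt0 //.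
  have -> : 2 / M * (pi * c_l * T) = 4 * c_l * (pi / 2 / M) * T.
    by move: (pi : R) => v; field; rewrite gt_eqF.
  apply: le_trans hT _.
  have -> : 2 / M * (pi * c_l * (M ^+ 2 * (k2 * L))) = 2 * M * (pi * c_l * k2 * L).
    by move: (pi : R) => v; field; rewrite gt_eqF.
  rewrite k2E ler_pM2l ?mulr_gt0 //; lra.
have S_le : S <= 30 * M * (k2 * L).
  by rewrite -(ler_pM2l M0); apply: le_trans hS _; lra.
have hD' : 2 * (pi * c_l) * D <= 72 * (8 * sq + 2 * (kappa * M) +
    (c_L * (pi / 2) * (4 * (S / M) + 2 * eta) + M * eps)).
  have -> : 2 * (pi * c_l) * D = 4 * c_l * (pi / 2 / M) * M * D.
    by move: (pi : R) => v; field; rewrite gt_eqF.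
  apply: le_trans hD _; rewrite le_eqVlt; apply/orP; left; apply/eqP.
  by move: (pi : R) => v; field; rewrite gt_eqF.
have SM : S / M <= 30 * (k2 * L) by rewrite ler_pdivrMr //; lra.
have c2 : 0 <= c_L * (pi / 2) by rewrite mulr_ge0 ?divr_ge0 // ltW.
have h1 : c_L * (pi / 2) * (4 * (S / M) + 2 * eta) <= c_L * (pi / 2) * ((120 * k2 + 2 * Ce) * L).
  by apply: ler_wpM2l => //; lra.
rewrite /refinement_const -/k1 -/k2 mulrAC ler_pdivlMr //.
move: h1 hD'; rewrite epsM; move: (c_L * (pi / 2)) (pi * c_l) (S / M) => a b e; lra.
Qed.
End Constants.

Lemma dihedral_angle (R : realType) m (g : 'I_m -> 'I_m) : (0 < m)%N -> dihedral g ->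
  exists (k : 'I_m) (o : bool), forall u,
    @near_angle R (2 * pi * (g u)%:R / m%:R)
      (2 * pi * k%:R / m%:R + (-1) ^+ o * (2 * pi * u%:R / m%:R)) 0.
Proof.
move=> m0 [k hk]; exists k; have mR : 0 < m%:R :> R by rewrite ltr0n.
have cast (x : nat) : exists l : int, (x %% m)%N%:R = x%:R - m%:R * l%:~R :> R.
  exists (x %/ m)%N%:Z; rewrite -pmulrn {2}(divn_eq x m) natrD natrM.
  by rewrite mulrC addrC addKr.
case: hk => hg; [exists false | exists true] => u; rewrite hg.
- have [l ->] := cast (k + u)%N; exists (- l); rewrite natrD mulrNz normr_le0; apply/eqP.
  by rewrite expr0; move: (pi : R) => v; field; rewrite gt_eqF.
- have [l ->] := cast (k + (m - u))%N; exists (1 - l).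
  rewrite natrD natrB ?(ltnW (ltn_ord u)) // intrB normr_le0; apply/eqP.
  by rewrite expr1; move: (pi : R) => v; field; rewrite gt_eqF.
Qed.

Section HalfEstimate.
Variables (R : realType) (n m : nat) (nE : n = (4 * m)%N) (m8 : (8 <= m)%N).
Variables (c_e c_l c_L : R) (c_e0 : 0 <= c_e) (cl0 : 0 < c_l) (clL : c_l <= c_L).
Variables (F : 'M[R]_n) (sigma : {perm 'I_n}).
Let L : R := Num.sqrt (n%:R * ln n%:R).
Let eps : R := c_e * Num.sqrt (ln n%:R / n%:R).
Hypothesis F_lip : bi_lipschitz c_l c_L eps (\matrix_(i, j) F (sigma i) (sigma j)).
Let p : 'I_n -> 'I_n := (sigma^-1)%g.

Variable m0 : (0 < m)%N.
Let n0 : (0 < n)%N. Proof. by rewrite nE; lia. Qed.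

Definition quiet_sample (A : 'M[R]_n) (s : {set 'I_n}) (t : R) : Prop :=
  forall k k' : {ffun 'I_n -> 'I_m},
    let D i j := (torus_dist m (k i) (k j))%:R - (torus_dist m (k' i) (k' j))%:R : R in
    - (\sum_(i in s) \sum_(j in s) (A i j - F i j) * D i j)
      <= t * Num.sqrt (\sum_(i in s) \sum_(j in s) D i j ^+ 2).

Definition quiet_outside (A : 'M[R]_n) (s : {set 'I_n}) (X : 'I_n -> 'I_m) (t : R) : Prop :=
  forall i (z z' : 'I_m), i \notin s ->
    let D j := (torus_dist m z (X j))%:R - (torus_dist m z' (X j))%:R : R in
    - (\sum_(j in s) (A i j - F i j) * D j) <= t * Num.sqrt (\sum_(j in s) D j ^+ 2).

Lemma half_estimate_accuracy (K : localizer R n m) (A : 'M[R]_n) (s : {set 'I_n})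
    (eta : nat) (Ce : R) :
  #|s| = m -> (forall j, nat_close eta (4 * #|s :&: below p (p j)|) (p j)) ->
  (3 <= eta)%N -> eta%:R <= Ce * L ->
  quiet_sample A s (4 * L) ->
  quiet_outside A s (fun j => grid_index m0 (loc K s (block s s A) j)) (8 * Num.sqrt (ln n%:R)) ->
  exists (al : R) (o : bool), forall i, i \notin s ->
    exists2 a, half_estimate K A s i = cis a &
      near_angle a (al + (-1) ^+ o * (2 * pi * (p i)%:R / n%:R))
        (2 * pi * (4 * (refinement_const c_e c_l c_L Ce * L) + eta%:R) / n%:R).
Proof.
move=> sm sb eta3 etaL q1 q2.
have p_inj : injective p by apply: perm_inj.
have [pos [pos_inj pos_s pos_surj posW]] := sample_enumeration p_inj sm sb.
pose B : 'M[R]_n := \matrix_(i, j) F (sigma i) (sigma j).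
have lip : bi_lipschitz c_l c_L eps B := F_lip.
have BE i j : B (p i) (p j) = F i j by rewrite mxE !permKV.
have pp : 0 < pi :> R := pi_gt0 R.
have nR : 0 < n%:R :> R by rewrite ltr0n.
have mR : 0 < m%:R :> R by rewrite ltr0n.
have sumE (G : 'I_n -> R) : \sum_(i in s) G i = \sum_a G (pos a).
  have -> : s = (pos @: [set: 'I_m])%SET.
    apply/setP => i; apply/idP/imsetP => [/pos_surj[a <-]|[a _ ->]]; last exact: pos_s.
    by exists a.
  rewrite big_imset /=; last by move=> x y _ _; exact: pos_inj.
  by apply: eq_bigl => a; rewrite inE.
set x1 := loc K s (block s s A) in q2.
have [x1P x1min] := locP K (block s s A) sm; rewrite -/x1 in x1P x1min.
have [x1E x1inj] := Pi_grid_index m0 sm x1P.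
pose X j := grid_index m0 (x1 j).
pose q a := X (pos a).
have q_inj : injective q.
  by move=> a b e; apply: pos_inj; apply: x1inj => //; exact: pos_s.
have grid0 := gdist_grid R m0.
have wm : 0 < 2 * pi / m%:R :> R by rewrite divr_gt0 ?mulr_gt0.

have [rk rkP] : exists rk : 'I_n -> 'I_m, forall a, rk (pos a) = a.
  have ex j : exists a : 'I_m, j \in s -> pos a = j.
    have [js|js] := boolP (j \in s); last by exists (Ordinal m0).
    by have [a <-] := pos_surj _ js; exists a.
  have [rk rkP] := boolp.choice ex; exists rk => a; apply: pos_inj.
  by rewrite rkP // pos_s.
(* The competitor is the true order of the sample. The successor matches the labels [1, ..., m] of
   [Pi_grid]; distances do not see this shift. *)
pose y : config R n := fun j => grid_point R m (rk j).+1.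
have yP : Pi_grid s y.
  exists (fun j => (rk j).+1); split.
    move=> i j si sj [] /ord_inj e.
    have [a ea] := pos_surj _ si; have [b eb] := pos_surj _ sj.
    by move: e; rewrite -ea -eb !rkP => ->.
  by move=> i si; rewrite sm /= ltn_ord.
have costE (x : config R n) (k : 'I_m -> nat) (k' : 'I_m -> 'I_m) :
    (forall a, (k a <= m)%N) -> (forall a, x (pos a) = grid_point R m (k a)) ->
    (forall a b, torus_dist m (k a) (k b) = torus_dist m (k' a) (k' b)) ->
    loc_cost s (block s s A) x =
    2 * pi / m%:R * \sum_a \sum_b A (pos a) (pos b) * (torus_dist m (k' a) (k' b))%:R.
  move=> km xk kk'; rewrite /loc_cost sumE mulr_sumr; apply: eq_bigr => a _.
  rewrite sumE mulr_sumr; apply: eq_bigr => b _.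
  by rewrite mxE !pos_s /= !xk grid0 ?km // kk' mulrCA.
have opt1 : \sum_a \sum_b (B (p (pos a)) (p (pos b)) + (A (pos a) (pos b) - F (pos a) (pos b)))
    * ((torus_dist m (q a) (q b))%:R - (torus_dist m a b)%:R) <= 0.
  have := x1min _ yP.
  rewrite (costE x1 q q (fun a => ltnW (ltn_ord _)) (fun a => x1E _ (pos_s a)) (fun a b => erefl)).
  have yE a : y (pos a) = grid_point R m a.+1 by rewrite /y rkP.
  have y_shift (a b : 'I_m) : torus_dist m a.+1 b.+1 = torus_dist m a b.
    by rewrite !torus_distE !subSS.
  rewrite (costE y (fun a => a.+1) id (fun a => ltn_ord a) yE y_shift).
  rewrite ler_pM2l // -subr_le0 -sumrB; under eq_bigr do rewrite -sumrB.
  move=> h; apply: le_trans h; rewrite le_eqVlt; apply/orP; left; apply/eqP.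
  apply: eq_bigr => a _; apply: eq_bigr => b _.
  by rewrite BE addrC subrK mulrBr.
have L0 : 0 <= L := sqrtr_ge0 _.
have noise1 : - (\sum_a \sum_b (A (pos a) (pos b) - F (pos a) (pos b))
      * ((torus_dist m (q a) (q b))%:R - (torus_dist m a b)%:R))
    <= 4 * L * Num.sqrt (\sum_a \sum_b ((torus_dist m (q a) (q b))%:R - (torus_dist m a b)%:R) ^+ 2).
  have := q1 [ffun j => X j] [ffun j => rk j].
  have sum2E (G : 'I_n -> 'I_n -> R) :
      \sum_(i in s) \sum_(j in s) G i j = \sum_a \sum_b G (pos a) (pos b).
    by rewrite sumE; apply: eq_bigr => a _; exact: sumE.
  rewrite /= !sum2E /=.
  under eq_bigr do under eq_bigr do rewrite !ffunE !rkP.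
  by under [in X in _ <= _ * Num.sqrt X]eq_bigr do under eq_bigr do rewrite !ffunE !rkP.
have t0 : 0 <= 4 * L by rewrite mulr_ge0.
have := localization_error nE n0 cl0 clL lip posW q_inj t0 opt1 noise1.
set kappa := 8 * c_L * _ * eta%:R + _ => loc_err.
have [g [hg]] := isometry_approximation q m8.
rewrite -(ler_nat R) !natrM; set S := (\sum_b _)%N => Sle.
set T := \sum_a \sum_b _ in loc_err.
have TE : (\sum_a \sum_b absdiff (torus_dist m (q a) (q b)) (torus_dist m a b))%:R = T.
  rewrite /T natr_sum; apply: eq_bigr => a _; rewrite natr_sum.
  by apply: eq_bigr => b _; rewrite normrB_nat.
move: Sle; rewrite TE => Sle.
have [k [b hk]] := dihedral_angle R m0 hg.
exists (2 * pi * k%:R / m%:R), b => i si.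
(* The coarse position of [i], off by at most 3 fine steps, which explains [3 <= eta]. *)
have um : (p i %/ 4 < m)%N by rewrite ltn_divLR // mulnC -nE.
pose u := Ordinal um.
have uW : nat_close eta (4 * u) (p i) by exact: nat_close_div4.
have [[h hm hE] zmin] := refP K i (block [set i] s A) (subtuple s x1) sm.
set z := ref _ _ _ _ _ in hE zmin.
have zE : half_estimate K A s i = z by [].
pose zi := Ordinal hm.
have rcostE (w : nat) : (w <= m)%N ->
    ref_cost s i (block [set i] s A) (subtuple s x1) (grid_point R m w) =
    2 * pi / m%:R * \sum_a A i (pos a) * (torus_dist m w (q a))%:R.
  move=> wm0; rewrite /ref_cost sumE mulr_sumr; apply: eq_bigr => a _.
  rewrite mxE /subtuple !pos_s !inE eqxx /= x1E ?pos_s // grid0 ?(ltnW (ltn_ord _)) //.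
  by rewrite mulrCA.
(* The competitor is [g u], the aligned image of the true coarse position of [i]. *)
have opt2 : \sum_a (B (p i) (p (pos a)) + (A i (pos a) - F i (pos a)))
    * ((torus_dist m zi (q a))%:R - (torus_dist m (g u) (q a))%:R) <= 0.
  have gm : circle_grid m (grid_point R m (g u)) by exists (g u).
  have := zmin _ gm; rewrite hE !rcostE ?(ltnW (ltn_ord _)) ?(ltnW hm) //.
  rewrite ler_pM2l // -subr_le0 -sumrB.
  move=> hh; apply: le_trans hh; rewrite le_eqVlt; apply/orP; left; apply/eqP.
  by apply: eq_bigr => a _; rewrite BE addrC subrK mulrBr.
have noise2 := q2 i zi (g u) si; rewrite /= !sumE in noise2.
have t20 : 0 <= 8 * Num.sqrt (ln n%:R) :> R by rewrite mulr_ge0 // sqrtr_ge0.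
have := refinement_error nE n0 cl0 clL lip posW q_inj m8 hg uW t20 opt2 noise2.
rewrite -/kappa -/S => ref_err.
have n4 : n%:R = 4 * m%:R :> R by rewrite nE natrM.
have ln0 : 0 <= ln n%:R :> R by rewrite ln_ge0 // ler1n.
have D_le : (torus_dist m zi (g u))%:R <= refinement_const c_e c_l c_L Ce * L.
  apply: (refinement_const_bound cl0 clL mR L0 etaL (eps := eps)
    (sq := Num.sqrt (ln n%:R) * Num.sqrt m%:R) (kappa := kappa) (T := T) (S := S%:R)).
  - rewrite /eps -n4; congr (_ * _).
    have -> : ln n%:R / n%:R = (n%:R * ln n%:R) / n%:R ^+ 2 :> R by field; rewrite gt_eqF.
    by rewrite sqrtrM ?mulr_ge0 // sqrtrV ?exprn_ge0 // sqrtr_sqr gtr0_norm.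
  - by rewrite -sqrtrM // ler_wsqrtr // mulrC ler_wpM2r // ler_nat nE leq_pmull.
  - by rewrite -n4.
  - by rewrite -n4.
  - exact: Sle.
  - by rewrite -n4 (mulrA 8).
have angle1 : near_angle (2 * pi * zi%:R / m%:R) (2 * pi * (g u)%:R / m%:R)
    (2 * pi / m%:R * (refinement_const c_e c_l c_L Ce * L)).
  apply: near_angle_le (near_gdist _ _); rewrite grid0 ?(ltnW (ltn_ord _)) //.
  by rewrite ler_pM2l.
have angle2 : @near_angle R (2 * pi * (g u)%:R / m%:R)
    (2 * pi * k%:R / m%:R + (-1) ^+ b * (2 * pi * u%:R / m%:R)) 0.
  exact: hk.
have angle3 : @near_angle R (2 * pi * k%:R / m%:R + (-1) ^+ b * (2 * pi * u%:R / m%:R))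
    (2 * pi * k%:R / m%:R + (-1) ^+ b * (2 * pi * (p i)%:R / n%:R)) (2 * pi * eta%:R / n%:R).
  apply: near_angle_shift; apply: near_angle_sign; exists 0; rewrite mulr0 subr0.
  have w0 : 0 < 2 * pi / n%:R :> R by rewrite divr_gt0 ?mulr_gt0.
  have -> : 2 * pi * u%:R / m%:R - 2 * pi * (p i)%:R / n%:R
      = 2 * pi / n%:R * ((4 * u)%:R - (p i)%:R) :> R.
    by rewrite n4 natrM; move: (pi : R) => v; field; rewrite gt_eqF.
  rewrite normrM (gtr0_norm w0) normrB_nat (mulrAC _ eta%:R) ler_pM2l //.
  by rewrite ler_nat; exact: nat_closeP.
exists (2 * pi * zi%:R / m%:R); first by rewrite zE hE.
apply: near_angle_le (near_angle_trans angle1 (near_angle_trans angle2 angle3)).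
rewrite n4 le_eqVlt; apply/orP; left; apply/eqP; move: (pi : R) => v; field.
by rewrite gt_eqF.
Qed.
End HalfEstimate.

(** * Measurability and independence *)

Section FinitelyValued.
Context d (T : measurableType d).

(** For a finite range level sets suffice, and the Borel conditions of [localizer] are also stated
    on level sets. *)
Definition finmeas (X : finType) (f : T -> X) : Prop :=
  forall x, measurable [set w | f w = x].

Lemma finmeas_pred (X : finType) (f : T -> X) (Q : X -> Prop) :
  finmeas f -> measurable [set w | Q (f w)].
Proof.
move=> mf; have -> : [set w | Q (f w)] = \bigcup_(x in [set x | Q x]) [set w | f w = x].
  apply/seteqP; split=> w /=; first by move=> Qw; exists (f w).
  by move=> [x Qx ->].
apply: fin_bigcup_measurable => [|x _]; [exact: finite_finset | exact: mf].
Qed.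

Lemma finmeas_comp (X Y : finType) (f : T -> X) (g : X -> Y) :
  finmeas f -> finmeas (fun w => g (f w)).
Proof. by move=> mf y; exact: (finmeas_pred (fun x => g x = y)). Qed.

Lemma finmeas_bind (X Y : finType) (f : T -> X) (g : X -> T -> Y) :
  finmeas f -> (forall x, finmeas (g x)) -> finmeas (fun w => g (f w) w).
Proof.
move=> mf mg y.
have -> : [set w | g (f w) w = y] = \bigcup_(x in setT) ([set w | f w = x] `&` [set w | g x w = y]).
  apply/seteqP; split=> w /=; first by move=> e; exists (f w).
  by move=> [x _ [/= -> ->]].
apply: fin_bigcup_measurable => [|x _]; first exact: finite_finset.
by apply: measurableI; [exact: mf | exact: mg].
Qed.

Lemma finmeas_ffun (I X : finType) (f : I -> T -> X) :
  (forall i, finmeas (f i)) -> finmeas (fun w => [ffun i => f i w]).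
Proof.
move=> mf x.
have -> : [set w | [ffun i => f i w] = x] = \bigcap_(i in setT) [set w | f i w = x i].
  apply/seteqP; split=> w /=; first by move=> <- i _; rewrite ffunE.
  by move=> h; apply/ffunP => i; rewrite ffunE; exact: h.
by apply: fin_bigcap_measurable => [|i _]; [exact: finite_finset | exact: mf].
Qed.

End FinitelyValued.

Section FiniteUnions.
Context d (T : measurableType d) (R : realType) (P : probability T R).

Lemma measure_union_le (I : finType) (F : I -> set T) (c : I -> R) (Q : pred I) :
  (forall i, Q i -> measurable (F i)) -> (forall i, Q i -> (P (F i) <= (c i)%:E)%E) ->
  (P (\bigcup_(i in [set i | Q i]) F i) <= (\sum_(i | Q i) c i)%:E)%E.
Proof.
move=> mF hc; have -> : \bigcup_(i in [set i | Q i]) F i = \big[setU/set0]_(i | Q i) F i.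
  apply/seteqP; split=> w /=.
    by move=> [i /= Qi Fiw]; rewrite (bigD1 i) //=; left.
  by elim/big_rec: _ => // i A Qi ih [Fi|/ih //]; exists i.
suff [] : measurable (\big[setU/set0]_(i | Q i) F i) /\
  (P (\big[setU/set0]_(i | Q i) F i) <= (\sum_(i | Q i) c i)%:E)%E by [].
elim/big_rec2: _ => [|i y A Qi [mA hA]]; first by rewrite measure0.
split; first by apply: measurableU => //; exact: mF.
apply: le_trans (measureU2 P (mF _ Qi) mA) _.
by rewrite EFinD leeD // hc.
Qed.

Lemma measure_level_sets (I : finType) (f : T -> I) (H : set T) :
  finmeas f -> measurable H -> P H = (\sum_i P (H `&` [set w | f w = i]))%E.
Proof.
move=> mf mH.
have seq_case (r : seq I) : uniq r -> measurable (H `&` [set w | f w \in r]) /\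
    P (H `&` [set w | f w \in r]) = (\sum_(i <- r) P (H `&` [set w | f w = i]))%E.
  elim: r => [|i r ih] /=.
    by rewrite big_nil (_ : _ `&` _ = set0) ?measure0 // -subset0 => w [].
  move=> /andP[ir /ih[mr hr]].
  have mi : measurable (H `&` [set w | f w = i]) by apply: measurableI => //; exact: mf.
  have -> : H `&` [set w | f w \in i :: r] =
      (H `&` [set w | f w = i]) `|` (H `&` [set w | f w \in r]).
    rewrite -setIUr; congr (_ `&` _); apply/seteqP; split=> w /=; rewrite inE.
      by move=> /orP[/eqP|]; [left|right].
    by case=> [->|->]; rewrite ?eqxx ?orbT.
  split; first exact: measurableU.
  have -> : (P ((H `&` [set w | f w = i]) `|` (H `&` [set w | f w \in r])) =
      P (H `&` [set w | f w = i]) + P (H `&` [set w | f w \in r]))%E.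
    rewrite measureU //.
    by rewrite -subset0 => w [[_ /= ->] [_ /=]]; rewrite (negPf ir).
  by rewrite hr big_cons.
have [_ <-] := seq_case _ (index_enum_uniq I).
by congr (P _); apply/seteqP; split=> w /=; [rewrite mem_index_enum | case].
Qed.

Lemma sum_level_sets (I : finType) (f : T -> I) : finmeas f ->
  \sum_i fine (P [set w | f w = i]) = 1.
Proof.
move=> mf; apply: EFin_inj; rewrite -sumEFin -(probability_setT P).
rewrite (measure_level_sets mf measurableT); apply: eq_bigr => i _.
by rewrite setTI fineK // fin_num_measure //; exact: mf.
Qed.

(** Independence from a fixed event survives complements and countable disjoint unions, so it passes
    from a pi-system to the sigma-algebra it generates. *)
Lemma independent_dynkin (G : set T) (C : set (set T)) :
  measurable G -> setI_closed C -> C `<=` measurable ->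
  (forall H, C H -> P (G `&` H) = (P G * P H)%E) ->
  forall H, <<s C >> H -> P (G `&` H) = (P G * P H)%E.
Proof.
move=> mG CI Cm hC H.
rewrite -setI_closed_g_dynkin_g_sigma_algebra // => dH.
suff [] : measurable H /\ P (G `&` H) = (P G * P H)%E by [].
apply: (dH [set H | measurable H /\ P (G `&` H) = (P G * P H)%E]); split; last first.
  by move=> K CK; split; [exact: Cm | exact: hC].
have Gfin := fin_num_measure P _ mG.
split.
- by split; [exact: measurableT | rewrite setIT probability_setT mule1].
- move=> K [mK hK]; split; first exact: measurableC.
  have -> : (P (G `&` ~` K) = P G - P (G `&` K))%E.
    by rewrite -setDE measureD // ltey_eq Gfin.
  rewrite hK probability_setC // muleBr ?mule1 //.
- move=> K tK hK; split; first by apply: bigcupT_measurable => k; case: (hK k).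
  rewrite setI_bigcupr measure_bigcup //; last first.
  + by apply: trivIset_setIl.
  + by move=> k _; apply: measurableI => //; case: (hK k).
  rewrite measure_bigcup //; last by move=> k _; case: (hK k).
  rewrite -(fineK Gfin) -nneseriesZl //.
  by apply: eq_eseriesr => k _; rewrite fineK //; case: (hK k).
Qed.
End FiniteUnions.

Section NoiseSigmaAlgebra.
Context d (Omega : measurableType d) (R : realType) (P : probability Omega R).
Variables (n : nat) (E : 'I_n -> 'I_n -> {RV P >-> R}).
Implicit Types U V : rel 'I_n.

Definition noise_gen U : set (set Omega) :=
  [set G | exists (i j : 'I_n) (B : set R),
    [/\ (i < j)%N, U i j, measurable B & G = E i j @^-1` B]].

Lemma noise_gen_measurable U : <<s noise_gen U >> `<=` measurable.
Proof.
apply: smallest_sub; first exact: sigma_algebra_measurable.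
move=> _ [i [j [B [_ _ mB ->]]]].
by rewrite -[X in measurable X]setTI; exact: measurable_funP.
Qed.

Lemma noise_gen_events U : <<s noise_gen U >> `<=` noise_events E.
Proof.
by apply: sub_sigma_algebra2 => _ [i [j [B [ij _ mB ->]]]]; exists i, j, B.
Qed.

Lemma noise_events_measurable : noise_events E `<=` measurable.
Proof.
apply: (subset_trans _ (@noise_gen_measurable (fun _ _ => true))).
by apply: sub_sigma_algebra2 => _ [i [j [B [ij mB ->]]]]; exists i, j, B.
Qed.

Definition noise_rect U (B : 'I_n -> 'I_n -> set R) : set Omega :=
  [set w | forall i j : 'I_n, (i < j)%N -> U i j -> B i j (E i j w)].

Let rects U : set (set Omega) :=
  [set G | exists2 B, (forall i j, measurable (B i j)) & G = noise_rect U B].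

Lemma noise_rect_event U B : (forall i j, measurable (B i j)) ->
  <<s noise_gen U >> (noise_rect U B).
Proof.
move=> mB.
suff: @measurable _ (g_sigma_algebraType (noise_gen U)) (noise_rect U B) by [].
have -> : noise_rect U B = \bigcap_(ij in [set ij : 'I_n * 'I_n | (ij.1 < ij.2)%N && U ij.1 ij.2])
    (E ij.1 ij.2 @^-1` B ij.1 ij.2).
  apply/seteqP; split=> w /= h.
    by move=> [i j] /= /andP[ij Uij]; exact: h.
  by move=> i j ij Uij; apply: (h (i, j)); rewrite /= ij.
apply: fin_bigcap_measurable => [|[i j] /= /andP[ij Uij]]; first exact: finite_finset.
by apply: sub_sigma_algebra; exists i, j, (B i j).
Qed.

Lemma noise_gen_rects U : <<s noise_gen U >> `<=` <<s rects U >>.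
Proof.
apply: sub_sigma_algebra2 => _ [i [j [B [ij Uij mB ->]]]].
exists (fun a b => if (a == i) && (b == j) then B else setT).
  by move=> a b; case: ifP.
apply/seteqP; split=> w /=.
  by move=> h a b _ _; case: ifP => // /andP[/eqP -> /eqP ->].
by move/(_ i j ij Uij); rewrite !eqxx.
Qed.

Lemma rects_setI U : setI_closed (rects U).
Proof.
move=> _ _ [B mB ->] [B' mB' ->]; exists (fun i j => B i j `&` B' i j).
  by move=> i j; exact: measurableI.
apply/seteqP; split=> w /=; first by move=> [h h'] i j ij Uij; split; [exact: h|exact: h'].
by move=> h; split=> i j ij Uij; case: (h i j ij Uij).
Qed.

Hypothesis E_indep : independent_noise E.

(** Unconstrained entries receive the full set, so the product rule applies to both rectangles and
    to their intersection; in each factor one of the two sides is trivial. *)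
Lemma noise_rect_indep U V B B' : (forall i j, U i j -> ~~ V i j) ->
  (forall i j, measurable (B i j)) -> (forall i j, measurable (B' i j)) ->
  (P (noise_rect U B `&` noise_rect V B') = P (noise_rect U B) * P (noise_rect V B'))%E.
Proof.
move=> UV mB mB'.
pose BU i j := if U i j then B i j else setT.
pose BV i j := if V i j then B' i j else setT.
have mBU i j : measurable (BU i j) by rewrite /BU; case: ifP.
have mBV i j : measurable (BV i j) by rewrite /BV; case: ifP.
have eU : noise_rect U B = [set w | forall i j : 'I_n, (i < j)%N -> BU i j (E i j w)].
  apply/seteqP; split=> w /= h i j ij; rewrite /BU; first by case: ifP => // Uij; exact: h.
  by move=> Uij; have := h i j ij; rewrite /BU Uij.
have eV : noise_rect V B' = [set w | forall i j : 'I_n, (i < j)%N -> BV i j (E i j w)].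
  apply/seteqP; split=> w /= h i j ij; rewrite /BV; first by case: ifP => // Vij; exact: h.
  by move=> Vij; have := h i j ij; rewrite /BV Vij.
have eUV : noise_rect U B `&` noise_rect V B' =
    [set w | forall i j : 'I_n, (i < j)%N -> (BU i j `&` BV i j) (E i j w)].
  rewrite eU eV; apply/seteqP; split=> w /=.
    by move=> [h h'] i j ij; split; [exact: h | exact: h'].
  by move=> h; split=> i j ij; case: (h i j ij).
have mI i j : measurable (BU i j `&` BV i j) by exact: measurableI.
rewrite eUV eU eV (E_indep mI) (E_indep mBU) (E_indep mBV).
rewrite -big_split /=; apply: eq_bigr => -[i j] /= _.
rewrite /BU /BV; case: ifP => Uij; last by rewrite setTI preimage_setT probability_setT mul1e.
by rewrite (negPf (UV _ _ Uij)) setIT preimage_setT probability_setT mule1.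
Qed.

(** The Dynkin argument is run twice, enlarging one side at a time from rectangles. *)
Lemma noise_indep U V G H : (forall i j, U i j -> ~~ V i j) ->
  <<s noise_gen U >> G -> <<s noise_gen V >> H -> (P (G `&` H) = P G * P H)%E.
Proof.
move=> UV sG sH.
have rm W : rects W `<=` measurable.
  by move=> _ [B mB ->]; apply: (@noise_gen_measurable W); exact: noise_rect_event.
apply: (independent_dynkin (noise_gen_measurable sG) (@rects_setI V)) => //; last first.
  exact: noise_gen_rects.
move=> _ [B' mB' ->]; rewrite setIC muleC.
apply: (independent_dynkin _ (@rects_setI U)) => //; last exact: noise_gen_rects.
  by apply: rm; exists B'.
move=> _ [B mB ->]; rewrite setIC muleC; exact: noise_rect_indep.
Qed.

End NoiseSigmaAlgebra.

(** * Noise bounds *)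

Lemma sum_offdiag (R : realType) n (G : 'I_n -> 'I_n -> R) :
  (forall i, G i i = 0) ->
  \sum_i \sum_j G i j = \sum_(i < n) \sum_(j < n | (i < j)%N) (G i j + G j i).
Proof.
move=> G0.
have -> : \sum_i \sum_j G i j = \sum_(i < n) \sum_(j < n | (i < j)%N) G i j
    + \sum_(i < n) \sum_(j < n | (j < i)%N) G i j.
  rewrite -big_split /=; apply: eq_bigr => i _.
  rewrite (bigID (fun j : 'I_n => (i < j)%N)) /=; congr (_ + _).
  rewrite [RHS]big_mkcond [LHS]big_mkcond; apply: eq_bigr => j _.
  by rewrite -leqNgt leq_eqVlt; case: eqP => [/ord_inj ->|] //=; rewrite ltnn G0.
rewrite [X in _ + X](exchange_big_dep xpredT) //= -big_split /=.
by apply: eq_bigr => i _; rewrite -big_split.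
Qed.

Lemma finmeas_grid_index (R : realType) d (T : measurableType d) m (m0 : (0 < m)%N)
    (v : T -> 'cV[R]_2) :
  (forall w, v w = grid_point R m (grid_index m0 (v w))) ->
  (forall l : 'I_m, measurable [set w | v w = grid_point R m l]) ->
  finmeas (fun w => grid_index m0 (v w)).
Proof.
move=> vE mv h.
have -> : [set w | grid_index m0 (v w) = h] =
    \bigcup_(l in [set l : 'I_m | grid_index m0 (grid_point R m l) = h])
      [set w | v w = grid_point R m l].
  apply/seteqP; split=> w /=; last by move=> [l /= <- ->].
  by move=> e; exists h => /=; rewrite -?e -vE.
by apply: fin_bigcup_measurable => [|l _]; [exact: finite_finset | exact: mv].
Qed.

Section NoisyMatrix.
Context d (Omega : measurableType d) (R : realType) (P : probability Omega R).
Variables (n : nat) (E : 'I_n -> 'I_n -> {RV P >-> R}).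
Variables (F : 'M[R]_n) (A : Omega -> 'M[R]_n).
Hypotheses (F_sym : F^T = F) (A_sym : forall w, (A w)^T = A w).
Hypothesis A_diag : forall w i, A w i i = 0.
Hypothesis A_signal : forall w (i j : 'I_n), (i < j)%N -> A w i j = F i j + E i j w.
Implicit Type U : rel 'I_n.

Lemma A_symE w i j : A w i j = A w j i.
Proof. by rewrite -[in LHS](A_sym w) mxE. Qed.

Lemma F_symE i j : F i j = F j i.
Proof. by rewrite -[in LHS]F_sym mxE. Qed.

Local Notation sigT U := (g_sigma_algebraType (noise_gen E U)).

Lemma A_entry_measurable U (i j : 'I_n) (B : set R) :
  (forall a b : 'I_n, (a < b)%N -> (a == i) && (b == j) || (a == j) && (b == i) -> U a b) ->
  measurable B -> @measurable _ (sigT U) [set w | B (A w i j)].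
Proof.
move=> hU mB.
have sh (a b : 'I_n) : (a < b)%N -> U a b ->
    @measurable _ (sigT U) [set w | B (A w a b)].
  move=> ab Uab; apply: sub_sigma_algebra; exists a, b, ((fun x => F a b + x) @^-1` B).
  split=> //; last by apply/seteqP; split=> w /=; rewrite A_signal.
  have mf : measurable_fun [set: R] (fun x : R => F a b + x).
    by apply: measurable_funD; [exact: measurable_cst | exact: measurable_id].
  by rewrite -[X in measurable X]setTI; apply: mf.
have [ij|ji|e] := ltngtP i j.
- by apply: sh => //; apply: hU; rewrite ?eqxx.
- have -> : [set w | B (A w i j)] = [set w | B (A w j i)].
    by apply/seteqP; split=> w /=; rewrite A_symE.
  by apply: sh => //; apply: hU; rewrite ?eqxx ?orbT.
- have -> : [set w | B (A w i j)] = [set w | B 0].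
    by apply/seteqP; split=> w /=; rewrite (ord_inj e) A_diag.
  have [B0|B0] := pselect (B 0).
    by rewrite (_ : [set _ | _] = setT) //; apply/seteqP; split.
  by rewrite (_ : [set _ | _] = set0) //; apply/seteqP; split.
Qed.

Lemma block_measurable U (S T : {set 'I_n}) (G : set 'M[R]_n) :
  (forall a b : 'I_n, (a < b)%N -> (a \in S) && (b \in T) || (a \in T) && (b \in S) -> U a b) ->
  mx_borel G -> @measurable _ (sigT U) [set w | G (block S T (A w))].
Proof.
move=> hU; move: G; apply: smallest_sub => [|G [i [j [B [mB ->]]]]] /=.
  split.
  - exact: measurable0.
  - move=> G mG /=; rewrite (_ : mkset _ = ~` [set w | G (block S T (A w))]).
      exact: (@measurableC _ (sigT U)).
    by apply/seteqP; split=> w /=; [case | split].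
  - by move=> G mG /=; exact: (@bigcupT_measurable _ (sigT U) (fun k => [set w | G k (block S T (A w))])).
have [/andP[iS jT]|ij] := boolP ((i \in S) && (j \in T)).
  rewrite (_ : [set _ | _] = [set w | B (A w i j)]); last first.
    by apply/seteqP; split=> w /=; rewrite mxE iS jT.
  apply: A_entry_measurable => // a b ab h; apply: hU => //.
  by case/orP: h => /andP[/eqP -> /eqP ->]; rewrite iS jT ?orbT.
rewrite (_ : [set _ | _] = [set w | B 0]); last first.
  by apply/seteqP; split=> w /=; rewrite mxE (negPf ij).
have [B0|B0] := pselect (B 0).
  by rewrite (_ : [set _ | _] = setT) //; apply/seteqP; split.
by rewrite (_ : [set _ | _] = set0) //; apply/seteqP; split.
Qed.

Definition noise_sum (C : 'I_n -> 'I_n -> R) w := \sum_i \sum_j C i j * (A w i j - F i j).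

Lemma noise_sumE C w : (forall i, C i i = 0) ->
  noise_sum C w = \sum_(i < n) \sum_(j < n | (i < j)%N) (C i j + C j i) * E i j w.
Proof.
move=> C0; rewrite /noise_sum sum_offdiag; last by move=> i; rewrite C0 mul0r.
apply: eq_bigr => i _; apply: eq_bigr => j ij.
rewrite (A_symE w j i) (F_symE j i) -mulrDl A_signal //.
by rewrite addrAC subrr add0r.
Qed.

Lemma noise_sum_measurable U C (c : R) : (forall i, C i i = 0) ->
  (forall i j : 'I_n, (i < j)%N -> ~~ U i j -> C i j + C j i = 0) ->
  @measurable _ (sigT U) [set w | c < noise_sum C w].
Proof.
move=> C0 CU.
have -> : [set w | c < noise_sum C w] = setT `&`
   (fun w => \sum_(i < n) \sum_(j < n | (i < j)%N) (C i j + C j i) * E i j w) @^-1` `]c, +oo[%classic.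
  by apply/seteqP; split=> w /=; rewrite noise_sumE // in_itv /= andbT; [split | case].
suff mf : @measurable_fun _ _ (sigT U) R setT
  (fun w => \sum_(i < n) \sum_(j < n | (i < j)%N) (C i j + C j i) * E i j w).
  by apply: mf; [exact: measurableT | exact: measurable_itv].
rewrite (_ : (fun w => _) = (fun w => \sum_(i < n) \sum_(j < n)
    if (i < j)%N then (C i j + C j i) * E i j w else 0)); last first.
  by apply/funext => w; apply: eq_bigr => i _; rewrite big_mkcond.
apply: measurable_sum => i; apply: measurable_sum => j; case: (boolP (i < j)%N) => ij; last exact: measurable_cst.
have [Uij|Uij] := boolP (U i j); last first.
  rewrite (_ : (fun w => _) = cst 0); first exact: measurable_cst.
  by apply/funext => w; rewrite CU // mul0r.
apply: measurable_funM; first exact: measurable_cst.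
move=> _ Y mY; rewrite setTI; apply: sub_sigma_algebra.
by exists i, j, Y.
Qed.

Hypothesis E_sub : subgaussian1 E.

(** By symmetry [E i j] has coefficient [C i j + C j i]; the factor 2 in the threshold absorbs this
    doubling. *)
Lemma noise_sum_tail C (t c : R) : (forall i, C i i = 0) -> 0 <= t ->
  2 * t * Num.sqrt (\sum_i \sum_j C i j ^+ 2) <= c ->
  (P [set w | (c < noise_sum C w)%R] <= (expR (- t ^+ 2 / 2))%:E)%E.
Proof.
move=> C0 t0 hc; pose B : 'M[R]_n := \matrix_(i, j) (C i j + C j i).
have CU (i j : 'I_n) : (i < j)%N -> ~~ true -> C i j + C j i = 0 by [].
have BE w : \sum_(i < n) \sum_(j < n | (i < j)%N) B i j * E i j w = noise_sum C w.
  by rewrite noise_sumE //; apply: eq_bigr => i _; apply: eq_bigr => j _; rewrite mxE.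
have B_le : \sum_(i < n) \sum_(j < n | (i < j)%N) B i j ^+ 2 <= 2 ^+ 2 * \sum_i \sum_j C i j ^+ 2.
  rewrite [X in _ * X]sum_offdiag; last by move=> i; rewrite C0 expr0n.
  rewrite mulr_sumr; apply: ler_sum => i _; rewrite mulr_sumr; apply: ler_sum => j _.
  have := sqr_ge0 (C i j - C j i); have := sqr_ge0 (C i j); have := sqr_ge0 (C j i).
  by rewrite mxE; nra.
have {}hc : t * Num.sqrt (\sum_(i < n) \sum_(j < n | (i < j)%N) B i j ^+ 2) <= c.
  apply: le_trans hc; rewrite (mulrC 2) -mulrA ler_wpM2l //.
  by apply: le_trans (ler_wsqrtr B_le) _; rewrite sqrtrM // sqrtr_sqr ger0_norm.
apply: le_trans (E_sub B t0).
have -> : [set w | (\sum_(i < n) \sum_(j < n | (i < j)%N) B i j * E i j w >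
               t * Num.sqrt (\sum_(i < n) \sum_(j < n | (i < j)%N) B i j ^+ 2))%R] =
  [set w | (t * Num.sqrt (\sum_(i < n) \sum_(j < n | (i < j)%N) B i j ^+ 2) < noise_sum C w)%R].
  by apply/seteqP; split=> w /=; rewrite BE.
apply: le_measure; rewrite ?inE.
- exact: (noise_gen_measurable (noise_sum_measurable (U := fun _ _ => true) c C0 CU)).
- exact: (noise_gen_measurable (noise_sum_measurable (U := fun _ _ => true) _ C0 CU)).
- by move=> w /=; exact: le_lt_trans.
Qed.
End NoisyMatrix.

Lemma expR_mul_ln (R : realType) (n k : nat) : (0 < n)%N ->
  expR (- (k%:R * ln n%:R)) = (n%:R ^+ k)^-1 :> R.
Proof. by move=> n0; rewrite expRN expRM_natl lnK // posrE ltr0n. Qed.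

Section QuietEvents.
Context d (Omega : measurableType d) (R : realType) (P : probability Omega R).
Variables (n : nat) (E : 'I_n -> 'I_n -> {RV P >-> R}).
Variables (F : 'M[R]_n) (A : Omega -> 'M[R]_n).
Hypotheses (F_sym : F^T = F) (A_sym : forall w, (A w)^T = A w).
Hypothesis A_diag : forall w i, A w i i = 0.
Hypothesis A_signal : forall w (i j : 'I_n), (i < j)%N -> A w i j = F i j + E i j w.
Hypotheses (E_sub : subgaussian1 E) (E_indep : independent_noise E).
Variables (m : nat) (m0 : (0 < m)%N) (nE : n = (4 * m)%N).
Variable K : localizer R n m.
Let L : R := Num.sqrt (n%:R * ln n%:R).
Let n0 : (0 < n)%N. Proof. by rewrite nE; lia. Qed.
Implicit Type s : {set 'I_n}.

(** The sign is that of [quiet_sample], which bounds the opposite of the noise term. *)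
Definition inner_coef s (k : {ffun 'I_n -> 'I_m} * {ffun 'I_n -> 'I_m}) (i j : 'I_n) : R :=
  if (i \in s) && (j \in s)
  then - ((torus_dist m (k.1 i) (k.1 j))%:R - (torus_dist m (k.2 i) (k.2 j))%:R) else 0.

Definition outer_coef s (x : 'I_n -> 'I_m) (z : 'I_n * ('I_m * 'I_m)) (i j : 'I_n) : R :=
  if [&& i == z.1, i \notin s & j \in s]
  then - ((torus_dist m z.2.1 (x j))%:R - (torus_dist m z.2.2 (x j))%:R) else 0.

Definition exceeds (C : 'I_n -> 'I_n -> R) (t : R) : set Omega :=
  [set w | t * Num.sqrt (\sum_i \sum_j C i j ^+ 2) < noise_sum F A C w].

Lemma inner_coef_diag s k i : inner_coef s k i i = 0.
Proof. by rewrite /inner_coef; case: ifP => // _; rewrite !torus_dist0 subrr oppr0. Qed.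

Lemma outer_coef_diag s x z i : outer_coef s x z i i = 0.
Proof. by rewrite /outer_coef; case: ifP => // /and3P[_ /negPf ->]. Qed.

Let T_ (U : rel 'I_n) := g_sigma_algebraType (noise_gen E U).

Definition loud_sample s : set Omega :=
  \bigcup_(k in [set k | xpredT k]) exceeds (inner_coef s k) (4 * L).

Lemma loud_sample_quiet s w : ~ loud_sample s w -> quiet_sample m F (A w) s (4 * L).
Proof.
move=> nl k k' /=; rewrite leNgt; apply/negP => h; apply: nl; exists (k, k') => //=.
rewrite /exceeds /=.
have sE (G : 'I_n -> 'I_n -> R) : \sum_i \sum_j (if (i \in s) && (j \in s) then G i j else 0)
    = \sum_(i in s) \sum_(j in s) G i j.
  rewrite [RHS]big_mkcond; apply: eq_bigr => i _; case: (i \in s) => /=; last by rewrite big1.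
  by rewrite [RHS]big_mkcond.
have -> : \sum_i \sum_j inner_coef s (k, k') i j ^+ 2 =
   \sum_(i in s) \sum_(j in s) ((torus_dist m (k i) (k j))%:R - (torus_dist m (k' i) (k' j))%:R) ^+ 2.
  rewrite -sE; apply: eq_bigr => i _; apply: eq_bigr => j _.
  by rewrite /inner_coef; case: ifP => _ /=; rewrite ?sqrrN ?expr0n.
apply: lt_le_trans h _; rewrite -sE -sumrN le_eqVlt; apply/orP; left; apply/eqP.
apply: eq_bigr => i _; rewrite -sumrN; apply: eq_bigr => j _.
by rewrite /inner_coef; case: ifP => _ /=; [rewrite mulNr mulrC | rewrite oppr0 mul0r].
Qed.

Lemma exceeds_measurable U C t : (forall i, C i i = 0) ->
  (forall i j : 'I_n, (i < j)%N -> ~~ U i j -> C i j + C j i = 0) ->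
  @measurable _ (T_ U) (exceeds C t).
Proof. by move=> C0 CU; exact: noise_sum_measurable. Qed.

Lemma ln_n_ge0 : 0 <= ln n%:R :> R.
Proof. by rewrite ln_ge0 // ler1n. Qed.

Lemma loud_sample_event s : <<s noise_gen E (fun _ _ => true) >> (loud_sample s).
Proof.
suff : @measurable _ (T_ (fun _ _ => true)) (loud_sample s) by [].
apply: fin_bigcup_measurable => [|k _]; first exact: finite_finset.
by apply: exceeds_measurable => [i|//]; exact: inner_coef_diag.
Qed.

(** The tail bound at [t = 2 L] gives [n ^ (- 2 n)] per pair of maps; there are [m ^ (2 n)] pairs,
    and [m / n = 1 / 4]. *)
Lemma loud_sample_prob s : (P (loud_sample s) <= ((16 ^+ n)^-1)%:E)%E.
Proof.
apply: le_trans (measure_union_le (P := P) (c := fun=> (n%:R ^+ (2 * n))^-1) _ _) _.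
- move=> k _; apply: (noise_gen_measurable (U := fun _ _ => true)).
  by apply: exceeds_measurable => [i|//]; exact: inner_coef_diag.
- move=> k _; rewrite -expR_mul_ln //.
  have e : (2 * n)%:R * ln n%:R = (2 * L) ^+ 2 / 2 :> R.
    by rewrite exprMn sqr_sqrtr ?mulr_ge0 ?ln_n_ge0 // natrM; field.
  rewrite e -mulNr; apply: (noise_sum_tail F_sym A_sym A_signal E_sub (@inner_coef_diag _ _)).
    by rewrite mulr_ge0 ?sqrtr_ge0.
  by rewrite mulrA; have -> : 2 * 2 = 4 :> R by ring.
rewrite lee_fin sumr_const card_prod card_ffun !card_ord -[leLHS]mulr_natl.
have nR : n%:R = 4 * m%:R :> R by rewrite nE natrM.
rewrite -expnD addnn -mul2n natrX nR exprMn invfM mulrCA mulfV; last first.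
  by rewrite expf_neq0 // pnatr_eq0 -lt0n.
by rewrite mulr1 exprM; have -> : 4 ^+ 2 = 16 :> R by ring.
Qed.

(** The constant default outside [s] keeps this a function of the noise inside [s] alone. *)
Definition sample_index s w : {ffun 'I_n -> 'I_m} :=
  [ffun j => if j \in s then grid_index m0 (loc K s (block s s (A w)) j) else Ordinal m0].

Let inner s : rel 'I_n := fun i j => (i \in s) && (j \in s).
Let outer s : rel 'I_n := fun i j => (i \in s) (+) (j \in s).

Lemma sample_index_finmeas s : #|s| = m ->
  @finmeas _ (T_ (inner s)) _ (sample_index s).
Proof.
move=> sm; apply: (@finmeas_ffun _ (T_ (inner s))) => j.
case: (boolP (j \in s)) => js.
- apply: finmeas_grid_index.
    move=> w; have [h _] := locP K (block s s (A w)) sm.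
    by have [xE _] := Pi_grid_index m0 sm h; exact: xE.
  move=> l; apply: (block_measurable A_sym A_diag A_signal (U := inner s) _
    (loc_borel K sm js (grid_point R m l))).
  by move=> a b _; rewrite /inner orbb.
- move=> x; have [e|e] := eqVneq (Ordinal m0) x.
    by rewrite (_ : [set _ | _] = setT) //; apply/seteqP; split.
  by rewrite (_ : [set _ | _] = set0) //; apply/seteqP; split => // w /= h; rewrite h eqxx in e.
Qed.

Definition loud_outside_at s x : set Omega :=
  \bigcup_(z in [set z | xpredT z]) exceeds (outer_coef s x z) (8 * Num.sqrt (ln n%:R)).

Definition loud_outside s : set Omega :=
  [set w | loud_outside_at s (sample_index s w) w].

Lemma loud_outside_quiet s w : ~ loud_outside s w ->
  quiet_outside F (A w) s (fun j => grid_index m0 (loc K s (block s s (A w)) j))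
    (8 * Num.sqrt (ln n%:R)).
Proof.
move=> nl i z z' si /=; rewrite leNgt; apply/negP => h; apply: nl.
exists (i, (z, z')) => //=; rewrite /exceeds /=.
have sE (G : 'I_n -> 'I_n -> R) :
    \sum_a \sum_j (if [&& a == i, a \notin s & j \in s] then G a j else 0) = \sum_(j in s) G i j.
  rewrite (bigD1 i) //= [X in _ + X]big1 ?addr0.
    by rewrite [RHS]big_mkcond; apply: eq_bigr => j _; rewrite eqxx si.
  by move=> a /negPf ai; rewrite big1 // => j _; rewrite ai.
have X j : j \in s -> sample_index s w j = grid_index m0 (loc K s (block s s (A w)) j).
  by rewrite ffunE => ->.
have -> : \sum_a \sum_j outer_coef s (sample_index s w) (i, (z, z')) a j ^+ 2 =
   \sum_(j in s) ((torus_dist m z (grid_index m0 (loc K s (block s s (A w)) j)))%:R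
      - (torus_dist m z' (grid_index m0 (loc K s (block s s (A w)) j)))%:R) ^+ 2.
  rewrite -(sE (fun _ j => (_ - _) ^+ 2)); apply: eq_bigr => a _; apply: eq_bigr => j _.
  rewrite /outer_coef; case: ifP => [/and3P[_ _ js]|_] /=; last by rewrite expr0n.
  by rewrite sqrrN X.
apply: lt_le_trans h _; rewrite -(sE (fun a j => (A w a j - F a j) * _)).
rewrite -sumrN le_eqVlt; apply/orP; left; apply/eqP.
apply: eq_bigr => a _; rewrite -sumrN; apply: eq_bigr => j _.
rewrite /outer_coef; case: ifP => [/and3P[_ _ js]|_] /=; last by rewrite oppr0 mul0r.
by rewrite mulNr mulrC X.
Qed.

Lemma loud_outside_at_event s x : <<s noise_gen E (outer s) >> (loud_outside_at s x).
Proof.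
suff : @measurable _ (T_ (outer s)) (loud_outside_at s x) by [].
apply: fin_bigcup_measurable => [|z _]; first exact: finite_finset.
apply: exceeds_measurable => [i|i j _]; first exact: outer_coef_diag.
rewrite /outer /outer_coef; case: (i \in s); case: (j \in s) => //= _;
  by rewrite ?andbF ?addr0.
Qed.

(** The tail bound at [t = 4 sqrt (ln n)] gives [n ^ (- 8)] per comparison, and there are
    [n m^2 <= n^3] choices of an item and two grid points. *)
Lemma loud_outside_at_prob s x :
  (P (loud_outside_at s x) <= ((n%:R ^+ 5)^-1)%:E)%E.
Proof.
apply: le_trans (measure_union_le (P := P) (c := fun=> (n%:R ^+ 8)^-1) _ _) _.
- move=> z _; apply: (noise_gen_measurable (U := fun _ _ => true)).
  by apply: exceeds_measurable => [i|//]; exact: outer_coef_diag.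
- move=> z _; rewrite -expR_mul_ln //.
  have e : 8%:R * ln n%:R = (4 * Num.sqrt (ln n%:R)) ^+ 2 / 2 :> R.
    by rewrite exprMn sqr_sqrtr ?ln_n_ge0 //; field.
  rewrite e -mulNr; apply: (noise_sum_tail F_sym A_sym A_signal E_sub (@outer_coef_diag _ _ _)).
    by rewrite mulr_ge0 ?sqrtr_ge0.
  by rewrite mulrA; have -> : 2 * 4 = 8 :> R by ring.
rewrite lee_fin sumr_const !card_prod !card_ord -[leLHS]mulr_natl.
have nR : 0 < n%:R :> R by rewrite ltr0n.
have -> : (n%:R ^+ 5)^-1 = n%:R ^+ 3 * (n%:R ^+ 8)^-1 :> R by field; rewrite gt_eqF.
rewrite ler_wpM2r ?invr_ge0 ?exprn_ge0 // -natrX ler_nat expnS expnS expn1.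
by rewrite leq_mul2l leq_mul ?orbT // nE leq_pmull.
Qed.

(** Condition on the sample index: it depends on pairs inside [s], the outer noise on pairs with one
    end in [s]. By independence the bound for a frozen index holds on average. *)
Lemma loud_outside_bound s : #|s| = m ->
  noise_events E (loud_outside s) /\ (P (loud_outside s) <= ((n%:R ^+ 5)^-1)%:E)%E.
Proof.
move=> sm; have fm := sample_index_finmeas sm.
have fmO : finmeas (sample_index s) by move=> x; exact: (noise_gen_measurable (fm x)).
pose B x := [set w | sample_index s w = x] `&` loud_outside_at s x.
have BE : loud_outside s = \bigcup_(x in [set x | xpredT x]) B x.
  apply/seteqP; split=> w /=; first by move=> h; exists (sample_index s w).
  by move=> [x _ [/= <-]].
have evN : noise_events E (loud_outside s).
  suff : @measurable _ (T_ (fun _ _ => true)) (loud_outside s) by exact: noise_gen_events.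
  have mono U : <<s noise_gen E U >> `<=` <<s noise_gen E (fun _ _ => true) >>.
    by apply: sub_sigma_algebra2 => _ [i [j [G [ij _ mG ->]]]]; exists i, j, G.
  rewrite BE; apply: fin_bigcup_measurable => [|x _]; first exact: finite_finset.
  by apply: measurableI; apply: mono; [exact: fm | exact: loud_outside_at_event].
split => //; rewrite BE.
apply: le_trans (measure_union_le (P := P)
  (c := fun x => fine (P [set w | sample_index s w = x]) * (n%:R ^+ 5)^-1) _ _) _.
- move=> x _; apply: measurableI; first exact: fmO.
  exact: (noise_gen_measurable (@loud_outside_at_event _ _)).
- move=> x _.
  have ind : (P (B x) = P [set w | sample_index s w = x] * P (loud_outside_at s x))%E.
    have i1 : <<s noise_gen E (inner s) >> [set w | sample_index s w = x] := fm x.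
    apply: (noise_indep E_indep _ i1 (@loud_outside_at_event s x)).
    by move=> i j; rewrite /inner /outer => /andP[-> ->].
  rewrite ind EFinM fineK; last by apply: fin_num_measure; exact: fmO.
  by apply: lee_pmul => //; exact: loud_outside_at_prob.
by rewrite -mulr_suml (sum_level_sets P fmO) mul1r.
Qed.

End QuietEvents.

(** * High-probability bounds *)

(** The draw is uniform and independent of the noise events, so failures are averaged over samples:
    those in [bad] count in full, the others at most [delta]. *)
Lemma sampled_failure d (Omega : measurableType d) (R : realType) (P : probability Omega R)
    (n m : nat) (events : set (set Omega)) (X : Omega -> {set 'I_n})
    (N : {set 'I_n} -> set Omega) (bad : {set {set 'I_n}}) (delta : R) :
  (m <= n)%N -> 0 <= delta -> events `<=` measurable -> events setT ->
  (forall w, #|X w| = m) -> (forall s, measurable (X @^-1` [set s])) ->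
  (forall (s : {set 'I_n}) G, #|s| = m -> events G ->
    (P (G `&` X @^-1` [set s]) = ('C(n, m)%:R^-1)%:E * P G)%E) ->
  (forall s : {set 'I_n}, #|s| = m -> events (N s) /\ (P (N s) <= delta%:E)%E) ->
  exists B : set Omega, [/\ measurable B,
    (P B <= (delta + #|bad|%:R / 'C(n, m)%:R)%:E)%E &
    forall w, ~ B w -> X w \notin bad /\ ~ N (X w) w].
Proof.
move=> mn d0 evm evT Xm mX law hN.
have C0 : 0 < 'C(n, m)%:R :> R by rewrite ltr0n bin_gt0.
pose D (s : {set 'I_n}) := if s \in bad then setT else N s.
pose F (s : {set 'I_n}) := D s `&` X @^-1` [set s].
have evD (s : {set 'I_n}) : #|s| == m -> events (D s).
  by move=> /eqP sm; rewrite /D; case: ifP => // _; case: (hN s sm).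
have mF (s : {set 'I_n}) : #|s| == m -> measurable (F s).
  by move=> sm; apply: measurableI; [exact: evm (evD _ sm) | exact: mX].
pose c (s : {set 'I_n}) : R := 'C(n, m)%:R^-1 * (delta + (s \in bad)%:R).
have cF (s : {set 'I_n}) : #|s| == m -> (P (F s) <= (c s)%:E)%E.
  move=> sm; rewrite /F law ?(eqP sm) //; last exact: evD.
  rewrite /c EFinM lee_wpmul2l ?lee_fin ?invr_ge0 //.
  rewrite /D; case: ifP => _ /=; first by rewrite probability_setT lee_fin lerDr.
  by rewrite addr0; case: (hN s (eqP sm)).
exists (\bigcup_(s in [set s : {set 'I_n} | #|s| == m]) F s); split.
- by apply: fin_bigcup_measurable => [|s]; [exact: finite_finset | exact: mF].
- apply: le_trans (measure_union_le mF cF) _; rewrite lee_fin -mulr_sumr big_split /=.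
  rewrite mulrDr lerD //.
    have -> : \sum_(s : {set 'I_n} | #|s| == m) delta = 'C(n, m)%:R * delta.
      by rewrite sumr_const -[in RHS](card_ord n) -card_draws cardsE mulr_natl.
    by rewrite mulrA mulVf ?mul1r ?gt_eqF.
  rewrite mulrC ler_wpM2r ?invr_ge0 // -natr_sum ler_nat -[leqRHS]sum1_card [leqRHS]big_mkcond /=.
  rewrite [leqLHS]big_mkcond; apply: leq_sum => s _; by case: ifP => _; case: (s \in bad).
- move=> w nB; have wm := Xm w.
  have nF : ~ F (X w) w by move=> h; apply: nB; exists (X w) => //=; exact/eqP.
  split; first by apply/negP => h; apply: nF; split => //; rewrite /D h.
  by move=> h; apply: nF; split => //; rewrite /D; case: ifP.
Qed.

Section HalfEstimateIndex.
Context d (Omega : measurableType d) (R : realType) (P : probability Omega R).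
Variables (n : nat) (E : 'I_n -> 'I_n -> {RV P >-> R}).
Variables (F : 'M[R]_n) (A : Omega -> 'M[R]_n).
Hypothesis A_sym : forall w, (A w)^T = A w.
Hypothesis A_diag : forall w i, A w i i = 0.
Hypothesis A_signal : forall w (i j : 'I_n), (i < j)%N -> A w i j = F i j + E i j w.
Variables (m : nat) (m0 : (0 < m)%N).
Implicit Types (K : localizer R n m) (s : {set 'I_n}).

Definition half_index K s w : {ffun 'I_n -> 'I_m} :=
  [ffun i => grid_index m0 (half_estimate K (A w) s i)].

Lemma half_estimate_index K s w : #|s| = m ->
  half_estimate K (A w) s = fun i => grid_point R m (half_index K s w i).
Proof.
move=> sm; apply/funext => i; rewrite ffunE.
have [[h hm e] _] := refP K i (block [set i] s (A w)) (subtuple s (loc K s (block s s (A w)))) sm.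
have -> : half_estimate K (A w) s i = grid_point R m (Ordinal hm) by [].
by rewrite grid_indexK.
Qed.

Lemma block_measurableT (S T : {set 'I_n}) (G : set 'M[R]_n) :
  mx_borel G -> measurable [set w | G (block S T (A w))].
Proof.
move=> mG; apply: (noise_gen_measurable (E := E) (U := fun _ _ => true)).
exact: (block_measurable A_sym A_diag A_signal (U := fun _ _ => true)).
Qed.

Let sample_conf s (x : 'I_n -> 'I_m) : config R n :=
  fun i => if i \in s then grid_point R m (x i) else 0.

(** [ref] also depends on the localized sample; passing through the finite-valued [sample_index]
    allows freezing that argument before using [ref_borel]. *)
Lemma half_index_finmeas K s : #|s| = m -> finmeas (half_index K s).
Proof.
move=> sm; apply: finmeas_ffun => i.
have fx : finmeas (sample_index A m0 K s).
  by move=> x; apply: (noise_gen_measurable (E := E)); exact: (sample_index_finmeas A_sym A_diag A_signal).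
have -> : (fun w => grid_index m0 (half_estimate K (A w) s i)) =
   (fun w => grid_index m0 (ref K s i (block [set i] s (A w))
      (sample_conf s (sample_index A m0 K s w)))).
  apply/funext => w; rewrite /half_estimate; congr (grid_index _ (ref _ _ _ _ _)).
  apply/funext => j; rewrite /subtuple /sample_conf; case: ifP => // js.
  have [h _] := locP K (block s s (A w)) sm.
  by rewrite ffunE js; have [xE _] := Pi_grid_index m0 sm h; rewrite [LHS]xE.
apply: (finmeas_bind (g := fun (x : {ffun 'I_n -> 'I_m}) w => grid_index m0 (ref K s i (block [set i] s (A w))
      (sample_conf s x))) fx) => x.
apply: finmeas_grid_index => [w|l].
  have [[h hm ->] _] := refP K i (block [set i] s (A w)) (sample_conf s x) sm.
  by rewrite -/(grid_point R m (Ordinal hm)) grid_indexK.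
exact: (block_measurableT [set i]%SET s
  (ref_borel K sm i (sample_conf s x) (grid_point R m l))).
Qed.

End HalfEstimateIndex.

(** The output is a function of finite data, two samples and two index tuples, so every set of
    outputs has a measurable preimage, whatever the rule [align]. *)
Lemma localize_and_refine_measurable d (Omega : measurableType d) (R : realType)
    (P : probability Omega R) (n m : nat) (E : 'I_n -> 'I_n -> {RV P >-> R})
    (F : 'M[R]_n) (A : Omega -> 'M[R]_n) (S S' : Omega -> {set 'I_n})
    (K K' : localizer R n m) (al : aligner R n) (good : set (config R n)) :
  (0 < m)%N -> (forall w, (A w)^T = A w) -> (forall w i, A w i i = 0) ->
  (forall w (i j : 'I_n), (i < j)%N -> A w i j = F i j + E i j w) ->
  (forall w, #|S w| = m) -> (forall w, #|S' w| = m) -> finmeas S -> finmeas S' ->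
  measurable [set w | good (localize_and_refine K K' al (A w) (S w) (S' w))].
Proof.
move=> m0 A_sym A_diag A_signal Sm S'm fS fS'.
pose out (s s' : {set 'I_n}) (h h' : {ffun 'I_n -> 'I_m}) : config R n :=
  let x2 := fun i => grid_point R m (h i) in let x2' := fun i => grid_point R m (h' i) in
  let T := (~: s :&: ~: s')%SET in
  let Q := align al T (subtuple T x2) (subtuple T x2') in
  fun j => if j \in s then Q *m x2' j else x2 j.
pose idx (K : localizer R n m) (s : {set 'I_n}) w :=
  if #|s| == m then half_index A m0 K s w else [ffun=> Ordinal m0].
have fidx (K0 : localizer R n m) (s : {set 'I_n}) : finmeas (idx K0 s).
  rewrite /idx; case: eqP => [sm|_]; first exact: (half_index_finmeas A_sym A_diag A_signal).
  move=> x; have [e|e] := eqVneq [ffun=> Ordinal m0] x.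
    by rewrite (_ : [set _ | _] = setT) //; apply/seteqP; split.
  by rewrite (_ : [set _ | _] = set0) //; apply/seteqP; split => // w /= h; rewrite h eqxx in e.
have outE w : localize_and_refine K K' al (A w) (S w) (S' w) =
    out (S w) (S' w) (idx K (S w) w) (idx K' (S' w) w).
  rewrite /localize_and_refine /out /idx Sm S'm eqxx.
  by rewrite !(half_estimate_index A m0).
pose f w := ((S w, S' w), (idx K (S w) w, idx K' (S' w) w)).
have ff : finmeas f.
  have pair (X Y : finType) (a : Omega -> X) (b : Omega -> Y) :
      finmeas a -> finmeas b -> finmeas (fun w => (a w, b w)).
    move=> fa fb; apply: (finmeas_bind (g := fun x w => (x, b w)) fa) => x.
    exact: (finmeas_comp (fun y => (x, y)) fb).
  apply: (pair); first exact: pair.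
  by apply: (pair); [exact: (finmeas_bind fS) | exact: (finmeas_bind fS')].
have -> : [set w | good (localize_and_refine K K' al (A w) (S w) (S' w))] =
    [set w | (fun x => good (out x.1.1 x.1.2 x.2.1 x.2.2)) (f w)].
  by apply/seteqP; split=> w /=; rewrite outE.
exact: (finmeas_pred (fun x => good (out x.1.1 x.1.2 x.2.1 x.2.2)) ff).
Qed.

(** Sum over the ['C(n - m, m)] first samples disjoint from [s']: their number cancels the
    conditional weight of the second draw. Hence steps (A) and (B) fall under the same lemma. *)
Lemma second_draw_law d (Omega : measurableType d) (R : realType) (P : probability Omega R)
    (n m : nat) (E : 'I_n -> 'I_n -> {RV P >-> R}) (S S' : Omega -> {set 'I_n}) :
  n = (4 * m)%N -> uniform_draws E m S S' ->
  forall (s' : {set 'I_n}) G, #|s'| = m -> noise_events E G -> measurable G ->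
    (P (G `&` S' @^-1` [set s']) = ('C(n, m)%:R^-1)%:E * P G)%E.
Proof.
move=> nE [card mS mS' law1 law2] s' G s'm evG mG.
have fS : finmeas S by move=> s; exact: mS.
have mG' : measurable (G `&` S' @^-1` [set s']) by apply: measurableI => //; exact: mS'.
rewrite (measure_level_sets P fS mG').
rewrite (bigID (fun s : {set 'I_n} => (s \subset ~: s') && (#|s| == m))) /= [X in (_ + X)%E]big1 ?adde0; last first.
  move=> s hs; rewrite (_ : _ `&` _ = set0) ?measure0 // -subset0 => w [[_ /= Sw'] Sw].
  have [c1 c2 c3] := card w; move: hs; rewrite -Sw -Sw' c1 eqxx andbT.
  by rewrite finset.subsetC c3.
have c1 : ('C(n - m, m)%:R != 0 :> R) by rewrite pnatr_eq0 -lt0n bin_gt0 nE; lia.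
rewrite (eq_bigr (fun=> (('C(n - m, m)%:R^-1 * 'C(n, m)%:R^-1)%:E * P G)%E)); last first.
  move=> s /andP[ss' /eqP sm].
  rewrite -setIA [X in _ `&` X]setIC setIA law2 //; last by rewrite finset.subsetC.
  by rewrite law1 // muleA -EFinM.
have PG : P G = (fine (P G))%:E by rewrite fineK // fin_num_measure.
rewrite PG; under eq_bigr do rewrite -EFinM.
rewrite sumEFin -EFinM sumr_const -[_ *+ _]mulr_natl.
have -> : #|[pred s : {set 'I_n} | (s \subset ~: s') && (#|s| == m)]| = 'C(n - m, m).
  have -> : (n - m = #|~: s'|)%N by rewrite cardsCs finset.setCK s'm card_ord.
  by rewrite -cards_draws cardsE.
by congr (_%:E); field; rewrite c1 pnatr_eq0 -lt0n bin_gt0 nE; lia.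
Qed.

(** The terms account for noise inside the sample, noise outside it, and unbalanced samples. The two
    half-estimates together give [5 / n^2]. *)
Lemma failure_numerics (R : realType) (n : nat) (u : R) : (4 <= n)%N ->
  u <= (2 * n)%:R * (n.+1%:R * (n%:R ^+ 8)^-1) ->
  (16 ^+ n)^-1 + (n%:R ^+ 5)^-1 + u <= 5 / 2 / n%:R ^+ 2.
Proof.
move=> n4 hu; have nR : 4 <= n%:R :> R by rewrite ler_nat.
have n0 : 0 < n%:R :> R by apply: lt_le_trans nR.
have h1 : (16 ^+ n)^-1 <= (n%:R ^+ 2)^-1 :> R.
  rewrite lef_pV2 ?posrE ?exprn_gt0 //.
  have -> : 16 ^+ n = (4 ^+ n) ^+ 2 :> R by rewrite -exprM mulnC exprM; congr (_ ^+ n); ring.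
  rewrite ler_sqr ?nnegrE ?exprn_ge0 // -natrX ler_nat; exact: ltnW (ltn_expl _ _).
set v := (n%:R ^+ 2)^-1 in h1 *.
have v0 : 0 < v by rewrite invr_gt0 exprn_gt0.
have inv3 : (n%:R ^+ 3)^-1 <= 4^-1 :> R.
  rewrite lef_pV2 ?posrE ?exprn_gt0 //; nra.
have h2 : (n%:R ^+ 5)^-1 <= v / 2.
  have -> : (n%:R ^+ 5)^-1 = v * (n%:R ^+ 3)^-1 :> R by rewrite /v; field; rewrite gt_eqF.
  by rewrite ler_pM2l //; lra.
have h3 : (2 * n)%:R * (n.+1%:R * (n%:R ^+ 8)^-1) <= v.
  have -> : (2 * n)%:R * (n.+1%:R * (n%:R ^+ 8)^-1) =
      v * ((2 * (n%:R + 1) / n%:R ^+ 2) * (n%:R ^+ 3)^-1) :> R.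
    by rewrite /v natrM -natr1; field; rewrite gt_eqF.
  rewrite -[leRHS]mulr1 ler_pM2l //.
  have i3 : 0 <= (n%:R ^+ 3)^-1 :> R by rewrite invr_ge0 exprn_ge0.
  have q : 2 * (n%:R + 1) / n%:R ^+ 2 <= 1 :> R.
    by rewrite ler_pdivrMr ?exprn_gt0 //; nra.
  have := ler_wpM2r i3 q; lra.
lra.
Qed.

Section SampledEstimate.
Context d (Omega : measurableType d) (R : realType) (P : probability Omega R).
Variables (n m : nat) (nE : n = (4 * m)%N) (m8 : (8 <= m)%N).
Variables (E : 'I_n -> 'I_n -> {RV P >-> R}).
Variables (F : 'M[R]_n) (sigma : {perm 'I_n}) (A : Omega -> 'M[R]_n).
Hypotheses (F_sym : F^T = F) (A_sym : forall w, (A w)^T = A w).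
Hypothesis A_diag : forall w i, A w i i = 0.
Hypothesis A_signal : forall w (i j : 'I_n), (i < j)%N -> A w i j = F i j + E i j w.
Hypotheses (E_sub : subgaussian1 E) (E_indep : independent_noise E).
Variables (c_e c_l c_L : R) (c_e0 : 0 <= c_e) (cl0 : 0 < c_l) (clL : c_l <= c_L).
Hypothesis F_lip : bi_lipschitz c_l c_L (c_e * Num.sqrt (ln n%:R / n%:R))
  (\matrix_(i, j) F (sigma i) (sigma j)).
Let L : R := Num.sqrt (n%:R * ln n%:R).
Hypotheses (L1 : 1 <= L) (Ln : 8 * L <= n%:R).
Let n0 : (0 < n)%N. Proof. by rewrite nE; lia. Qed.

(** In fine steps: four times the coarse error, plus a rank mismatch [eta <= 17 L]. *)
Definition estimate_radius : R := (4 * refinement_const c_e c_l c_L 17 + 17) * L.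

Lemma half_estimate_whp (K : localizer R n m) (X : Omega -> {set 'I_n}) :
  (forall w, #|X w| = m) -> (forall s, measurable (X @^-1` [set s])) ->
  (forall (s : {set 'I_n}) G, #|s| = m -> noise_events E G ->
    (P (G `&` X @^-1` [set s]) = ('C(n, m)%:R^-1)%:E * P G)%E) ->
  exists B : set Omega, [/\ measurable B, (P B <= (5 / 2 / n%:R ^+ 2)%:E)%E &
    forall w, ~ B w -> exists (al : R) (o : bool), forall i, i \notin X w ->
      exists2 a, half_estimate K (A w) (X w) i = cis a &
        near_angle a (al + (-1) ^+ o * (2 * pi * ((sigma^-1)%g i)%:R / n%:R))
          (2 * pi * estimate_radius / n%:R)].
Proof.
move=> Xm mX law.
have m0 : (0 < m)%N by apply: leq_trans m8.
have nR : 0 < n%:R :> R by rewrite ltr0n.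
have L0 : 0 <= L by apply: le_trans L1.
pose p : 'I_n -> 'I_n := (sigma^-1)%g.
have p_inj : injective p by apply: perm_inj.
pose N (s : {set 'I_n}) := loud_sample F A m s `|` loud_outside F A m0 K s.
have evU (G G' : set Omega) : noise_events E G -> noise_events E G' -> noise_events E (G `|` G').
  move=> mG mG'; exact: (@measurableU _ (g_sigma_algebraType
    [set G | exists (i j : 'I_n) (B : set R), [/\ (i < j)%N, measurable B & G = E i j @^-1` B]])).
have hN (s : {set 'I_n}) : #|s| = m ->
    noise_events E (N s) /\ (P (N s) <= ((16 ^+ n)^-1 + (n%:R ^+ 5)^-1)%:E)%E.
  move=> sm.
  have ev1 : noise_events E (loud_sample F A m s).
    by apply: (noise_gen_events (U := fun _ _ => true)); exact: loud_sample_event.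
  have [ev2 P2] := loud_outside_bound F_sym A_sym A_diag A_signal E_sub E_indep m0 nE K sm.
  split; first exact: evU.
  apply: le_trans (measureU2 P (noise_events_measurable ev1) (noise_events_measurable ev2)) _.
  rewrite EFinD leeD //; exact: (loud_sample_prob F_sym A_sym A_signal E_sub m0 nE).
have delta0 : 0 <= (16 ^+ n)^-1 + (n%:R ^+ 5)^-1 :> R.
  by rewrite addr_ge0 // invr_ge0 exprn_ge0.
have evT : noise_events E setT.
  exact: (@measurableT _ (g_sigma_algebraType
    [set G | exists (i j : 'I_n) (B : set R), [/\ (i < j)%N, measurable B & G = E i j @^-1` B]])).
have mn : (m <= n)%N by rewrite nE leq_pmull.
(* The deviation [h = 4 L] makes the exponent [h^2 / (2 n)] equal to [8 ln n]. *)
have [B [mB PB hB]] := sampled_failure (unbalanced m p (4 * L)) mn delta0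
  (@noise_events_measurable _ _ _ _ _ E) evT Xm mX law hN.
exists B; split => //.
- apply: le_trans PB _; rewrite lee_fin.
  have h0 : 0 <= 4 * L by rewrite mulr_ge0.
  have hn : 4 * L <= n%:R / 2 by move: Ln; lra.
  have := card_unbalanced p_inj nE n0 h0 hn.
  have -> : (4 * L) ^+ 2 / (2 * n%:R) = 8%:R * ln n%:R.
    rewrite exprMn sqr_sqrtr; first by field; rewrite gt_eqF.
    by rewrite mulr_ge0 // ln_ge0 // ler1n.
  rewrite expR_mul_ln // => ub.
  have C0 : 0 < 'C(n, m)%:R :> R by rewrite ltr0n bin_gt0.
  have {}ub : #|unbalanced m p (4 * L)|%:R / 'C(n, m)%:R <= (2 * n)%:R * (n.+1%:R * (n%:R ^+ 8)^-1) :> R.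
    by rewrite ler_pdivrMr //; move: ub; rewrite -!mulrA [X in _ * (_ * X)]mulrC.
  by apply: failure_numerics ub; rewrite nE; move: m8; case: (m) => [|m'] //; rewrite mulnS leq_addr.
- move=> w /hB[bal quiet].
  (* Counts in the sample are multiplied by 4, so the deviation [4 L] becomes [16 L]; rounding up
     costs at most [L] because [1 <= L]. *)
  have [eta [eta_ge eta_le]] : exists eta : nat, 16 * L <= eta%:R /\ eta%:R <= 17 * L.
    exists `|Num.ceil (16 * L)|%N.
    rewrite natr_absz_norm ger0_norm; last by rewrite (le_trans _ (ceil_ge _)) // mulr_ge0.
    split; first exact: ceil_ge.
    have := ceilB1_lt (16 * L); rewrite intrB (_ : 1%:~R = 1) //.
    by move: L1 (_%:~R) => l1 e; lra.
  have eta4 : 4 * (4 * L) <= eta%:R by move: eta_ge; lra.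
  have eta3 : (3 <= eta)%N by rewrite -(ler_nat R); move: L1 eta_ge; lra.
  have sb j := balanced_close j (Xm w) bal eta4.
  have q1 : quiet_sample m F (A w) (X w) (4 * L).
    by apply: loud_sample_quiet => h; apply: quiet; left.
  have q2 := @loud_outside_quiet _ _ _ _ F A m m0 K (X w) w (fun h => quiet (or_intror h)).
  have [al [b h]] := half_estimate_accuracy nE m8 c_e0 cl0 clL F_lip (Xm w) sb eta3 eta_le q1 q2.
  exists al, b => i /h[a -> ha]; exists a => //.
  apply: near_angle_le ha; apply: ler_wpM2r; first by rewrite invr_ge0 ltW.
  apply: ler_wpM2l; first by rewrite mulr_ge0 ?pi_ge0.
  by rewrite /estimate_radius; move: eta_le; rewrite -/L; lra.
Qed.
End SampledEstimate.

Lemma refinement_const_ge0 (R : realType) (c_e c_l c_L Ce : R) :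
  0 <= c_e -> 0 < c_l -> c_l <= c_L -> 0 <= Ce -> 0 <= refinement_const c_e c_l c_L Ce.
Proof.
move=> ce0 cl0 clL Ce0; have pp := pi_ge0 R; have cL0 : 0 <= c_L := ltW (lt_le_trans cl0 clL).
have pc : 0 <= pi * c_l by rewrite mulr_ge0 // ltW.
have k1 : 0 <= mismatch_const c_e c_L Ce.
  by rewrite /mismatch_const; apply: addr_ge0; rewrite ?mulr_ge0.
have k2 : 0 <= localization_const c_e c_l c_L Ce.
  by rewrite /localization_const; apply: divr_ge0 => //; apply: addr_ge0; rewrite ?divr_ge0.
have c2 : 0 <= c_L * (pi / 2) by apply: mulr_ge0 => //; apply: divr_ge0.
have h1 : 0 <= 120 * localization_const c_e c_l c_L Ce + 2 * Ce.
  by apply: addr_ge0; apply: mulr_ge0.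
rewrite /refinement_const; apply: divr_ge0 => //; apply: mulr_ge0 => //.
have := mulr_ge0 c2 h1; lra.
Qed.

(** Just enough to get [1 <= n ln n] from [4 <= n]. *)
Lemma ln_ge_quarter (R : realType) (n : nat) : (4 <= n)%N -> 1 / 4 <= ln n%:R :> R.
Proof.
move=> n4; have nR : 4 <= n%:R :> R by rewrite ler_nat.
rewrite -ler_expR lnK ?posrE; last by apply: lt_le_trans nR.
have h : expR (1 / 4) <= 1 + 1 / 4 + 2 * (1 / 4) ^+ 2 :> R by apply: expR_le_quadratic; lra.
by apply: le_trans h _; lra.
Qed.

(* sigma maps positions to items, while rank_of estimates the position of item i:
   the position of i is sigma^-1 i, with label (sigma^-1 i) + 1 in {1, ..., n}.
   Positions live on the torus and are compared modulo n. *)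
Theorem corollary3p4 (R : realType) (c_e c_l c_L : R)
    (c_e_ge0 : 0 <= c_e) (c_l_gt0 : 0 < c_l) (c_l_le : c_l <= c_L) :
  exists C : R, 0 < C /\
  forall (n : nat) (n_gt0 : (0 < n)%N) (n_mult4 : (4 %| n)%N)
    (F : 'M[R]_n) (sigma : {perm 'I_n})
    (F_range : forall i j, 0 <= F i j <= 1) (F_sym : F^T = F)
    (F_toroidal : toroidal_R_matrix (\matrix_(i, j) F (sigma i) (sigma j)))
    (F_lip : bi_lipschitz c_l c_L (c_e * Num.sqrt (ln n%:R / n%:R))
               (\matrix_(i, j) F (sigma i) (sigma j)))
    (d : measure_display) (Omega : measurableType d) (P : probability Omega R)
    (E : 'I_n -> 'I_n -> {RV P >-> R})
    (E_indep : independent_noise E) (E_centered : centered_noise E)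
    (E_subgaussian : subgaussian1 E)
    (A : Omega -> 'M[R]_n)
    (A_sym : forall w, (A w)^T = A w)
    (A_diag : forall w i, A w i i = 0)
    (A_signal : forall w (i j : 'I_n), (i < j)%N -> A w i j = F i j + E i j w)
    (S S' : Omega -> {set 'I_n}) (SS'_uniform : uniform_draws E (n %/ 4) S S')
    (K K' : localizer R n (n %/ 4)) (al : aligner R n),
  ((1 - 5 / n%:R ^+ 2)%:E <=
   P [set w | exists2 tau : {perm 'I_n}, tau \in Gamma n &
       forall i : 'I_n,
         (torus_dist n (tau ((sigma^-1)%g i)).+1
            (rank_of n (localize_and_refine K K' al (A w) (S w) (S' w) i)))%:R
         <= C * Num.sqrt (n%:R * ln n%:R)]%R)%E.
Proof.
set KD := refinement_const c_e c_l c_L 17.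
have KD0 : 0 <= KD by exact: refinement_const_ge0.
(* Excluding the wrong orientation requires [5 (e + 1) < n / 2], where [e <= 8 rho + 1] and
   [rho = (4 KD + 17) L]. Since [1 <= L], this follows from [C L < n]; the final error [5 rho + 2]
   is far below [C L]. *)
pose C : R := 320 * KD + 1380.
exists C; split; first by rewrite /C; lra.
move=> n n_gt0 n_mult4 F sigma F_range F_sym _ F_lip d Omega P E E_indep _ E_sub
  A A_sym A_diag A_signal S S' draws K K' al.
set L := Num.sqrt (n%:R * ln n%:R).
set m := (n %/ 4)%N in draws K K' *.
have nE : n = (4 * m)%N by rewrite mulnC divnK.
have nR : 0 < n%:R :> R by rewrite ltr0n.
have n4 : (4 <= n)%N by exact: dvdn_leq.
set goal := mkset _.
(* Torus distances never exceed [n], so only [C L < n] needs work. *)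
have [big|small] := lerP n%:R (C * L).
  have -> : goal = setT.
    apply/seteqP; split=> w // _; exists 1%g => [|i]; first exact: group1.
    by apply: le_trans big; rewrite ler_nat; exact: torus_dist_le.
  by rewrite probability_setT lee_fin gerBl divr_ge0.
have ln4 := ln_ge_quarter R n4.
have L1 : 1 <= L.
  rewrite -sqrtr1 ler_wsqrtr //.
  have nR4 : 4 <= n%:R :> R by rewrite ler_nat.
  have := ler_pM (ler0n R 4) (ltW (_ : 0 < 1 / 4)) nR4 ln4; lra.
have C1380 : 1380 * L <= C * L by rewrite ler_wpM2r ?(le_trans _ L1) // /C; lra.
have m8 : (8 <= m)%N.
  have n1380 : (1380 < n)%N.
    by rewrite -(ltr_nat R); apply: le_lt_trans small; apply: le_trans C1380; lra.
  by rewrite /m leq_divRL // (leq_trans _ (ltnW n1380)).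
have Ln : 8 * L <= n%:R by apply: ltW; apply: le_lt_trans small; apply: le_trans C1380; lra.
have [card mS mS' law1 law2] := draws.
have Sm w : #|S w| = m by case: (card w).
have S'm w : #|S' w| = m by case: (card w).
have law2' (s : {set 'I_n}) G : #|s| = m -> noise_events E G ->
    (P (G `&` S' @^-1` [set s]) = ('C(n, m)%:R^-1)%:E * P G)%E.
  by move=> sm evG; apply: (second_draw_law nE draws) => //; exact: noise_events_measurable evG.
have [B [mB PB hB]] := half_estimate_whp nE m8 F_sym A_sym A_diag A_signal E_sub E_indep
  c_e_ge0 c_l_gt0 c_l_le F_lip L1 Ln K Sm mS law1.
have [B' [mB' PB' hB']] := half_estimate_whp nE m8 F_sym A_sym A_diag A_signal E_sub E_indep
  c_e_ge0 c_l_gt0 c_l_le F_lip L1 Ln K' S'm mS' law2'.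
have m0 : (0 < m)%N by exact: leq_trans m8.
have mgoal : measurable goal.
  exact: (localize_and_refine_measurable K K' al (fun x => exists2 tau : {perm 'I_n}, tau \in Gamma n &
       forall i : 'I_n, (torus_dist n (tau ((sigma^-1)%g i)).+1 (rank_of n (x i)))%:R
         <= C * Num.sqrt (n%:R * ln n%:R)) m0 A_sym A_diag A_signal Sm S'm mS mS').
have mBB : measurable (B `|` B') by exact: measurableU.
apply: (@le_trans _ _ (P (~` (B `|` B')))).
  rewrite probability_setC // EFinB leeB //.
  apply: le_trans (measureU2 P mB mB') _.
  have -> : 5 / n%:R ^+ 2 = 5 / 2 / n%:R ^+ 2 + 5 / 2 / n%:R ^+ 2 :> R by field; rewrite gt_eqF.
  by rewrite EFinD leeD.
apply: le_measure; rewrite ?inE //; first exact: measurableC.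
move=> w /= nBB.
have [a1 [b1 h1]] := hB w (fun h => nBB (or_introl h)).
have [a2 [b2 h2]] := hB' w (fun h => nBB (or_intror h)).
set rho := estimate_radius n c_e c_l c_L in h1 h2.
have rhoE : rho = (4 * KD + 17) * L by [].
have rho0 : 0 <= rho by rewrite rhoE mulr_ge0 ?(le_trans _ L1) //; lra.
pose r : R := 2 * pi * rho / n%:R.
have r0 : 0 <= r.
  by apply: divr_ge0 => //; apply: mulr_ge0 => //; rewrite mulr_ge0 ?pi_ge0.
(* The value of [E] in [alignment], whose condition reads [8 pi rho <= pi E] because
   [4 r n = 8 pi rho]. *)
have [e [e_ge e_le]] : exists e : nat, 8 * rho <= e%:R /\ e%:R <= 8 * rho + 1.
  exists `|Num.ceil (8 * rho)|%N.
  rewrite natr_absz_norm ger0_norm; last by rewrite (le_trans _ (ceil_ge _)) // mulr_ge0.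
  split; first exact: ceil_ge.
  have := ceilB1_lt (8 * rho); rewrite intrB (_ : 1%:~R = 1) //.
  by move: (_%:~R) => c; lra.
have [t tG ht] := Gamma_rank n_gt0 a1 b1.
have p_inj : injective ((sigma^-1)%g : 'I_n -> 'I_n) by exact: perm_inj.
have cardT : #|~: S w :&: ~: S' w| = (2 * m)%N.
  have [_ _ sub] := card w.
  rewrite -finset.setCU cardsCs finset.setCK card_ord cardsU Sm S'm.
  have -> : S w :&: S' w = finset.set0.
    by apply/eqP; rewrite finset.setI_eq0 disjoint_sym finset.disjoints_subset.
  by rewrite cards0 subn0 addnn -mul2n nE -mulnBl.
have e_n : 5 * (e%:R + 1) < (2 * m)%:R :> R.
  have n2 : n%:R = 2 * (2 * m)%:R :> R by rewrite -natrM mulnA -nE.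
  have := le_lt_trans (lexx (C * L)) small; rewrite n2 /C.
  by move: e_le; rewrite rhoE; lra.
have fin j : j \notin S' w -> exists2 b, align al (~: S w :&: ~: S' w)
    (subtuple (~: S w :&: ~: S' w) (half_estimate K (A w) (S w)))
    (subtuple (~: S w :&: ~: S' w) (half_estimate K' (A w) (S' w))) *m half_estimate K' (A w) (S' w) j = cis b
    & near_angle b (a1 + (-1) ^+ b1 * (2 * pi * ((sigma^-1)%g j)%:R / n%:R)) (5 * r).
  apply: (alignment n_gt0 p_inj (s := S w) (r := r) (E := e) (al' := a2) (o' := b2)).
  - by rewrite -(ltr_nat R); move: e_n; rewrite natrM nE !natrM; have := ler0n R m; lra.
  - have := ler_wpM2l (pi_ge0 R) e_ge; rewrite /r.
    by have -> : 4 * (2 * pi * rho / n%:R) * n%:R = pi * (8 * rho) by field; rewrite gt_eqF.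
  - exact: r0.
  - by rewrite cardT -(ltr_nat R) (natrM R 5) -[e.+1%:R]natr1.
  - exact: h1.
  - exact: h2.
  - set T := ~: S w :&: ~: S' w.
    set x2 := half_estimate K (A w) (S w); set x2' := half_estimate K' (A w) (S' w).
    (* The aligner receives tuples padded with zeros outside the overlap; [d_inf] does not see the
       padding. *)
    have dE Q : d_inf T x2 (fun i => Q *m x2' i) =
        d_inf T (subtuple T x2) (fun i => Q *m subtuple T x2' i).
      by apply: eq_bigr => i iT; rewrite /subtuple iT.
    have circ i : i \in T -> circle (subtuple T x2 i) /\ circle (subtuple T x2' i).
      move=> iT; rewrite /subtuple iT; move: iT; rewrite !inE => /andP[iS iS'].
      have [a xa _] := h1 _ iS; have [a' xa' _] := h2 _ iS'.
      by rewrite /x2 xa /x2' xa'; split; exact: circle_cis.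
    have [orth min] := alignP al circ.
    by split=> // Q Qorth; rewrite !dE; exact: min.
exists t => // i.
have [b xb hb] : exists2 b, localize_and_refine K K' al (A w) (S w) (S' w) i = cis b &
    near_angle b (a1 + (-1) ^+ b1 * (2 * pi * ((sigma^-1)%g i)%:R / n%:R)) (2 * pi * (5 * rho) / n%:R).
  rewrite /localize_and_refine; case: (boolP (i \in S w)) => iS.
    have iS' : i \notin S' w.
      have [_ _ sub] := card w; apply/negP => /(fintype.subsetP sub).
      by rewrite inE iS.
    have [b xb hb] := fin _ iS'; exists b => //.
    by apply: near_angle_le hb; rewrite /r; lra.
  have [b xb hb] := h1 _ iS; exists b => //.
  apply: near_angle_le hb; apply: ler_wpM2r; first by rewrite invr_ge0 ltW.
  by apply: ler_wpM2l; [rewrite mulr_ge0 ?pi_ge0 | lra].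
rewrite xb; apply: le_trans (ht _ _ _ hb) _.
by rewrite -/L /C rhoE; have := mulr_ge0 KD0 (le_trans ler01 L1); lra.
Qed.
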